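(* Suppose that a function $f(x)=f_{Kr}(x)$ with parameters $(\alpha,\beta,\gamma,\lambda)\in\mathbb{C}^4$, $\alpha\neq0$, satisfies the equation \[ \sum_{i=1}^{4}\ \prod_{1\le j\le 4,\ j\neq i}\frac1{f(x_j-x_i)}=0 \] (identically in $x_1,x_2,x_3,x_4$). Then \[ \gamma=4\alpha(4\alpha^2-3\beta),\qquad \lambda=4(32\alpha^4-24\alpha^2\beta+3\beta^2). \]
   Context: The function $f_{Kr}$. Let $\wp,\zeta,\sigma$ be the Weierstrass functions of a lattice in $\mathbb{C}$ with invariants $g_2,g_3$, let $z$ be a point not in the lattice, $\alpha\in\mathbb{C}$, and \[ f_{Kr}(x)=\frac{\sigma(x)\sigma(z)}{\sigma(z-x)}\exp(\alpha x-\zeta(z)x). \] The Taylor coefficients of $f_{Kr}$ at $x=0$ are polynomials with rational coefficients in $\alpha$, $\beta=\wp(z)$, $\gamma=\wp'(z)$, $\lambda=g_2$ (and $g_3=4\beta^3-\lambda\beta-\gamma^2$); these polynomials define $f_{Kr}$ for all $(\alpha,\beta,\gamma,\lambda)\in\mathbb{C}^4$, including degenerate values with $\Delta=g_2^3-27g_3^2=0$: \[ f_{Kr}(x)=x+\alpha x^2+(\alpha^2+\beta)\tfrac{x^3}{2}+(\alpha^3+3\alpha\beta-\gamma)\tfrac{x^4}{3!}+(5\alpha^4+30\alpha^2\beta+45\beta^2-20\alpha\gamma-3\lambda)\tfrac{x^5}{5!}+O(x^6). \] *)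

(* Defs.v *)
From HB Require Import structures.
From mathcomp Require Import all_boot all_order all_algebra.
From mathcomp Require Import all_classical all_reals all_analysis.
From mathcomp Require Import complex.
From mathcomp Require mpoly.

Set Implicit Arguments.
Unset Strict Implicit.
Unset Printing Implicit Defensive.

Import Order.TTheory GRing.Theory Num.Theory numFieldNormedType.Exports.
Local Open Scope classical_set_scope.
Local Open Scope ring_scope.

(* R[i] seen as a numClosedFieldType, so that it inherits the topology of the
   modulus; the bare type R[i] carries no topological structure. *)
Definition cplx (R : realType) : numClosedFieldType := R[i]%C.

Section Krichever.
Variable R : realType.
Local Notation C := (cplx R).

Definition cexp (z : C) : C :=
  (expR (complex.Re z))%:C%C *
  (cos (complex.Im z) +i* sin (complex.Im z))%C.

(* The lattice is Z w1 + Z w2 with w1, w2 linearly independent over the reals.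
   If w1 = 0 then w2 / w1 = 0, so the condition also forces w1 != 0. *)
Definition lattice_basis (w1 w2 : C) : Prop := 'Im (w2 / w1) != 0.

Definition in_lattice (w1 w2 z : C) : Prop :=
  exists m n : int, z = m%:~R * w1 + n%:~R * w2.

(* The nonzero points m w1 + n w2 with -N <= m, n <= N. Sums and products over
   the nonzero lattice points are limits over these squares; those below
   converge absolutely, so the order of summation is immaterial. *)
Definition lattice_box (w1 w2 : C) (N : nat) : seq C :=
  let I := [seq k%:Z - N%:Z | k <- iota 0 N.*2.+1] in
  [seq w <- [seq m%:~R * w1 + n%:~R * w2 | m <- I, n <- I] | w != 0].

Definition wsigma (w1 w2 x : C) : C :=
  x * limn (fun N => \prod_(w <- lattice_box w1 w2 N)
                       ((1 - x / w) * cexp (x / w + (x / w) ^+ 2 / 2))).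

Definition wzeta (w1 w2 x : C) : C :=
  x^-1 + limn (fun N => \sum_(w <- lattice_box w1 w2 N)
                          ((x - w)^-1 + w^-1 + x / w ^+ 2)).

Definition wp (w1 w2 x : C) : C :=
  x ^- 2 + limn (fun N => \sum_(w <- lattice_box w1 w2 N)
                            ((x - w) ^- 2 - w ^- 2)).

Definition g2 (w1 w2 : C) : C :=
  60 * limn (fun N => \sum_(w <- lattice_box w1 w2 N) w ^- 4).

Definition fKr_lattice (w1 w2 z alpha x : C) : C :=
  wsigma w1 w2 x * wsigma w1 w2 z / wsigma w1 w2 (z - x)
    * cexp (alpha * x - wzeta w1 w2 z * x).

Definition taylor_at0 (f : C -> C) (a : nat -> C) : Prop :=
  \forall x \near (0 : C), series (fun n => a n * x ^+ n) @ \oo --> f x.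

Definition eval4 (p : mpoly.mpoly 4 rat) (alpha beta gamma lambda : C) : C :=
  mpoly.mmap ratr
    (fun i : 'I_4 => [:: alpha; beta; gamma; lambda]`_i) p.

(* P n is the universal polynomial giving the n-th Taylor coefficient of f_Kr,
   for all (nondegenerate) lattices. It is unique because the points
   (alpha, wp z, wp' z, g2) are Zariski dense. *)
Definition fKr_polynomials (P : nat -> mpoly.mpoly 4 rat) : Prop :=
  forall w1 w2 z alpha : C,
    lattice_basis w1 w2 -> ~ in_lattice w1 w2 z ->
    taylor_at0 (fKr_lattice w1 w2 z alpha)
      (fun n => eval4 (P n) alpha (wp w1 w2 z) (derive1 (wp w1 w2) z) (g2 w1 w2)).

(* The germ at 0 of f is that of f_Kr with arbitrary, possibly degenerate,
   parameters. *)
Definition is_fKr (alpha beta gamma lambda : C) (f : C -> C) : Prop :=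
  exists P : nat -> mpoly.mpoly 4 rat, fKr_polynomials P /\
    taylor_at0 f (fun n => eval4 (P n) alpha beta gamma lambda).

(* The equation between germs: the denominators are required to be nonzero and
   the differences small. For meromorphic f this is equivalent, by analytic
   continuation, to the equation at all points where it makes sense. *)
Definition hirzebruch4 (f : C -> C) : Prop :=
  exists2 r : R, 0 < r &
    forall x : 'I_4 -> C,
      (forall i j, i != j -> `|x j - x i| < r%:C%C /\ f (x j - x i) != 0) ->
      \sum_(i < 4) \prod_(j < 4 | j != i) (f (x j - x i))^-1 = 0.

End Krichever.

(* Main.v *)
(* The equation at the points 0, t, 2t, 3t, with denominators cleared, is a cubic
   identity between the values F(kt), |k| <= 3, of F(x) = f(x)/x. Its coefficients
   of t^3 and t^5 are polynomial relations between the Taylor coefficients of f;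
   the first gives gamma and the second, since alpha <> 0, lambda.

   The universal polynomials are only known through their values at lattices.
   For t(Z + iyZ) with 1 <= y <= 2 and z near 0, collecting the factors of
   sigma(x), sigma(z), 1/sigma(z-x) and exp(-zeta(z)x) that belong to the same
   lattice point expresses the coefficients by the sums
   B_k(z) = z^-k + sum_w ((z-w)^-k - w^-k) for k <= 5, where B_2 = wp and
   B_3 = -wp'/2. Liouville's theorem is not needed for B_4 = B_2^2 - g2/10 and
   B_5 = B_2 B_3: since universal polynomials are assumed to exist, homogeneity
   under scaling dictates the shape of these identities, and the pole at z = 0
   then determines their constants.

   A polynomial vanishing at all (alpha, wp(z), wp'(z), g2) is zero: as z -> 0,
   wp -> oo while 4 wp^3 - g2 wp - wp'^2 -> g3, and for fixed g2 the invariant g3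
   takes infinitely many values, by the intermediate value theorem for
   |G_6|^2/|G_4|^3 between y = 1, where G_6 = 0, and y = 2. *)

Require Import Defs.
From mathcomp Require Import all_boot all_order all_algebra.
From mathcomp Require Import all_classical all_reals all_analysis.
From mathcomp Require Import complex ring lra zify.
From mathcomp Require mpoly.

Set Implicit Arguments.
Unset Strict Implicit.
Unset Printing Implicit Defensive.

Import Order.TTheory GRing.Theory Num.Theory numFieldNormedType.Exports.
Local Open Scope classical_set_scope.
Local Open Scope ring_scope.

(** * The complex modulus and limits *)

(** The argument never uses holomorphy. Every expansion, in x as well as in z, is an estimate O(x^n)
    on a punctured disc around 0, and coefficients are identified because a polynomial of degree
    less than n which is O(x^n) vanishes. Only the coefficients of f_Kr up to x^6 matter, so the
    logarithm of each factor is cut at degree 5 and every factor left over is 1 + O((x/w)^6).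
    Lattices with y >= 1 satisfy |m + n i y| >= max(|m|, |n|); all sums and products are therefore
    dominated by the single series of max(|m|, |n|)^-3. The scale t is kept free because it serves
    three purposes. As a variable, it turns homogeneity into a comparison of coefficients of
    polynomials in t. Chosen as a fourth root, it adjusts g2 to a prescribed nonzero value. Replaced
    by -t, it changes the sign of wp' and of nothing else, which separates the even and odd parts in
    gamma. *)

Section ComplexNorm.
Variable R : realType.
Local Notation C := (cplx R).

(* The norm of C takes values in C, where the order is only partial and lra does
   not apply. *)
Definition nrm (x : C) : R := complex.Re `|x|.

Lemma nrmE (x : C) : `|x| = (nrm x)%:C%C.
Proof. by rewrite /nrm /Num.norm /=. Qed.

Lemma nrm_sqrt (x : C) : nrm x = Num.sqrt (complex.Re x ^+ 2 + complex.Im x ^+ 2).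
Proof. by rewrite /nrm normc_def. Qed.

Lemma nrm_ltC (x : C) (e : R) : (`|x| < e%:C%C) = (nrm x < e).
Proof. by rewrite !nrmE ltcR. Qed.

Lemma nrm_ge0 (x : C) : 0 <= nrm x.
Proof. by rewrite nrm_sqrt sqrtr_ge0. Qed.

Lemma nrm_eq0 (x : C) : (nrm x == 0) = (x == 0).
Proof. by rewrite -[RHS]normr_eq0 nrmE eq_complex /= eqxx andbT. Qed.

Lemma nrm_gt0 (x : C) : (0 < nrm x) = (x != 0).
Proof. by rewrite lt0r nrm_ge0 andbT nrm_eq0. Qed.

Lemma nrm0 : nrm 0 = 0. Proof. by apply/eqP; rewrite nrm_eq0. Qed.

Lemma nrmN (x : C) : nrm (- x) = nrm x.
Proof. by rewrite /nrm normrN. Qed.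

Lemma nrmB_sym (x y : C) : nrm (x - y) = nrm (y - x).
Proof. by rewrite -nrmN opprB. Qed.

Lemma nrmM (x y : C) : nrm (x * y) = nrm x * nrm y.
Proof. by apply: complexI; rewrite -nrmE normrM !nrmE rmorphM. Qed.

Lemma nrmX (x : C) n : nrm (x ^+ n) = nrm x ^+ n.
Proof. by apply: complexI; rewrite -nrmE normrX !nrmE rmorphXn. Qed.

Lemma nrmV (x : C) : nrm x^-1 = (nrm x)^-1.
Proof. by apply: complexI; rewrite -nrmE normfV !nrmE fmorphV. Qed.

Lemma nrmD (x y : C) : nrm (x + y) <= nrm x + nrm y.
Proof. by rewrite -lecR rmorphD /= -!nrmE ler_normD. Qed.

Lemma nrmB (x y : C) : nrm (x - y) <= nrm x + nrm y.
Proof. by rewrite -(nrmN y) nrmD. Qed.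

Lemma nrm_geB (x y : C) : nrm x - nrm y <= nrm (x - y).
Proof. by rewrite lerBlDr (le_trans _ (nrmD _ _)) // subrK. Qed.

Lemma nrm_geD (x y : C) : nrm x - nrm y <= nrm (x + y).
Proof. by rewrite -(nrmN y) -[y in X in _ <= X]opprK nrm_geB. Qed.

Lemma nrm_nat (n : nat) : nrm n%:R = n%:R.
Proof. by apply: complexI; rewrite -nrmE normr_nat rmorph_nat. Qed.

Lemma nrm1 : nrm 1 = 1. Proof. exact: (nrm_nat 1). Qed.

Lemma nrm_real (x : R) : nrm x%:C%C = `|x|.
Proof. by rewrite nrm_sqrt /= expr0n addr0 sqrtr_sqr. Qed.

Lemma nrm_sum (I : Type) (s : seq I) (P : pred I) (F : I -> C) :
  nrm (\sum_(i <- s | P i) F i) <= \sum_(i <- s | P i) nrm (F i).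
Proof.
elim/big_rec2: _ => [|i x y _ h]; first by rewrite nrm0.
by apply: le_trans (nrmD _ _) _; rewrite lerD2l.
Qed.

Lemma nrm_Re (x : C) : `|complex.Re x| <= nrm x.
Proof. by rewrite -lecR -nrmE normc_ge_Re. Qed.

Lemma nrm_Im (x : C) : `|complex.Im x| <= nrm x.
Proof.
rewrite nrm_sqrt -sqrtr_sqr ler_wsqrtr // lerDr; exact: sqr_ge0.
Qed.

Lemma nrm_le_ReIm (x : C) : nrm x <= `|complex.Re x| + `|complex.Im x|.
Proof.
rewrite nrm_sqrt -[leRHS]ger0_norm ?addr_ge0 // -[leRHS]sqrtr_sqr.
rewrite ler_wsqrtr // sqrrD !real_normK ?num_real //.
by rewrite addrAC lerDl mulrn_wge0 // mulr_ge0.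
Qed.

Lemma cvgC_P (u : nat -> C) (l : C) :
  (u @ \oo --> l) <->
  forall e : R, 0 < e -> \forall n \near \oo, nrm (l - u n) < e.
Proof.
split=> [/cvgrPdist_lt h e e0|h].
  have /h : 0 < e%:C%C :> C by rewrite ltcR.
  by apply: filterS => n; rewrite nrm_ltC.
apply/cvgrPdist_lt => e e0.
have eE : e = (complex.Re e)%:C%C.
  by rewrite RRe_real // gtr0_real.
have /h : 0 < complex.Re e by rewrite -ltcR -eE.
by apply: filterS => n; rewrite eE nrm_ltC.
Qed.

Lemma cvgC_ReIm (u : nat -> C) (a b : R) :
  (fun n => complex.Re (u n)) @ \oo --> a ->
  (fun n => complex.Im (u n)) @ \oo --> b -> u @ \oo --> ((a +i* b)%C : C).
Proof.
move=> /cvgrPdist_lt ha /cvgrPdist_lt hb; apply/cvgC_P => e e0.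
have e2 : 0 < e / 2 by rewrite divr_gt0.
near=> n.
apply: le_lt_trans (nrm_le_ReIm _) _; rewrite (splitr e) ltrD //.
  rewrite raddfB /=; near: n; exact: ha.
rewrite raddfB /=; near: n; exact: hb.
Unshelve. all: by end_near. Qed.

Lemma cvg_nrm_le (u : nat -> C) (l v : C) (K : R) :
  u @ \oo --> l -> (forall n, nrm (u n - v) <= K) -> nrm (l - v) <= K.
Proof.
move=> /cvgC_P h hK; apply/ler_addgt0Pr => e e0.
have [n _ /(_ n (leqnn n)) hn] := h e e0.
have -> : l - v = (u n - v) + (l - u n) by ring.
by apply: le_trans (nrmD _ _) _; rewrite lerD // ltW.
Qed.

(** With b n = A / (n + 1), the hypothesis makes [v - b] nondecreasing and [v + b] nonincreasing, so
    [v - b] is bounded and converges. The increments have the telescoping shape that the shells of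
    the boxes below produce. *)
Lemma telescope_is_cvg (v : nat -> R) (A : R) : 0 <= A ->
  (forall n, `|v n.+1 - v n| <= A * (n.+1%:R^-1 - n.+2%:R^-1)) -> cvgn v.
Proof.
move=> A0 hv.
pose b n : R := A * n.+1%:R^-1.
have b0 : b @ \oo --> 0.
  rewrite -[0](mulr0 A); apply: cvgM; first exact: cvg_cst.
  exact: cvg_harmonic.
have hn n : `|v n.+1 - v n| <= b n - b n.+1.
  by rewrite -mulrBr.
have inc : nondecreasing_seq (fun n => v n - b n).
  apply/nondecreasing_seqP => n.
  have := hn n; rewrite ler_norml => /andP[+ _]; lra.
have dec n : v n + b n <= v 0 + b 0.
  elim: n => // n; have := hn n; rewrite ler_norml => /andP[_]; lra.
have bp n : 0 <= b n by rewrite mulr_ge0.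
have c : cvgn (fun n => v n - b n).
  apply: nondecreasing_is_cvgn => //.
  exists (v 0 + b 0) => _ [n _ <-]; have := dec n; have := bp n; lra.
have -> : v = (fun n => (v n - b n) + b n) by apply/funext => n; rewrite subrK.
by apply: is_cvgD => //; apply/cvg_ex; exists 0.
Qed.

Lemma telescope_is_cvgC (u : nat -> C) (A : R) : 0 <= A ->
  (forall n, nrm (u n.+1 - u n) <= A * (n.+1%:R^-1 - n.+2%:R^-1)) -> cvgn u.
Proof.
move=> A0 hu.
have /cvg_ex[a ha] : cvgn (fun n => complex.Re (u n)).
  apply: (telescope_is_cvg A0) => n; apply: le_trans (hu n).
  by rewrite -raddfB nrm_Re.
have /cvg_ex[b hb] : cvgn (fun n => complex.Im (u n)).
  apply: (telescope_is_cvg A0) => n; apply: le_trans (hu n).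
  by rewrite -raddfB nrm_Im.
by apply/cvg_ex; exists ((a +i* b)%C : C); exact: cvgC_ReIm.
Qed.

End ComplexNorm.

(** * Taylor expansion of the exponential *)

Section ComplexExp.
Variable R : realType.
Local Notation C := (cplx R).

Lemma cexp0 : cexp (0 : C) = 1.
Proof. by rewrite /cexp /= expR0 cos0 sin0 mul1r. Qed.

Lemma cexpD (u v : C) : cexp (u + v) = cexp u * cexp v.
Proof.
case: u v => [a b] [c d]; rewrite /cexp /= expRD cosD sinD.
by apply/eqP; rewrite eq_complex /=; apply/andP; split; apply/eqP; ring.
Qed.

Lemma cexpNK (v : C) : cexp v * cexp (- v) = 1.
Proof. by rewrite -cexpD subrr cexp0. Qed.

Lemma cexp_neq0 (v : C) : cexp v != 0.
Proof. by apply/eqP => h; have := cexpNK v; rewrite h mul0r => /eqP; rewrite eq_sym oner_eq0. Qed.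

Lemma cexpN (v : C) : cexp (- v) = (cexp v)^-1.
Proof. by apply: (mulfI (cexp_neq0 v)); rewrite cexpNK divff ?cexp_neq0. Qed.

Lemma nrm_cexp (v : C) : nrm (cexp v) = expR (complex.Re v).
Proof.
rewrite nrm_sqrt /cexp /= !mul0r subr0 addr0 !exprMn -mulrDr cos2Dsin2 mulr1.
by rewrite sqrtr_sqr ger0_norm // expR_ge0.
Qed.

Lemma nrm_cexp_le (v : C) : nrm (cexp v) <= expR (nrm v).
Proof. by rewrite nrm_cexp ler_expR (le_trans (ler_norm _)) ?nrm_Re. Qed.

Lemma mean_value_le (f df : R -> R) (M t : R) :
  (forall x : R, is_derive x (1 : R) f (df x)) -> f 0 = 0 -> 0 <= t ->
  (forall x, 0 <= x <= t -> `|df x| <= M) -> `|f t| <= M * t.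
Proof.
move=> fd f0 t0 hM.
have fc : {within `[0, t], continuous f}.
  by apply: derivable_within_continuous => x _; case: (fd x).
have [c] := MVT_segment t0 (fun x _ => fd x) fc.
rewrite in_itv /= => /hM hc; rewrite f0 !subr0 => ->.
by rewrite normrM (ger0_norm t0) ler_wpM2r.
Qed.

Lemma is_derive_monomial (k : R) n (t : R) :
  is_derive t (1 : R) (fun x => k * x ^+ n.+1) (k * (t ^+ n *+ n.+1)).
Proof.
have := is_derive_poly (k%:P * 'X^(n.+1)) t.
rewrite mul_polyC derivZ derivXn hornerZ hornerMn hornerXn.
have -> // : horner (k *: 'X^(n.+1)) = fun x => k * x ^+ n.+1.
by apply/funext => x; rewrite hornerZ hornerXn.
Qed.

Definition exp_trunc (n : nat) (v : C) : C := \sum_(k < n) v ^+ k / k`!%:R.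

Lemma exp_trunc0 (n : nat) : exp_trunc n.+1 0 = 1.
Proof.
rewrite /exp_trunc big_ord_recl /= expr0 divr1 big1 ?addr0 // => i _.
by rewrite expr0n mul0r.
Qed.

Let coord (c x : C) := complex.Re (c * x).

Let coord_cexp_tail (v c : C) (n : nat) (t : R) :=
  coord c (cexp (t%:C%C * v) - exp_trunc n (t%:C%C * v)).

Let coord_cexpE (v c : C) (t : R) : coord c (cexp (t%:C%C * v)) =
  expR (t * complex.Re v) * (complex.Re c * cos (t * complex.Im v)
    - complex.Im c * sin (t * complex.Im v)).
Proof.
case: v c => a b [c d]; rewrite /coord /cexp /= !mul0r !subr0 !addr0.
ring.
Qed.

Let is_derive_coord_cexp (v c : C) (t : R) :
  is_derive t (1 : R) (fun s => coord c (cexp (s%:C%C * v))) (coord c (v * cexp (t%:C%C * v))).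
Proof.
under eq_fun do rewrite coord_cexpE.
apply: is_derive_eq.
have -> : coord c (v * cexp (t%:C%C * v)) = coord (c * v) (cexp (t%:C%C * v)).
  by rewrite /coord mulrA.
rewrite coord_cexpE; case: v c => a b [c d] /=.
rewrite /GRing.scale /=; ring.
Qed.

Let coord_truncE (v c : C) n (t : R) : coord c (exp_trunc n (t%:C%C * v)) =
  \sum_(k < n) coord c (v ^+ k / k`!%:R) * t ^+ k.
Proof.
rewrite /coord /exp_trunc mulr_sumr raddf_sum; apply: eq_bigr => k _ /=.
have -> : c * ((t%:C%C * v) ^+ k / k`!%:R) = (t ^+ k)%:C%C * (c * (v ^+ k / k`!%:R)).
  by rewrite exprMn rmorphXn /=; ring.
by case: (c * _) => a b /=; rewrite mul0r subr0 mulrC.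
Qed.

Let is_derive_coord_trunc (v c : C) n (t : R) :
  is_derive t (1 : R) (fun s => coord c (exp_trunc n.+1 (s%:C%C * v)))
    (coord c (v * exp_trunc n (t%:C%C * v))).
Proof.
under eq_fun do rewrite coord_truncE.
have -> : coord c (v * exp_trunc n (t%:C%C * v)) = coord (c * v) (exp_trunc n (t%:C%C * v)).
  by rewrite /coord mulrA.
rewrite coord_truncE.
elim: n => [|n IH].
  under eq_fun do rewrite big_ord1 !expr0.
  by rewrite big_ord0; exact: is_derive_cst.
under eq_fun do rewrite big_ord_recr /=.
rewrite big_ord_recr /=.
apply: is_deriveD.
have -> : coord (c * v) (v ^+ n / n`!%:R) = coord c (v ^+ n.+1 / n.+1`!%:R) *+ n.+1.
  rewrite /coord -[RHS](raddfMn (@complex.Re R)); apply: congr1.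
  rewrite factS natrM exprS -[RHS]mulr_natl; field.
  by rewrite nat1r !pnatr_eq0 -lt0n fact_gt0.
by rewrite mulrnAl -mulrnAr; exact: is_derive_monomial.
Qed.

(** Induction on n along the segment from 0 to v: the derivative in t of the tail of order n + 1 at
    t v is v times the tail of order n. The mean value theorem being real, it is applied to the
    coordinates Re(c x) for c = 1 and c = -i; adding the two bounds costs a factor 2 per step, hence
    2^n. *)
Lemma cexp_taylor (n : nat) (v : C) :
  nrm (cexp v - exp_trunc n v) <= 2 ^+ n * expR (nrm v) * nrm v ^+ n.
Proof.
suff H : forall t : R, 0 <= t <= 1 ->
    nrm (cexp (t%:C%C * v) - exp_trunc n (t%:C%C * v)) <= 2 ^+ n * expR (nrm v) * nrm v ^+ n.
  by have := H 1; rewrite mul1r; apply; lra.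
elim: n => [|n IH] t /andP[t0 t1].
  rewrite /exp_trunc big_ord0 subr0 !expr0 mulr1 mul1r (le_trans (nrm_cexp_le _)) //.
  by rewrite ler_expR nrmM nrm_real ger0_norm // ler_piMl ?nrm_ge0.
have bnd (c : C) : nrm c = 1 ->
    `|coord_cexp_tail v c n.+1 t| <= 2 ^+ n * expR (nrm v) * nrm v ^+ n.+1.
  move=> c1.
  have D (x : R) : is_derive x (1 : R) (coord_cexp_tail v c n.+1) (coord_cexp_tail v (c * v) n x).
    have -> : coord_cexp_tail v (c * v) n x =
       coord c (v * cexp (x%:C%C * v)) - coord c (v * exp_trunc n (x%:C%C * v)).
      by rewrite /coord_cexp_tail /coord -raddfB /=; congr complex.Re; ring.
    have -> : coord_cexp_tail v c n.+1 = (fun s => coord c (cexp (s%:C%C * v))) -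
       (fun s => coord c (exp_trunc n.+1 (s%:C%C * v))).
      by apply/funext => s; rewrite /coord_cexp_tail /coord mulrBr raddfB.
    by apply: is_deriveB.
  apply: le_trans (mean_value_le D _ t0 _) _.
  - by rewrite /coord_cexp_tail mul0r cexp0 exp_trunc0 subrr /coord mulr0.
  - move=> x /andP[x0 xt].
    apply: le_trans (nrm_Re _) _.
    rewrite !nrmM c1 mul1r.
    apply: ler_wpM2l; first exact: nrm_ge0.
    by apply: IH; rewrite x0 (le_trans xt).
  - rewrite -[leRHS]mulr1; apply: ler_pM => //.
      by rewrite !mulr_ge0 ?exprn_ge0 ?expR_ge0 ?nrm_ge0.
    by rewrite exprS; lra.
apply: le_trans (nrm_le_ReIm _) _.
have := bnd 1 (nrm1 R).
have : nrm (- 'i%C : C) = 1 by rewrite nrmN nrm_sqrt /= expr0n expr1n add0r sqrtr1.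
move=> /bnd; rewrite /coord_cexp_tail /coord mul1r.
set x := _ - _; case: x => x1 x2 /=.
rewrite !oppr0 !mul0r !mulN1r sub0r opprK => h2 h1.
by rewrite exprS -!mulrA; lra.
Qed.

End ComplexExp.

(** * Orders of vanishing at 0 *)

Section LocalOrder.
Variable R : realType.
Local Notation C := (cplx R).

(* f(x) = O(x^n) as x -> 0; the value f 0 is irrelevant. *)
Definition isO (n : nat) (f : C -> C) : Prop :=
  exists K d : R, [/\ 0 <= K, 0 < d &
    forall x, x != 0 -> nrm x <= d -> nrm (f x) <= K * nrm x ^+ n].

Definition polyfun (f : C -> C) : Prop := exists p : {poly C}, forall x, f x = p.[x].

Lemma isO_near (n : nat) (f g : C -> C) (d : R) : 0 < d ->
  (forall x, x != 0 -> nrm x <= d -> f x = g x) -> isO n f -> isO n g.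
Proof.
move=> d0 fg [K [e [K0 e0 h]]]; exists K, (Num.min d e); split => //.
  by rewrite lt_min d0 e0.
by move=> x x0; rewrite le_min => /andP[xd xe]; rewrite -fg // h.
Qed.

Lemma eq_isO (n : nat) (f g : C -> C) : f =1 g -> isO n f -> isO n g.
Proof. by move=> fg; apply: (@isO_near _ _ _ 1) => // x _ _. Qed.

Lemma isO0 n : isO n (fun=> 0).
Proof. by exists 0, 1; split=> // x _ _; rewrite nrm0 mul0r. Qed.

Lemma isOD n (f g : C -> C) : isO n f -> isO n g -> isO n (fun x => f x + g x).
Proof.
move=> [K [d [K0 d0 hf]]] [L [e [L0 e0 hg]]].
exists (K + L), (Num.min d e); split; rewrite ?addr_ge0 ?lt_min ?d0 ?e0 //.
move=> x x0; rewrite le_min => /andP[xd xe].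
by apply: le_trans (nrmD _ _) _; rewrite mulrDl lerD ?hf ?hg.
Qed.

Lemma isON n (f : C -> C) : isO n f -> isO n (fun x => - f x).
Proof. by move=> [K [d [K0 d0 h]]]; exists K, d; split=> // x x0 xd; rewrite nrmN h. Qed.

Lemma isOB n (f g : C -> C) : isO n f -> isO n g -> isO n (fun x => f x - g x).
Proof. by move=> hf hg; apply: isOD => //; exact: isON. Qed.

Lemma isOM m n (f g : C -> C) : isO m f -> isO n g -> isO (m + n) (fun x => f x * g x).
Proof.
move=> [K [d [K0 d0 hf]]] [L [e [L0 e0 hg]]].
exists (K * L), (Num.min d e); split; rewrite ?mulr_ge0 ?lt_min ?d0 ?e0 //.
move=> x x0; rewrite le_min => /andP[xd xe].
by rewrite nrmM exprD mulrACA ler_pM ?nrm_ge0 ?hf ?hg.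
Qed.

Lemma isO_le m n (f : C -> C) : (m <= n)%N -> isO n f -> isO m f.
Proof.
move=> mn [K [d [K0 d0 h]]]; exists K, (Num.min d 1); split; rewrite ?lt_min ?d0 ?ltr01 //.
move=> x x0; rewrite le_min => /andP[xd x1]; apply: le_trans (h x x0 xd) _.
by apply: ler_wpM2l => //; rewrite ler_wiXn2l ?nrm_ge0.
Qed.

Lemma isO_X n : isO n (fun x => x ^+ n).
Proof. by exists 1, 1; split=> // x _ _; rewrite nrmX mul1r. Qed.

Lemma isO_cst c : isO 0 (fun=> c).
Proof. by exists (nrm c), 1; split=> // [|x _ _]; rewrite ?nrm_ge0 ?mulr1. Qed.

Lemma isO_horner (p : {poly C}) : isO 0 (horner p).
Proof.
elim/poly_ind: p => [|p c IH].
  by apply: eq_isO (isO_cst 0) => x; rewrite horner0.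
apply: (@eq_isO _ (fun x => p.[x] * x + c)).
  by move=> x; rewrite hornerD hornerM hornerX hornerC.
apply: isOD; last exact: isO_cst.
by apply: (@isOM 0 0) => //; apply: isO_le (isO_X 1).
Qed.

Lemma isO_polyfun f : polyfun f -> isO 0 f.
Proof. by move=> [p fp]; apply: eq_isO (isO_horner p) => x; rewrite fp. Qed.

Lemma isO_Xpoly n f : polyfun f -> isO n (fun x => x ^+ n * f x).
Proof.
move=> /isO_polyfun hf; rewrite -[n in isO n]addn0.
by apply: (@isOM n 0 (fun x => x ^+ n) f) => //; exact: isO_X.
Qed.

Lemma polyfun_cst c : polyfun (fun=> c).
Proof. by exists c%:P => x; rewrite hornerC. Qed.

Lemma polyfun_id : polyfun id.
Proof. by exists 'X => x; rewrite hornerX. Qed.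

Lemma polyfunD f g : polyfun f -> polyfun g -> polyfun (fun x => f x + g x).
Proof. by move=> [p fp] [q gq]; exists (p + q) => x; rewrite hornerD fp gq. Qed.

Lemma polyfunM f g : polyfun f -> polyfun g -> polyfun (fun x => f x * g x).
Proof. by move=> [p fp] [q gq]; exists (p * q) => x; rewrite hornerM fp gq. Qed.

Lemma polyfunN f : polyfun f -> polyfun (fun x => - f x).
Proof. by move=> [p fp]; exists (- p) => x; rewrite hornerN fp. Qed.

Lemma polyfunX f n : polyfun f -> polyfun (fun x => f x ^+ n).
Proof. by move=> [p fp]; exists (p ^+ n) => x; rewrite horner_exp fp. Qed.

Lemma polyfun_monomial (c : C) n : polyfun (fun z => c * z ^+ n).
Proof. by apply: polyfunM; [exact: polyfun_cst | apply: polyfunX; exact: polyfun_id]. Qed.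

Lemma polyfun_sum (I : Type) (s : seq I) (P : pred I) (F : I -> C -> C) :
  (forall i, polyfun (F i)) -> polyfun (fun x => \sum_(i <- s | P i) F i x).
Proof.
move=> hF; elim: s => [|i s IH].
  by under eq_fun do rewrite big_nil; exact: polyfun_cst.
under eq_fun do rewrite big_cons; case: (P i) => //; exact: polyfunD.
Qed.

Lemma isO1_cst c : isO 1 (fun=> c) -> c = 0.
Proof.
move=> [K [d [K0 d0 h]]]; apply/eqP; rewrite -nrm_eq0 eq_le nrm_ge0 andbT.
apply/ler_addgt0Pr => e e0; rewrite add0r.
pose r := Num.min d (e / (K + 1)).
have r0 : 0 < r by rewrite lt_min d0 divr_gt0 // ltr_wpDl.
have nr : nrm (r%:C%C : C) = r by rewrite nrm_real gtr0_norm.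
have := h r%:C%C; rewrite nr expr1 -nrm_eq0 nr gt_eqF // => /(_ isT).
rewrite ge_min lexx => /(_ isT) /le_trans; apply.
have : r * (K + 1) <= e by rewrite -ler_pdivlMr ?ltr_wpDl // ge_min lexx orbT.
nra.
Qed.

(** Uniqueness of Taylor coefficients is used in this form throughout: the constant term is O(x),
    hence zero, and a factor x can be divided out. *)
Lemma isO_poly0 n (p : {poly C}) : (size p <= n)%N -> isO n (horner p) -> p = 0.
Proof.
elim: n p => [|n IH] p; first by rewrite leqn0 size_poly_eq0 => /eqP.
elim/poly_ind: p => [//|p c _] hs h.
have c0 : c = 0.
  apply: isO1_cst.
  apply: (@eq_isO _ (fun x => (p * 'X + c%:P).[x] - x ^+ 1 * p.[x])).
    by move=> x; rewrite hornerD hornerM hornerX hornerC; ring.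
  apply: isOB; first exact: isO_le h.
  by apply: isO_Xpoly; exists p.
rewrite c0 addr0 in hs h *.
suff -> : p = 0 by rewrite mul0r.
apply: IH.
  have [->|p0] := eqVneq p 0; first by rewrite size_poly0.
  by move: hs; rewrite size_mulX.
move: h => [K [d [K0 d0 h]]]; exists K, d; split=> // x x0 xd.
have := h x x0 xd; rewrite hornerM hornerX nrmM exprSr mulrA.
by rewrite ler_pM2r ?nrm_gt0.
Qed.

Lemma isO_coef0 n (d : nat -> C) :
  isO n (fun x => \sum_(i < n) d i * x ^+ i) -> forall i, (i < n)%N -> d i = 0.
Proof.
move=> h i ltin; pose p : {poly C} := \poly_(j < n) d j.
have -> : d i = p`_i by rewrite coef_poly ltin.
rewrite (@isO_poly0 n p) ?coef0 ?size_poly //.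
by apply: eq_isO h => x; rewrite horner_poly.
Qed.

Definition quintic (d0 d1 d2 d3 d4 d5 x : C) : C :=
  d0 + d1 * x + d2 * x ^+ 2 + d3 * x ^+ 3 + d4 * x ^+ 4 + d5 * x ^+ 5.

Lemma polyfun_quintic d0 d1 d2 d3 d4 d5 : polyfun (quintic d0 d1 d2 d3 d4 d5).
Proof.
by repeat (apply: polyfunD || apply: polyfunM || apply: polyfunX || exact: polyfun_cst
  || exact: polyfun_id).
Qed.

Lemma isO_quintic0 d0 d1 d2 d3 d4 d5 : isO 6 (quintic d0 d1 d2 d3 d4 d5) ->
  [/\ d0 = 0, d1 = 0, d2 = 0, d3 = 0 & d4 = 0 /\ d5 = 0].
Proof.
move=> h; pose d i := nth 0 [:: d0; d1; d2; d3; d4; d5] i.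
have H : forall i, (i < 6)%N -> d i = 0.
  apply: isO_coef0; apply: eq_isO h => x.
  rewrite !big_ord_recr big_ord0 /d /= /quintic; ring.
by have := (H 0 isT, H 1 isT, H 2 isT, H 3 isT, H 4 isT, H 5 isT)%N;
  rewrite /d /= => -[[[[[-> ->] ->] ->] ->] ->].
Qed.

Lemma isO_cexp_trunc n k (c : C) : (0 < k)%N ->
  isO (k * n) (fun x => cexp (c * x ^+ k) - exp_trunc n (c * x ^+ k)).
Proof.
move=> k0; exists (2 ^+ n * expR (nrm c) * nrm c ^+ n), 1; split=> //.
  by rewrite !mulr_ge0 ?exprn_ge0 ?expR_ge0 ?nrm_ge0.
move=> x _ x1; apply: le_trans (cexp_taylor _ _) _.
rewrite nrmM nrmX exprMn exprM mulrA ler_wpM2r ?exprn_ge0 ?nrm_ge0 //.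
rewrite ler_wpM2r ?exprn_ge0 ?nrm_ge0 // ler_wpM2l ?exprn_ge0 //.
by rewrite ler_expR ler_piMr ?nrm_ge0 // exprn_ile1 ?nrm_ge0.
Qed.

(** Boundedness of g belongs to the relation so that it is compatible with products. *)
Definition eqO6 (f g : C -> C) := isO 6 (fun x => f x - g x) /\ isO 0 g.

Lemma eqO6M f1 g1 f2 g2 : eqO6 f1 g1 -> eqO6 f2 g2 ->
  eqO6 (fun x => f1 x * f2 x) (fun x => g1 x * g2 x).
Proof.
move=> [h1 b1] [h2 b2]; split; last exact: (@isOM 0 0).
apply: (@eq_isO _ (fun x => (f1 x - g1 x) * ((f2 x - g2 x) + g2 x) + g1 x * (f2 x - g2 x))).
  by move=> x; ring.
apply: isOD; last exact: (@isOM 0 6).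
apply: (@isOM 6 0) => //; apply: isOD => //; exact: isO_le h2.
Qed.

Lemma eqO6_trans_poly f g h q : eqO6 f g -> polyfun q -> polyfun h ->
  (forall x, g x = h x + x ^+ 6 * q x) -> eqO6 f h.
Proof.
move=> [hf _] hq hh E; split; last exact: isO_polyfun.
apply: (@eq_isO _ (fun x => (f x - g x) + x ^+ 6 * q x)).
  by move=> x; rewrite E; ring.
by apply: isOD => //; exact: isO_Xpoly.
Qed.

End LocalOrder.

Ltac polyfun_tac := repeat (apply: polyfunD || apply: polyfunM || apply: polyfunX
  || apply: polyfunN || exact: polyfun_cst || exact: polyfun_id).

(** * The exponential of a quintic polynomial up to O(x^6) *)

Section ExpCoefficients.
Variable R : realType.
Local Notation C := (cplx R).

(* The coefficients of x^2, ..., x^5 in exp(a x + c2 x^2 + ... + c5 x^5). *)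
Definition exp_coef2 (a c2 : C) := c2 + a ^+ 2 / 2.
Definition exp_coef3 (a c2 c3 : C) := c3 + a * c2 + a ^+ 3 / 6.
Definition exp_coef4 (a c2 c3 c4 : C) :=
  c4 + c2 ^+ 2 / 2 + a * c3 + a ^+ 2 * c2 / 2 + a ^+ 4 / 24.
Definition exp_coef5 (a c2 c3 c4 c5 : C) :=
  c5 + c2 * c3 + a * c4 + a * c2 ^+ 2 / 2 + a ^+ 2 * c3 / 2 + a ^+ 3 * c2 / 6
  + a ^+ 5 / 120.

Definition exp_quintic (a c2 c3 c4 c5 : C) : C -> C :=
  quintic 1 a (exp_coef2 a c2) (exp_coef3 a c2 c3) (exp_coef4 a c2 c3 c4)
    (exp_coef5 a c2 c3 c4 c5).

(** The exponential is split into the factors exp(c_k x^k), each cut after n terms with k n >= 6;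
    the factors are then multiplied one at a time, terms in x^6 and beyond being collected into a
    polynomial multiple of x^6. *)
Lemma cexp_quintic (a c2 c3 c4 c5 : C) :
  isO 6 (fun x => cexp (quintic 0 a c2 c3 c4 c5 x) - exp_quintic a c2 c3 c4 c5 x).
Proof.
pose E k c (x : C) := cexp (c * x ^+ k).
have EO n k (c : C) g : (0 < k)%N -> (k * n = 6 \/ k * n = 8)%N ->
    (forall x, exp_trunc n (c * x ^+ k) = g x) -> polyfun g -> eqO6 (E k c) g.
  move=> k0 kn Eg pg; split; last exact: isO_polyfun.
  apply: (@isO_le _ _ (k * n)); first by case: kn => ->.
  by apply: eq_isO (isO_cexp_trunc n c k0) => x; rewrite Eg.
have e1 : eqO6 (E 1 a)
    (quintic 1 a (a ^+ 2 / 2) (a ^+ 3 / 6) (a ^+ 4 / 24) (a ^+ 5 / 120)).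
  apply: (@EO 6) => //; [by left | | exact: polyfun_quintic].
  move=> x; rewrite /exp_trunc !big_ord_recr big_ord0 /= /quintic.
  have [-> -> ->] : [/\ 2`! = 2, 3`! = 6 & 4`! = 24]%N by [].
  by have -> : (5`! = 120)%N by []; rewrite fact0 (_ : 1`! = 1)%N //; field.
have e2 : eqO6 (E 2 c2) (fun x => 1 + c2 * x ^+ 2 + c2 ^+ 2 / 2 * x ^+ 4).
  apply: (@EO 3) => //; [by left | | by polyfun_tac].
  move=> x; rewrite /exp_trunc !big_ord_recr big_ord0 /=.
  by rewrite fact0 (_ : 1`! = 1)%N // (_ : 2`! = 2)%N //; field.
have eL k (c : C) : (k = 3 \/ k = 4)%N -> eqO6 (E k c) (fun x => 1 + c * x ^+ k).
  move=> hk; apply: (@EO 2); [by case: hk => -> | | | by polyfun_tac].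
    by case: hk => ->; [left | right].
  move=> x; rewrite /exp_trunc !big_ord_recr big_ord0 /=.
  by rewrite fact0 (_ : 1`! = 1)%N //; field.
have e5 : eqO6 (E 5 c5) (fun x => 1 + c5 * x ^+ 5).
  split; last by apply: isO_polyfun; polyfun_tac.
  apply: (@isO_le _ _ 10) => //; apply: eq_isO (isO_cexp_trunc 2 c5 (isT : (0 < 5)%N)) => x.
  rewrite /exp_trunc !big_ord_recr big_ord0 /=.
  by rewrite fact0 (_ : 1`! = 1)%N //; congr (_ - _); field.
have : eqO6 (fun x => E 1 a x * E 2 c2 x) (quintic 1 a (c2 + a ^+ 2 / 2)
    (a * c2 + a ^+ 3 / 6) (c2 ^+ 2 / 2 + a ^+ 2 * c2 / 2 + a ^+ 4 / 24)
    (a * c2 ^+ 2 / 2 + a ^+ 3 * c2 / 6 + a ^+ 5 / 120)).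
  have := eqO6M e1 e2.
  move=> /(@eqO6_trans_poly _ _ _ _ (fun x => (a ^+ 2 * c2 ^+ 2 / 4 + a ^+ 4 * c2 / 24)
    + (a ^+ 3 * c2 ^+ 2 / 12 + a ^+ 5 * c2 / 120) * x
    + (a ^+ 4 * c2 ^+ 2 / 48) * x ^+ 2 + (a ^+ 5 * c2 ^+ 2 / 240) * x ^+ 3)).
  apply; [by polyfun_tac | exact: polyfun_quintic |].
  by move=> x; rewrite /quintic; field.
have M3 d0 d1 d2 d3 d4 d5 c f : eqO6 f (quintic d0 d1 d2 d3 d4 d5) ->
    eqO6 (fun x => f x * E 3 c x) (quintic d0 d1 d2 (d3 + d0 * c) (d4 + d1 * c) (d5 + d2 * c)).
  move=> hf; have := eqO6M hf (eL 3 c (or_introl erefl)).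
  move=> /(@eqO6_trans_poly _ _ _ _ (fun x => d3 * c + d4 * c * x + d5 * c * x ^+ 2)).
  apply; [by polyfun_tac | exact: polyfun_quintic |].
  by move=> x; rewrite /quintic; ring.
have M4 d0 d1 d2 d3 d4 d5 c f : eqO6 f (quintic d0 d1 d2 d3 d4 d5) ->
    eqO6 (fun x => f x * E 4 c x) (quintic d0 d1 d2 d3 (d4 + d0 * c) (d5 + d1 * c)).
  move=> hf; have := eqO6M hf (eL 4 c (or_intror erefl)).
  move=> /(@eqO6_trans_poly _ _ _ _ (fun x => d2 * c + d3 * c * x + d4 * c * x ^+ 2
    + d5 * c * x ^+ 3)).
  apply; [by polyfun_tac | exact: polyfun_quintic |].
  by move=> x; rewrite /quintic; ring.
have M5 d0 d1 d2 d3 d4 d5 f : eqO6 f (quintic d0 d1 d2 d3 d4 d5) ->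
    eqO6 (fun x => f x * E 5 c5 x) (quintic d0 d1 d2 d3 d4 (d5 + d0 * c5)).
  move=> hf; have := eqO6M hf e5.
  move=> /(@eqO6_trans_poly _ _ _ _ (fun x => d1 * c5 + d2 * c5 * x + d3 * c5 * x ^+ 2
    + d4 * c5 * x ^+ 3 + d5 * c5 * x ^+ 4)).
  apply; [by polyfun_tac | exact: polyfun_quintic |].
  by move=> x; rewrite /quintic; ring.
move=> /(M3 _ _ _ _ _ _ c3) /(M4 _ _ _ _ _ _ c4) /M5 [h _].
apply: eq_isO h => x; rewrite /E -!cexpD; congr (cexp _ - _).
  by rewrite /quintic; ring.
rewrite /exp_quintic /quintic /exp_coef2 /exp_coef3 /exp_coef4 /exp_coef5; ring.
Qed.

End ExpCoefficients.

(** * Sums and products over square boxes of indices *)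

Section IndexBox.

Definition imax (p : int * int) : nat := maxn `|p.1|%N `|p.2|%N.

Definition irange (N : nat) : seq int := [seq k%:Z - N%:Z | k <- iota 0 N.*2.+1].

Definition ibox (N : nat) : seq (int * int) :=
  [seq p <- [seq (m, n) | m <- irange N, n <- irange N] | p != (0, 0)].

Definition ishell (N : nat) : seq (int * int) := [seq p <- ibox N | imax p == N].

Lemma mem_irange N (k : int) : (k \in irange N) = (`|k| <= N)%N.
Proof.
apply/mapP/idP => [[j] | h].
  by rewrite mem_iota => /andP[_ h] ->; lia.
exists (absz (k + N%:Z)); last by lia.
by rewrite mem_iota; lia.
Qed.

Lemma uniq_irange N : uniq (irange N).
Proof. by rewrite map_inj_uniq ?iota_uniq // => i j h; lia. Qed.

Lemma uniq_ibox N : uniq (ibox N).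
Proof.
by apply: filter_uniq; apply: allpairs_uniq => //; try exact: uniq_irange; move=> [a b] [c d].
Qed.

Lemma mem_ibox N p : (p \in ibox N) = (p != (0, 0)) && (imax p <= N)%N.
Proof.
rewrite mem_filter; congr (_ && _); case: p => m n.
have -> : (imax (m, n) <= N)%N = (m \in irange N) && (n \in irange N).
  by rewrite !mem_irange /imax geq_max.
apply/allpairsP/andP => [[[a b] /= [ha hb [-> ->]]]|[ha hb]] //.
by exists (m, n).
Qed.

Lemma mem_ishell N p : (p \in ishell N) = (imax p == N) && (p \in ibox N).
Proof. exact: mem_filter. Qed.

Lemma imax_gt0 p : p != (0, 0) -> (0 < imax p)%N.
Proof.
case: p => m n; rewrite /imax /= => h.
have [m0|] := eqVneq m 0; last by lia.
have : n != 0 by apply: contraNN h => /eqP ->; rewrite m0.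
lia.
Qed.

Lemma ibox0 : ibox 0 = [::].
Proof.
case E : (ibox 0) => [//|p s]; have : p \in ibox 0 by rewrite E mem_head.
by rewrite mem_ibox => /andP[/imax_gt0]; lia.
Qed.

Lemma perm_iboxS N : perm_eq (ibox N.+1) (ibox N ++ ishell N.+1).
Proof.
apply: uniq_perm; first exact: uniq_ibox.
  rewrite cat_uniq uniq_ibox (filter_uniq _ (uniq_ibox _)) andbT /=.
  apply/hasPn => p; rewrite mem_ishell => /andP[/eqP e _].
  by rewrite /= mem_ibox e ltnn andbF.
move=> p; rewrite mem_cat mem_ishell !mem_ibox.
case: (p != _); rewrite ?andbF //= [LHS]leq_eqVlt ltnS orbC.
by case: eqP => // ->; rewrite ltnn leqnn.
Qed.

Lemma size_ishell N : size (ishell N.+1) = (8 * N.+1)%N.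
Proof.
have S M : (size (ibox M)).+1 = (M.*2.+1 * M.*2.+1)%N.
  pose s := [seq (m, n) | m <- irange M, n <- irange M].
  have u : uniq s.
    by apply: allpairs_uniq => //; try exact: uniq_irange; move=> [a b] [c d].
  have s0 : (0, 0) \in s.
    by apply/allpairsP; exists (0, 0); rewrite /= mem_irange.
  have zs : size s = (M.*2.+1 * M.*2.+1)%N.
    by rewrite size_allpairs !size_map size_iota.
  rewrite /ibox size_filter -/s -zs -(count_predC (pred1 (0, 0)) s).
  by rewrite (count_uniq_mem _ u) s0 add1n.
have := S N.+1; rewrite (perm_size (perm_iboxS N)) size_cat.
have := S N; move: (size (ibox N)) (size (ishell N.+1)) => a b; rewrite -!muln2.
rewrite (_ : ((N.+1 * 2).+1 * (N.+1 * 2).+1 = (N * 2).+1 * (N * 2).+1 + 8 * N.+1)%N); last by ring.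
lia.
Qed.

Lemma sum_iboxS (V : nmodType) (F : int * int -> V) N :
  \sum_(p <- ibox N.+1) F p = \sum_(p <- ibox N) F p + \sum_(p <- ishell N.+1) F p.
Proof. by rewrite (perm_big _ (perm_iboxS N)) big_cat. Qed.

Lemma prod_iboxS (K : comNzRingType) (F : int * int -> K) N :
  \prod_(p <- ibox N.+1) F p = (\prod_(p <- ibox N) F p) * \prod_(p <- ishell N.+1) F p.
Proof. by rewrite (perm_big _ (perm_iboxS N)) big_cat. Qed.

(** Used for two symmetries of the boxes: p -> -p, which kills odd sums, and the quarter turn, which
    kills G_6 of the square lattice. *)
Lemma sum_ibox_inj (V : nmodType) (F : int * int -> V) (h : int * int -> int * int) N :
  injective h -> (forall p, imax (h p) = imax p) -> h (0, 0) = (0, 0) ->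
  \sum_(p <- ibox N) F (h p) = \sum_(p <- ibox N) F p.
Proof.
move=> hi hm h0; rewrite -(big_map h xpredT F); apply: perm_big.
have u : uniq (map h (ibox N)) by rewrite map_inj_uniq // uniq_ibox.
have sub : {subset map h (ibox N) <= ibox N}.
  move=> _ /mapP[p + ->]; rewrite !mem_ibox hm => /andP[p0 ->]; rewrite andbT.
  by apply: contraNN p0 => /eqP; rewrite -[X in _ = X]h0 => /hi ->.
apply: uniq_perm; rewrite ?uniq_ibox //.
have le : (size (ibox N) <= size (map h (ibox N)))%N by rewrite size_map.
by case: (uniq_min_size u sub le) => _ E x; rewrite E.
Qed.

End IndexBox.

(** * Convergence of sums and products dominated by max(|m|, |n|)^-3 *)

Section IndexSums.
Variable R : realType.
Local Notation C := (cplx R).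

Definition imaxR (p : int * int) : R := (imax p)%:R.

Lemma imaxR_ge1 p : p != (0, 0) -> 1 <= imaxR p.
Proof. by move=> /imax_gt0 h; rewrite /imaxR ler1n. Qed.

(** The shell max = k has 8 k points, so its sum is at most 8 A / k^2, and 1 / k^2 <= 2 / (k (k +
    1)) makes the bound telescope. *)
Lemma sum_ishell_le (F : int * int -> R) (A : R) N : 0 <= A ->
  (forall p, p != (0, 0) -> F p <= A / imaxR p ^+ 3) ->
  \sum_(p <- ishell N.+1) F p <= 16 * A * (N.+1%:R^-1 - N.+2%:R^-1).
Proof.
move=> A0 hF.
have -> : 16 * A * (N.+1%:R^-1 - N.+2%:R^-1) = 16 * A / (N.+1%:R * N.+2%:R).
  have e : N.+2%:R = N.+1%:R + 1 :> R by rewrite natr1.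
  have n0 : 0 < N.+1%:R :> R by rewrite ltr0n.
  rewrite e; move: N.+1%:R n0 => x x0; field.
  by rewrite !lt0r_neq0 // addr_gt0.
apply: (@le_trans _ _ (\sum_(p <- ishell N.+1) A / N.+1%:R ^+ 3)).
  rewrite big_seq [leRHS]big_seq; apply: ler_sum => p.
  rewrite mem_ishell mem_ibox => /andP[/eqP e /andP[/hF + _]].
  by rewrite /imaxR e.
rewrite big_const_seq count_predT size_ishell iter_addr_0 -[leLHS]mulr_natl natrM.
have n0 : 0 < N.+1%:R :> R by rewrite ltr0n.
have -> : 8 * N.+1%:R * (A / N.+1%:R ^+ 3) = 8 * A / N.+1%:R ^+ 2 :> R.
  by field; rewrite lt0r_neq0.
rewrite ler_pdivrMr ?exprn_gt0 // mulrAC ler_pdivlMr ?mulr_gt0 //.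
rewrite -[N.+2%:R]nat1r; have : 1 <= N.+1%:R :> R by rewrite ler1n.
set x := N.+1%:R => x1; nra.
Qed.

Lemma sum_ibox_le (F : int * int -> R) (A : R) N : 0 <= A ->
  (forall p, p != (0, 0) -> F p <= A / imaxR p ^+ 3) ->
  \sum_(p <- ibox N) F p <= 16 * A.
Proof.
move=> A0 hF.
suff : \sum_(p <- ibox N) F p <= 16 * A * (1 - N.+1%:R^-1).
  move=> /le_trans; apply; rewrite ler_piMr ?mulr_ge0 // gerBl invr_ge0 ler0n //.
elim: N => [|N IH]; first by rewrite ibox0 big_nil invr1 subrr mulr0.
rewrite sum_iboxS; apply: le_trans (lerD IH (sum_ishell_le N A0 hF)) _.
by rewrite -mulrDr addrA subrK.
Qed.

Lemma is_cvg_sum_ibox (F : int * int -> C) (A : R) : 0 <= A ->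
  (forall p, p != (0, 0) -> nrm (F p) <= A / imaxR p ^+ 3) ->
  cvgn (fun N => \sum_(p <- ibox N) F p).
Proof.
move=> A0 hF; apply: (@telescope_is_cvgC _ _ (16 * A)); first by rewrite mulr_ge0.
move=> N; rewrite sum_iboxS addrAC subrr add0r.
by apply: le_trans (nrm_sum _ _ _) _; apply: sum_ishell_le.
Qed.

Lemma nrm_sum_ibox_le (F : int * int -> C) (A : R) N : 0 <= A ->
  (forall p, p != (0, 0) -> nrm (F p) <= A / imaxR p ^+ 3) ->
  nrm (\sum_(p <- ibox N) F p) <= 16 * A.
Proof. by move=> A0 hF; apply: le_trans (nrm_sum _ _ _) _; apply: sum_ibox_le. Qed.

Lemma expR_sub1_le (x : R) : 0 <= x -> expR x - 1 <= x * expR x.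
Proof.
move=> x0; have := expR_ge1Dx (- x); rewrite expRN => h.
have e0 := expR_gt0 x.
have : (1 - x) * expR x <= 1 by rewrite -ler_pdivlMr // div1r.
lra.
Qed.

(** Both bounds go through one induction, since F P - 1 = (F - 1) P + (P - 1) needs the size of P as
    well as its distance to 1. *)
Lemma prod_sub1_le (I : Type) (s : seq I) (F : I -> C) :
  nrm (\prod_(i <- s) F i) <= expR (\sum_(i <- s) nrm (F i - 1)) /\
  nrm (\prod_(i <- s) F i - 1) <= expR (\sum_(i <- s) nrm (F i - 1)) - 1.
Proof.
elim: s => [|i s [IH1 IH2]].
  by rewrite !big_nil nrm1 expR0 subrr nrm0 subrr.
rewrite !big_cons expRD; set a := nrm (F i - 1).
have a0 : 0 <= a by exact: nrm_ge0.
have Fi : nrm (F i) <= 1 + a.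
  by have := nrmD 1 (F i - 1); rewrite nrm1 addrC subrK.
have ea := expR_ge1Dx a.
set S := expR (\sum_(j <- s) _) in IH1 IH2 *.
set P := \prod_(j <- s) F j in IH1 IH2 *.
have S0 : 0 <= S by exact: expR_ge0.
split; first by rewrite nrmM ler_pM ?nrm_ge0 //; lra.
have -> : F i * P - 1 = (F i - 1) * P + (P - 1) by ring.
apply: le_trans (nrmD _ _) _; rewrite nrmM -/a.
have h1 : a * nrm P <= a * S by rewrite ler_wpM2l.
have h2 : (1 + a) * S <= expR a * S by rewrite ler_wpM2r.
lra.
Qed.

Lemma is_cvg_prod_ibox (F : int * int -> C) (A : R) : 0 <= A ->
  (forall p, p != (0, 0) -> nrm (F p - 1) <= A / imaxR p ^+ 3) ->
  cvgn (fun N => \prod_(p <- ibox N) F p).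
Proof.
move=> A0 hF; pose E := expR (16 * A).
have E0 : 0 <= E by exact: expR_ge0.
apply: (@telescope_is_cvgC _ _ (E * (E * (16 * A)))).
  by rewrite !mulr_ge0.
move=> N; rewrite prod_iboxS.
set P := \prod_(p <- ibox N) F p; set Q := \prod_(p <- _) F p.
have -> : P * Q - P = P * (Q - 1) by ring.
rewrite nrmM -mulrA; apply: ler_pM; rewrite ?nrm_ge0 //.
  have [h _] := prod_sub1_le (ibox N) F; apply: le_trans h _.
  by rewrite ler_expR sum_ibox_le.
have [_ h] := prod_sub1_le (ishell N.+1) F; apply: le_trans h _.
set S := \sum_(i <- _) _.
have S0 : 0 <= S by apply: sumr_ge0 => i _; exact: nrm_ge0.
have SA : S <= 16 * A * (N.+1%:R^-1 - N.+2%:R^-1) by exact: sum_ishell_le.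
apply: le_trans (expR_sub1_le S0) _.
rewrite -mulrA mulrC; apply: ler_pM; rewrite ?expR_ge0 //.
rewrite ler_expR; apply: le_trans SA _; rewrite ler_piMr ?mulr_ge0 //.
have : N.+1%:R^-1 <= 1 :> R by rewrite invf_le1 ?ltr0n // ler1n.
have : 0 <= N.+2%:R^-1 :> R by rewrite invr_ge0.
by move: (N.+1%:R^-1) (N.+2%:R^-1) => x y; lra.
Qed.

Lemma prod_ibox_sub1_le (F : int * int -> C) (A : R) N : 0 <= A ->
  (forall p, p != (0, 0) -> nrm (F p - 1) <= A / imaxR p ^+ 3) ->
  nrm (\prod_(p <- ibox N) F p - 1) <= 16 * A * expR (16 * A).
Proof.
move=> A0 hF; have [_ h] := prod_sub1_le (ibox N) F; apply: le_trans h _.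
apply: le_trans (expR_sub1_le _) _.
  by apply: sumr_ge0 => i _; exact: nrm_ge0.
have h : \sum_(i <- ibox N) nrm (F i - 1) <= 16 * A by exact: sum_ibox_le.
apply: ler_pM; rewrite ?expR_ge0 ?ler_expR //.
by apply: sumr_ge0 => i _; exact: nrm_ge0.
Qed.

End IndexSums.

(** * Factors attached to one lattice point *)

Section LocalEstimates.
Variable R : realType.
Local Notation C := (cplx R).
Implicit Types s t x z h : C.

Lemma one_sub_neq0 s : nrm s <= 1 / 2 -> 1 - s != 0.
Proof.
move=> hs; rewrite -nrm_gt0; have := nrm_geB 1 s; rewrite nrm1; lra.
Qed.

Lemma nrm_one_sub_inv s : nrm s <= 1 / 2 -> nrm (1 - s)^-1 <= 2.
Proof.
move=> hs; rewrite nrmV -[leRHS]invrK lef_pV2 ?posrE ?invr_gt0 ?nrm_gt0 ?one_sub_neq0 //.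
have := nrm_geB 1 s; rewrite nrm1; lra.
Qed.

Lemma isO_one_sub_inv : isO 0 (fun s => (1 - s)^-1).
Proof. by exists 2, (1 / 2); split=> // s _ hs; rewrite mulr1 nrm_one_sub_inv. Qed.

Lemma isO_one_sub_invX n : isO 0 (fun s => (1 - s) ^- n).
Proof.
elim: n => [|n IH].
  by apply: eq_isO (isO_cst 1) => s; rewrite expr0 invr1.
apply: (@eq_isO _ _ (fun s => (1 - s)^-1 * (1 - s) ^- n)).
  by move=> s; rewrite exprS invfM.
exact: (@isOM _ 0 0 _ _ isO_one_sub_inv IH).
Qed.

(** The Taylor remainder of order k of (1 - s)^-n has exactly the form s^k q(s) (1 - s)^-n with q a
    polynomial of degree less than n. The explicit numerators in the following lemmas are these
    q. *)
Lemma isO_geom_rem n k (f : C -> C) (q : C -> C) : polyfun q ->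
  (forall s, 1 - s != 0 -> f s = s ^+ k * (q s * (1 - s) ^- n)) -> isO k f.
Proof.
move=> hq E.
have h : isO k (fun s => s ^+ k * (q s * (1 - s) ^- n)).
  rewrite -[k in isO k]addn0; apply: (@isOM _ k 0); first exact: isO_X.
  by apply: (@isOM _ 0 0); [exact: isO_polyfun | exact: isO_one_sub_invX].
apply: (@isO_near _ _ _ _ (1 / 2)) h => // s _ hs.
by rewrite E // one_sub_neq0.
Qed.

Lemma isO_inv2 : isO 5 (fun s => (1 - s) ^- 2 -
  (1 + 2 * s + 3 * s ^+ 2 + 4 * s ^+ 3 + 5 * s ^+ 4)).
Proof.
apply: (@isO_geom_rem 2 5 _ (fun s => 6 + - (5 * s))); first by polyfun_tac.
by move=> s s1; field.
Qed.

Lemma isO_inv2_1 : isO 1 (fun s => (1 - s) ^- 2 - 1).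
Proof.
apply: (@isO_geom_rem 2 1 _ (fun s => 2 + - s)); first by polyfun_tac.
by move=> s s1; field.
Qed.

Lemma isO_inv2_2 : isO 2 (fun s => (1 - s) ^- 2 - 1 - 2 * s).
Proof.
apply: (@isO_geom_rem 2 2 _ (fun s => 3 + - (2 * s))); first by polyfun_tac.
by move=> s s1; field.
Qed.

Lemma isO_inv3 : isO 4 (fun s => (1 - s) ^- 3 -
  (1 + 3 * s + 6 * s ^+ 2 + 10 * s ^+ 3)).
Proof.
apply: (@isO_geom_rem 3 4 _ (fun s => 15 + - (24 * s) + 10 * s ^+ 2)).
  by polyfun_tac.
by move=> s s1; field.
Qed.

Lemma isO_inv4 : isO 1 (fun s => (1 - s) ^- 4 - 1).
Proof.
apply: (@isO_geom_rem 4 1 _ (fun s => 4 + - (6 * s) + 4 * s ^+ 2 + - s ^+ 3)).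
  by polyfun_tac.
by move=> s s1; field.
Qed.

(* The Taylor polynomial of log(1 + s), so that psi s and psi_inv s are 1 + O(s^6). *)
Definition log_quintic : C -> C := quintic 0 1 (- 1 / 2) (1 / 3) (- 1 / 4) (1 / 5).

Definition psi s : C := (1 + s) * cexp (- log_quintic s).
Definition psi_inv s : C := cexp (log_quintic s) / (1 + s).

Lemma isO_cexp_quintic a c2 c3 c4 c5 : isO 0 (fun x : C => cexp (quintic 0 a c2 c3 c4 c5 x)).
Proof.
apply: (@eq_isO _ _ (fun x => (cexp (quintic 0 a c2 c3 c4 c5 x)
    - exp_quintic a c2 c3 c4 c5 x) + exp_quintic a c2 c3 c4 c5 x)).
  by move=> x; rewrite subrK.
apply: isOD; first exact: isO_le (cexp_quintic _ _ _ _ _).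
by apply: isO_polyfun; exact: polyfun_quintic.
Qed.

Lemma isO_cexp_log : isO 6 (fun s => cexp (log_quintic s) - (1 + s)).
Proof.
apply: eq_isO (cexp_quintic 1 (- 1 / 2) (1 / 3) (- 1 / 4) (1 / 5)) => s.
congr (_ - _).
rewrite /exp_quintic /quintic /exp_coef2 /exp_coef3 /exp_coef4 /exp_coef5.
by field.
Qed.

Lemma isO_psi_inv : isO 6 (fun s => psi_inv s - 1).
Proof.
have [K [d [K0 d0 h]]] := isO_one_sub_inv.
have h1 : isO 0 (fun s => (1 + s)^-1).
  exists K, d; split=> // s s0 sd.
  by have := h (- s); rewrite oppr_eq0 nrmN opprK; apply.
apply: (@isO_near _ _ (fun s => (cexp (log_quintic s) - (1 + s)) * (1 + s)^-1) _ (1 / 2)) => //.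
  move=> s _ hs; rewrite /psi_inv; field.
  by rewrite -[s]opprK one_sub_neq0 // nrmN.
exact: (@isOM _ 6 0 _ _ isO_cexp_log h1).
Qed.

Lemma isO_psi : isO 6 (fun s => psi s - 1).
Proof.
have h1 : isO 0 (fun s => cexp (- log_quintic s)).
  apply: eq_isO (isO_cexp_quintic (- 1) (1 / 2) (- 1 / 3) (1 / 4) (- 1 / 5)) => s.
  by congr cexp; rewrite /log_quintic /quintic; field.
apply: (@eq_isO _ _ (fun s => - ((cexp (log_quintic s) - (1 + s)) * cexp (- log_quintic s)))).
  by move=> s; rewrite mulrBl cexpNK /psi opprB.
by apply: isON; exact: (@isOM _ 6 0 _ _ isO_cexp_log h1).
Qed.

(** The Weierstrass elementary factor E_2. Being 1 + O(s^3), it meets the cubic decay required for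
    products over a lattice of rank 2. *)
Definition sigma_factor s : C := (1 - s) * cexp (s + s ^+ 2 / 2).

Lemma isO_sigma_factor : isO 3 (fun s => sigma_factor s - 1).
Proof.
pose q s : C := exp_quintic 1 (1 / 2) 0 0 0 s.
apply: (@eq_isO _ _ (fun s => (1 - s) * (cexp (quintic 0 1 (1 / 2) 0 0 0 s) - q s)
   + ((1 - s) * q s - 1))).
  move=> s; rewrite /sigma_factor.
  have -> : quintic 0 1 (1 / 2) 0 0 0 s = s + s ^+ 2 / 2 by rewrite /quintic; field.
  ring.
apply: isOD.
  apply: (@isO_le _ 3 6) => //; apply: (@isOM _ 0 6); last exact: cexp_quintic.
  by apply: isO_polyfun; polyfun_tac.
pose r s : C := - (exp_coef3 1 (1/2) 0 - exp_coef4 1 (1/2) 0 0) * s 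
   - (exp_coef4 1 (1/2) 0 0 - exp_coef5 1 (1/2) 0 0 0) * s ^+ 2 
   - exp_coef5 1 (1 / 2) 0 0 0 * s ^+ 3 + (exp_coef3 1 (1/2) 0 - 1).
apply: (@eq_isO _ _ (fun s => s ^+ 3 * r s)).
  move=> s; rewrite /r /q /exp_quintic /quintic /exp_coef2 /exp_coef3 /exp_coef4 /exp_coef5.
  by field.
by apply: isO_Xpoly; polyfun_tac.
Qed.

Lemma isO_sigma_factor_inv : isO 3 (fun s => (sigma_factor s)^-1 - 1).
Proof.
pose E s : C := cexp (quintic 0 (- 1) (- 1 / 2) 0 0 0 s).
have h1 : isO 0 (fun s => (1 - s)^-1 * E s).
  exact: (@isOM _ 0 0 _ _ isO_one_sub_inv (isO_cexp_quintic _ _ _ _ _)).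
have h2 := @isOM _ 3 0 _ _ isO_sigma_factor h1.
apply: (@isO_near _ _ (fun s => - ((sigma_factor s - 1) * ((1 - s)^-1 * E s))) _ (1 / 2)) => //.
  move=> s _ hs; have s1 := one_sub_neq0 hs.
  have -> : (1 - s)^-1 * E s = (sigma_factor s)^-1.
    rewrite invfM -cexpN; congr (_ * cexp _); rewrite /quintic; by field.
  by rewrite mulrBl divff ?mul1r ?opprB // mulf_neq0 ?cexp_neq0.
exact: isON.
Qed.

End LocalEstimates.

(** * Lattice sums *)

Section AbstractLattice.
Variable R : realType.
Local Notation C := (cplx R).
Variable w : int * int -> C.
(** This normalization gives |w| >= 1 away from the origin, so that z/w is as small as z for all w
    at once, and reduces every lattice estimate to one on indices. *)
Hypothesis w_ge : forall p, imaxR R p <= nrm (w p).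
Hypothesis w_opp : forall p, w (- p.1, - p.2) = - w p.

Lemma w_ge1 p : p != (0, 0) -> 1 <= nrm (w p).
Proof. by move=> /(imaxR_ge1 R) /le_trans; apply. Qed.

Lemma w_neq0 p : p != (0, 0) -> w p != 0.
Proof. by move=> /w_ge1 h; rewrite -nrm_gt0 (lt_le_trans ltr01). Qed.

Lemma wV_le p k : (3 <= k)%N -> p != (0, 0) -> nrm (w p) ^- k <= (imaxR R p ^+ 3)^-1.
Proof.
move=> k3 p0; have M1 := imaxR_ge1 R p0; have W1 := w_ge1 p0.
have W0 : 0 < nrm (w p) by exact: lt_le_trans W1.
have M0 : 0 < imaxR R p by exact: lt_le_trans M1.
rewrite lef_pV2 ?posrE ?exprn_gt0 //.
apply: (@le_trans _ _ (nrm (w p) ^+ 3)).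
  by rewrite lerXn2r ?nnegrE ?w_ge ?(ltW W0) ?(ltW M0).
by rewrite ler_weXn2l.
Qed.

Definition lsummable (F : int * int -> C) : Prop :=
  exists2 A : R, 0 <= A & forall p, p != (0, 0) -> nrm (F p) <= A / imaxR R p ^+ 3.

Definition lsum (F : int * int -> C) : C := limn (fun N => \sum_(p <- ibox N) F p).

Lemma lsum_cvg F : lsummable F -> (fun N => \sum_(p <- ibox N) F p) @ \oo --> lsum F.
Proof. by move=> [A A0 h]; exact: (@is_cvg_sum_ibox _ F A). Qed.

Lemma lsum_unique F l : (fun N => \sum_(p <- ibox N) F p) @ \oo --> l -> lsum F = l.
Proof. by move=> h; apply: cvg_lim. Qed.

Lemma lsum_le F (A : R) : 0 <= A ->
  (forall p, p != (0, 0) -> nrm (F p) <= A / imaxR R p ^+ 3) -> nrm (lsum F) <= 16 * A.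
Proof.
move=> A0 h; rewrite -[lsum F]subr0.
apply: (@cvg_nrm_le _ (fun N => \sum_(p <- ibox N) F p)).
  by apply: lsum_cvg; exists A.
by move=> N; rewrite subr0 nrm_sum_ibox_le.
Qed.

Lemma eq_sum_ibox (F G : int * int -> C) N : (forall p, p != (0, 0) -> F p = G p) ->
  \sum_(p <- ibox N) F p = \sum_(p <- ibox N) G p.
Proof. by move=> h; apply: eq_big_seq => p; rewrite mem_ibox => /andP[/h]. Qed.

Lemma eq_lsum F G : (forall p, p != (0, 0) -> F p = G p) -> lsum F = lsum G.
Proof.
by move=> h; rewrite /lsum; congr (lim (_ @ \oo)); apply/funext => N; exact: eq_sum_ibox.
Qed.

Lemma eq_lsummable F G : (forall p, p != (0, 0) -> F p = G p) -> lsummable F -> lsummable G.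
Proof. by move=> h [A A0 hA]; exists A => // p p0; rewrite -h // hA. Qed.

Lemma lsummableD F G : lsummable F -> lsummable G -> lsummable (fun p => F p + G p).
Proof.
move=> [A A0 hA] [B B0 hB]; exists (A + B); first exact: addr_ge0.
by move=> p p0; apply: le_trans (nrmD _ _) _; rewrite mulrDl lerD ?hA ?hB.
Qed.

Lemma lsummableZ c F : lsummable F -> lsummable (fun p => c * F p).
Proof.
move=> [A A0 hA]; exists (nrm c * A); first by rewrite mulr_ge0 ?nrm_ge0.
by move=> p p0; rewrite nrmM -mulrA ler_wpM2l ?nrm_ge0 ?hA.
Qed.

Lemma lsumD F G : lsummable F -> lsummable G -> lsum (fun p => F p + G p) = lsum F + lsum G.
Proof.
move=> hF hG; apply: lsum_unique; under eq_fun do rewrite big_split.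
by apply: cvgD; exact: lsum_cvg.
Qed.

Lemma lsumZ c F : lsummable F -> lsum (fun p => c * F p) = c * lsum F.
Proof.
move=> hF; apply: lsum_unique; under eq_fun do rewrite -mulr_sumr.
by apply: cvgM; [exact: cvg_cst | exact: lsum_cvg].
Qed.

Lemma lsum_odd F : (forall p, F (- p.1, - p.2) = - F p) -> lsum F = 0.
Proof.
move=> h; apply: lsum_unique.
have E N : \sum_(p <- ibox N) F p = 0.
  have e : \sum_(p <- ibox N) F (- p.1, - p.2) = \sum_(p <- ibox N) F p.
    apply: (@sum_ibox_inj _ F (fun p => (- p.1, - p.2))).
    - by move=> [a b] [c d] /= [/oppr_inj -> /oppr_inj ->].
    - by move=> [a b]; rewrite /imax /= !abszN.
    - by rewrite /= oppr0.
  move: e; under eq_bigr do rewrite h.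
  rewrite sumrN => /eqP; rewrite eq_sym -subr_eq0 opprK -mulr2n mulrn_eq0 /=.
  by move=> /eqP.
under eq_fun do rewrite E; exact: cvg_cst.
Qed.

Lemma lattice_isO n (f : C -> C) : isO n f ->
  exists K d : R, [/\ 0 <= K, 0 < d & forall z p, z != 0 -> nrm z <= d -> p != (0, 0) ->
    nrm (f (z / w p)) <= K * nrm z ^+ n / nrm (w p) ^+ n].
Proof.
move=> [K [d [K0 d0 h]]]; exists K, d; split=> // z p z0 zd p0.
have wp0 := w_neq0 p0.
have -> : K * nrm z ^+ n / nrm (w p) ^+ n = K * nrm (z / w p) ^+ n.
  by rewrite nrmM nrmV exprMn exprVn mulrA.
apply: h; first by rewrite mulf_neq0 ?invr_neq0.
rewrite nrmM nrmV; apply: le_trans zd; rewrite ler_piMr ?nrm_ge0 //.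
by rewrite invf_le1 ?w_ge1 ?nrm_gt0.
Qed.

(** Each term is at most K |z|^n / |w|^(k + n), with K independent of w because |z/w| <= |z|; k + n
    >= 3 makes this summable. *)
Lemma lsum_isO k n (f : C -> C) : (3 <= k + n)%N -> isO n f ->
  exists K d : R, [/\ 0 <= K, 0 < d & forall z, z != 0 -> nrm z <= d ->
    lsummable (fun p => w p ^- k * f (z / w p)) /\
    nrm (lsum (fun p => w p ^- k * f (z / w p))) <= K * nrm z ^+ n].
Proof.
move=> kn /lattice_isO[K [d [K0 d0 h]]]; exists (16 * K), d; split=> //.
  by rewrite mulr_ge0.
move=> z z0 zd.
have A0 : 0 <= K * nrm z ^+ n by rewrite mulr_ge0 ?exprn_ge0 ?nrm_ge0.
have H p : p != (0, 0) ->
    nrm (w p ^- k * f (z / w p)) <= K * nrm z ^+ n / imaxR R p ^+ 3.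
  move=> p0; rewrite nrmM nrmV nrmX.
  apply: (@le_trans _ _ (K * nrm z ^+ n * nrm (w p) ^- (k + n))).
    rewrite exprD invfM mulrCA ler_wpM2l ?invr_ge0 ?exprn_ge0 ?nrm_ge0 //.
    exact: h.
  by rewrite ler_wpM2l // wV_le.
by split; [exists (K * nrm z ^+ n) | rewrite -mulrA lsum_le].
Qed.

Definition eis k : C := lsum (fun p => w p ^- k).

Lemma lsummable_eis k : (3 <= k)%N -> lsummable (fun p => w p ^- k).
Proof.
by move=> k3; exists 1 => // p p0; rewrite nrmV nrmX mul1r wV_le.
Qed.

Lemma eis_odd k : odd k -> eis k = 0.
Proof.
move=> ok; apply: lsum_odd => p; rewrite w_opp exprNn -signr_odd ok expr1 mulN1r.
by rewrite invrN.
Qed.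

(** The difference (z - w)^-k - w^-k is what the logarithm of the factor of f_Kr at w contributes as
    coefficient of x^k / k. For k >= 3, [bsum k] is (-1)^k / (k - 1)! times the derivative of order
    k - 2 of wp, less the constant [eis k]. *)
Definition bterm k z p : C := (z - w p) ^- k - w p ^- k.
Definition bsum k z : C := z ^- k + lsum (bterm k z).

Lemma sub_w_inv k z p : p != (0, 0) ->
  (z - w p) ^- k = (-1) ^+ k * (w p ^- k * (1 - z / w p) ^- k).
Proof.
move=> p0; have wp0 := w_neq0 p0.
have -> : z - w p = (-1) * (w p * (1 - z / w p)) by field.
by rewrite !exprMn !invfM -exprVn invrN1.
Qed.

(** The expansion of (1 - z/w)^-2 is summed over w term by term; the sums of odd powers of 1/w
    vanish by w -> -w. *)
Lemma bsum2_expansion : isO 5 (fun z => bsum 2 z - z ^- 2 - (3 * eis 4 * z ^+ 2 + 5 * eis 6 * z ^+ 4)).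
Proof.
have [K [d [K0 d0 h]]] := lsum_isO (isT : 3 <= 2 + 5)%N (@isO_inv2 R).
exists K, d; split=> // z z0 zd; have [sF le] := h z z0 zd.
set F := fun p => _ in sF le.
suff -> : bsum 2 z - z ^- 2 - (3 * eis 4 * z ^+ 2 + 5 * eis 6 * z ^+ 4) = lsum F by [].
have g k := @lsummable_eis k.
have -> : bsum 2 z = z ^- 2 + lsum (fun p => F p + (2 * z * w p ^- 3 + (3 * z ^+ 2 * w p ^- 4
    + (4 * z ^+ 3 * w p ^- 5 + 5 * z ^+ 4 * w p ^- 6)))).
  congr (_ + _); apply: eq_lsum => p p0; have wp0 := w_neq0 p0.
  rewrite /bterm sub_w_inv // /F sqrrN expr1n mul1r.
  set X := (1 - z / w p) ^- 2; by field.
rewrite !(lsumD, lsumZ) -/(eis 3) -/(eis 4) -/(eis 5) -/(eis 6);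
  rewrite ?(@eis_odd 3) ?(@eis_odd 5) //; do ?apply: lsummableD; do ?apply: lsummableZ;
  do ?by [exact: g | exact: sF].
by ring.
Qed.

Lemma bsum3_expansion : isO 4 (fun z => bsum 3 z - z ^- 3 + (3 * eis 4 * z + 10 * eis 6 * z ^+ 3)).
Proof.
have [K [d [K0 d0 h]]] := lsum_isO (isT : 3 <= 3 + 4)%N (@isO_inv3 R).
exists K, d; split=> // z z0 zd; have [sF le] := h z z0 zd.
set F := fun p => _ in sF le.
suff -> : bsum 3 z - z ^- 3 + (3 * eis 4 * z + 10 * eis 6 * z ^+ 3) = - lsum F by rewrite nrmN.
have g k := @lsummable_eis k.
have -> : bsum 3 z = z ^- 3 + lsum (fun p => -1 * F p + (- 2 * w p ^- 3 + (- 3 * z * w p ^- 4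
    + (- 6 * z ^+ 2 * w p ^- 5 + - 10 * z ^+ 3 * w p ^- 6)))).
  congr (_ + _); apply: eq_lsum => p p0; have wp0 := w_neq0 p0.
  rewrite /bterm sub_w_inv // /F.
  set X := (1 - z / w p) ^- 3; by field.
rewrite !(lsumD, lsumZ) -/(eis 3) -/(eis 4) -/(eis 5) -/(eis 6);
  rewrite ?(@eis_odd 3) ?(@eis_odd 5) //; do ?apply: lsummableD; do ?apply: lsummableZ;
  do ?by [exact: g | exact: sF].
by ring.
Qed.

Lemma bsum4_expansion : isO 1 (fun z => bsum 4 z - z ^- 4).
Proof.
have [K [d [K0 d0 h]]] := lsum_isO (isT : 3 <= 4 + 1)%N (@isO_inv4 R).
exists K, d; split=> // z z0 zd; have [sF le] := h z z0 zd.
suff -> : bsum 4 z - z ^- 4 = lsum (fun p => w p ^- 4 * ((1 - z / w p) ^- 4 - 1)) by [].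
rewrite /bsum addrAC subrr add0r; apply: eq_lsum => p p0.
by rewrite /bterm sub_w_inv // -signr_odd expr0; ring.
Qed.

(** For k >= 3 both parts of the term are summable separately. For k = 2 only their difference is,
    through (1 - s)^-2 - 1 = O(s), which supplies the missing power of 1/w. *)
Lemma isO_bterm k : (2 <= k)%N -> exists K d : R, [/\ 0 <= K, 0 < d &
  forall z, z != 0 -> nrm z <= d -> lsummable (bterm k z) /\ nrm (lsum (bterm k z)) <= K].
Proof.
rewrite leq_eqVlt => /orP[/eqP <-|k3].
  have [K [d [K0 d0 h]]] := lsum_isO (isT : 3 <= 2 + 1)%N (@isO_inv2_1 R).
  exists K, (Num.min d 1); split; rewrite ?lt_min ?d0 ?ltr01 //.
  move=> z z0; rewrite le_min => /andP[zd z1]; have [sF le] := h z z0 zd.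
  have E p : p != (0, 0) -> w p ^- 2 * ((1 - z / w p) ^- 2 - 1) = bterm 2 z p.
    by move=> p0; rewrite /bterm sub_w_inv // -signr_odd expr0; ring.
  split; first exact: eq_lsummable E sF.
  rewrite -(eq_lsum E); apply: le_trans le _; rewrite expr1.
  by rewrite -[leRHS]mulr1 ler_wpM2l.
have hf : isO 0 (fun s : C => (-1) ^+ k * (1 - s) ^- k - 1).
  apply: isOB; last exact: isO_cst.
  by apply: (@isOM _ 0 0); [exact: isO_cst | exact: isO_one_sub_invX].
have [|K [d [K0 d0 h]]] := @lsum_isO k 0 _ _ hf; first by rewrite addn0.
exists K, d; split=> // z z0 zd; have [sF le] := h z z0 zd.
have E p : p != (0, 0) -> w p ^- k * ((-1) ^+ k * (1 - z / w p) ^- k - 1) = bterm k z p.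
  by move=> p0; rewrite /bterm sub_w_inv //; ring.
split; first exact: eq_lsummable E sF.
by rewrite -(eq_lsum E) (le_trans le) // expr0 mulr1.
Qed.

Lemma bsum5_expansion : isO 0 (fun z => bsum 5 z - z ^- 5).
Proof.
have [K [d [K0 d0 h]]] := @isO_bterm 5 isT.
exists K, d; split=> // z z0 zd; rewrite expr0 mulr1 /bsum addrAC subrr add0r.
by have [] := h z z0 zd.
Qed.

Lemma isO2_derive1 (f : C -> C) (a c : C) :
  isO 2 (fun h => f (a + h) - f a - c * h) -> derive1 f a = c.
Proof.
move=> [K [d [K0 d0 h]]]; apply: cvg_lim => //.
apply/cvgrPdist_lt => e e0.
have eE : e = (complex.Re e)%:C%C by rewrite RRe_real // gtr0_real.
have e'0 : 0 < complex.Re e by rewrite -ltcR -eE.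
pose r := Num.min d (complex.Re e / (K + 1)).
have r0 : 0 < r by rewrite lt_min d0 divr_gt0 // ltr_wpDl.
have rC : 0 < r%:C%C :> C by rewrite ltcR.
rewrite /dnbhs /within /=; apply/nbhs_normP; exists r%:C%C => //.
move=> t /=; rewrite sub0r normrN nrm_ltC lt_min => /andP[td te] t0.
have ht := h t t0 (ltW td).
rewrite eE nrm_ltC /GRing.scale /= [t + a]addrC.
have -> : c - t^-1 * (f (a + t) - f a) = - (t^-1 * (f (a + t) - f a - c * t)).
  by field.
have nt : 0 < nrm t by rewrite nrm_gt0.
rewrite nrmN nrmM nrmV mulrC ltr_pdivrMr //.
apply: le_lt_trans ht _.
have : nrm t * (K + 1) < complex.Re e by rewrite -ltr_pdivlMr ?ltr_wpDl.
nra.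
Qed.

Lemma nrm_sub_w_ge z p : nrm z <= 1 / 2 -> p != (0, 0) -> nrm (w p) / 2 <= nrm (z - w p).
Proof.
move=> z1 p0; have := nrm_geB (w p) z; rewrite nrmB_sym.
have := w_ge1 p0; lra.
Qed.

Lemma sub_w_neq0 z p : nrm z <= 1 / 2 -> p != (0, 0) -> z - w p != 0.
Proof.
move=> z1 p0; rewrite -nrm_gt0; have := nrm_sub_w_ge z1 p0; have := w_ge1 p0; lra.
Qed.

(** Termwise differentiation with a quantitative error: H(q, h), the second order remainder of q^-2,
    is at most K |h|^2 / |q|^4, and for q = z - w this is summable because |z - w| >= |w| / 2. The
    terms w^-3 subtracted in [bterm 3] sum to zero. *)
Lemma bsum2_derivative : exists2 d : R, 0 < d & forall z, z != 0 -> nrm z <= d ->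
  isO 2 (fun h => bsum 2 (z + h) - bsum 2 z - - 2 * bsum 3 z * h).
Proof.
have [K2 [d2 [_ d20 h2]]] := @isO_bterm 2 isT.
have [K3 [d3 [_ d30 h3]]] := @isO_bterm 3 isT.
have [K [e [K0 e0 he]]] := isO_inv2_2 R.
pose d := Num.min (d2 / 2) (Num.min d3 (1 / 2)).
have d0 : 0 < d by rewrite !lt_min d30 !divr_gt0.
exists d => // z z0; rewrite !le_min => /and3P[zd2 zd3 z12].
have nz : 0 < nrm z by rewrite nrm_gt0.
pose H (q h : C) := (q + h) ^- 2 - q ^- 2 + 2 * h * q ^- 3.
have Hle q h : q != 0 -> h != 0 -> nrm h <= e * nrm q -> nrm h <= nrm q / 2 ->
    nrm (H q h) <= K * nrm h ^+ 2 / nrm q ^+ 4.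
  move=> q0 h0 hq hq2; have nq : 0 < nrm q by rewrite nrm_gt0.
  have nt : nrm (- h / q) = nrm h / nrm q by rewrite nrmM nrmN nrmV.
  have s1 : 1 - - h / q != 0.
    by apply: one_sub_neq0; rewrite nt ler_pdivrMr // mulrC mulrA mulr1.
  have -> : H q h = q ^- 2 * ((1 - - h / q) ^- 2 - 1 - 2 * (- h / q)).
    have s2 : q + h != 0.
      have -> : q + h = q * (1 - - h / q) by field.
      by rewrite mulf_neq0.
    by rewrite /H; field; rewrite opprK q0.
  rewrite nrmM nrmV nrmX.
  have -> : K * nrm h ^+ 2 / nrm q ^+ 4 = nrm q ^- 2 * (K * (nrm h / nrm q) ^+ 2).
    by field; rewrite gt_eqF.
  rewrite ler_wpM2l ?invr_ge0 ?exprn_ge0 ?nrm_ge0 // -nt; apply: he.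
    by rewrite mulf_neq0 ?oppr_eq0 ?invr_neq0.
  by rewrite nt ler_pdivrMr.
(* The first term is the remainder at the origin. Of the two factors 16, one is 2^4, from |z - w| >=
   |w| / 2, and the other is the constant in [lsum_le]. *)
pose L := K / nrm z ^+ 4 + 16 * (16 * K).
pose d' := Num.min (Num.min (d2 / 2) (e / 2)) (Num.min (e * nrm z) (Num.min (nrm z / 2) (1 / 4))).
have d'0 : 0 < d' by rewrite !lt_min !divr_gt0 ?mulr_gt0.
exists L, d'; split => //.
  by rewrite addr_ge0 ?mulr_ge0 ?invr_ge0 ?exprn_ge0 ?nrm_ge0.
move=> h h0; rewrite !le_min => /andP[/andP[hd2 he2] /and3P[hez hz2 h4]].
have zh0 : z + h != 0.
  by rewrite -nrm_gt0; have := nrm_geD z h; lra.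
have zd2' : nrm z <= d2 by lra.
have [sb2 _] := h2 z z0 zd2'.
have [sb2h _] : lsummable (bterm 2 (z + h)) /\ nrm (lsum (bterm 2 (z + h))) <= K2.
  by apply: h2 => //; apply: le_trans (nrmD _ _) _; rewrite (splitr d2) lerD.
have [sb3 _] := h3 z z0 zd3.
have s3 := lsummable_eis (leqnn 3).
pose D p := H (z - w p) h.
have DE p : D p = bterm 2 (z + h) p + (-1 * bterm 2 z p + (2 * h * bterm 3 z p + 2 * h * w p ^- 3)).
  by rewrite /D /H /bterm (_ : z - w p + h = z + h - w p); ring.
have Dle p : p != (0, 0) -> nrm (D p) <= 16 * K * nrm h ^+ 2 / imaxR R p ^+ 3.
  move=> p0; have W1 := w_ge1 p0; have qW := nrm_sub_w_ge z12 p0.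
  apply: le_trans (Hle _ _ (sub_w_neq0 z12 p0) h0 _ _) _.
  - have : e * (1 / 2) <= e * nrm (z - w p) by rewrite ler_wpM2l ?(ltW e0) //; lra.
    lra.
  - lra.
  rewrite mulrAC [leRHS]mulrAC ler_wpM2r ?exprn_ge0 ?nrm_ge0 //.
  rewrite [16 * K]mulrC -mulrA ler_wpM2l //.
  apply: (@le_trans _ _ (16 * nrm (w p) ^- 4)); last by rewrite ler_wpM2l // wV_le.
  rewrite -[16]invrK -invfM lef_pV2 ?posrE ?exprn_gt0 ?mulr_gt0 ?invr_gt0 ?exprn_gt0 //; try lra.
  have -> : 16^-1 * nrm (w p) ^+ 4 = (nrm (w p) / 2) ^+ 4 by field.
  by rewrite lerXn2r ?nnegrE ?nrm_ge0 //; lra.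
have -> : bsum 2 (z + h) - bsum 2 z - - 2 * bsum 3 z * h = H z h + lsum D.
  rewrite (@eq_lsum D _ (fun p _ => DE p)).
  have sD := lsummableD (lsummableZ (2 * h) sb3) (lsummableZ (2 * h) s3).
  rewrite (lsumD sb2h (lsummableD (lsummableZ (-1) sb2) sD)).
  rewrite (lsumD (lsummableZ (-1) sb2) sD) (lsumD (lsummableZ _ sb3) (lsummableZ _ s3)).
  rewrite (lsumZ _ sb2) (lsumZ _ sb3) (lsumZ _ s3) -/(eis 3) eis_odd //.
  by rewrite /H /bsum; ring.
apply: le_trans (nrmD _ _) _; rewrite /L mulrDl lerD //.
  by rewrite mulrAC Hle.
have -> : 16 * (16 * K) * nrm h ^+ 2 = 16 * (16 * K * nrm h ^+ 2) by ring.
by apply: lsum_le Dle; rewrite ?mulr_ge0 ?exprn_ge0 ?nrm_ge0.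
Qed.

End AbstractLattice.

(** * Expansion of f_Kr at 0 *)

Section LatticeExpansion.
Variable R : realType.
Local Notation C := (cplx R).
Variable w : int * int -> C.
Hypothesis w_ge : forall p, imaxR R p <= nrm (w p).

Definition lsigma (x : C) : C :=
  x * limn (fun N => \prod_(p <- ibox N) sigma_factor (x / w p)).

Definition zterm (z : C) (p : int * int) : C := (z - w p)^-1 + (w p)^-1 + z / w p ^+ 2.

Definition lzeta (z : C) : C := z^-1 + lsum (zterm z).

Definition lfKr (z a x : C) : C :=
  lsigma x * lsigma z / lsigma (z - x) * cexp (a * x - lzeta z * x).

Lemma cvg_cexp (u : nat -> C) (l : C) :
  u @ \oo --> l -> (fun n => cexp (u n)) @ \oo --> cexp l.
Proof.
move=> /cvgC_P hu; apply/cvgC_P => e e0.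
have L0 : 0 < nrm (cexp l) by rewrite nrm_gt0 cexp_neq0.
have M0 : 0 < nrm (cexp l) * (2 * expR 1).
  by rewrite !mulr_gt0 ?expR_gt0.
pose r := Num.min 1 (e / (nrm (cexp l) * (2 * expR 1))).
have r0 : 0 < r by rewrite lt_min ltr01 divr_gt0.
apply: filterS (hu r r0) => n; rewrite lt_min => /andP[h1 he].
rewrite nrmB_sym; rewrite nrmB_sym in h1 he.
have -> : cexp (u n) - cexp l = cexp l * (cexp (u n - l) - exp_trunc 1 (u n - l)).
  by rewrite /exp_trunc big_ord1 expr0 fact0 divr1 mulrBr mulr1 -cexpD [l + _]addrC subrK.
rewrite ltr_pdivlMr // in he; apply: le_lt_trans he.
have := cexp_taylor 1 (u n - l); rewrite !expr1 => h.
have h2 : expR (nrm (u n - l)) * nrm (u n - l) <= expR 1 * nrm (u n - l).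
  by rewrite ler_wpM2r ?nrm_ge0 // ler_expR ltW.
have h3 : nrm (cexp (u n - l) - exp_trunc 1 (u n - l)) <= 2 * (expR 1 * nrm (u n - l)) by lra.
rewrite nrmM [leRHS]mulrCA ler_wpM2l ?(ltW L0) -?mulrA //; lra.
Qed.

(** The linear factors reduce to (1 - x/v) / (1 + x/(v - z)). The logarithms of numerator and
    denominator give the coefficients of x^2, ..., x^5; their linear terms cancel against the
    exponents in the sigma factors and the zeta term. *)
Lemma sigma_quotient_factor (v z x : C) : v != 0 -> v - z != 0 -> v - z + x != 0 ->
  sigma_factor (x / v) * sigma_factor (z / v) / sigma_factor ((z - x) / v)
    * cexp (- (((z - v)^-1 + v^-1 + z / v ^+ 2) * x)) =
  cexp (quintic 0 0 (((z - v) ^- 2 - v ^- 2) / 2) (((z - v) ^- 3 - v ^- 3) / 3)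
    (((z - v) ^- 4 - v ^- 4) / 4) (((z - v) ^- 5 - v ^- 5) / 5) x)
  * (psi (- (x / v)) * psi_inv (x / (v - z))).
Proof.
move=> v0 vz vzx; rewrite /sigma_factor /psi /psi_inv.
have zv : z - v != 0 by rewrite -opprB oppr_eq0.
set a1 := x / v + _; set a2 := z / v + _; set a3 := (z - x) / v + _; set a4 := - (_ * x).
set t := quintic _ _ _ _ _ _ _; set L1 := log_quintic _; set L2 := log_quintic _.
have E : cexp a1 * cexp a2 * cexp (- a3) * cexp a4 = cexp t * (cexp (- L1) * cexp L2).
  rewrite -!cexpD; congr cexp; rewrite /a1 /a2 /a3 /a4 /t /L1 /L2 /log_quintic /quintic.
  by field; rewrite vz v0 zv.
have F : (1 - x / v) * (1 - z / v) / (1 - (z - x) / v) = (1 - x / v) / (1 + x / (v - z)).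
  by field; rewrite vz vzx v0.
rewrite invfM -cexpN.
transitivity ((1 - x / v) * (1 - z / v) / (1 - (z - x) / v)
   * (cexp a1 * cexp a2 * cexp (- a3) * cexp a4)); first by ring.
by rewrite E F; ring.
Qed.

Lemma quintic_sum (I : Type) (s : seq I) (a c2 c3 c4 c5 x : C) (F2 F3 F4 F5 : I -> C) :
  quintic 0 a c2 c3 c4 c5 x
    + \sum_(i <- s) quintic 0 0 (F2 i / 2) (F3 i / 3) (F4 i / 4) (F5 i / 5) x =
  quintic 0 a (c2 + (\sum_(i <- s) F2 i) / 2) (c3 + (\sum_(i <- s) F3 i) / 3)
    (c4 + (\sum_(i <- s) F4 i) / 4) (c5 + (\sum_(i <- s) F5 i) / 5) x.
Proof.
elim: s => [|i s IH]; first by rewrite !big_nil !mul0r !addr0.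
by rewrite !big_cons addrCA IH /quintic; field.
Qed.

(* What remains of the factor of w in f_Kr after removing the exponential of a
   polynomial of degree 5 in x; it is 1 + O((x / w)^6). *)
Let rfactor (z x : C) p := psi (- (x / w p)) * psi_inv (x / (w p - z)).

Lemma sigma_quotient_prod (z x : C) N : nrm z <= 1 / 4 -> nrm x <= 1 / 4 ->
  (\prod_(p <- ibox N) sigma_factor (x / w p)) * (\prod_(p <- ibox N) sigma_factor (z / w p))
    / (\prod_(p <- ibox N) sigma_factor ((z - x) / w p))
    * cexp (- ((\sum_(p <- ibox N) zterm z p) * x)) =
  cexp (\sum_(p <- ibox N) quintic 0 0 (bterm w 2 z p / 2) (bterm w 3 z p / 3)
     (bterm w 4 z p / 4) (bterm w 5 z p / 5) x)
  * \prod_(p <- ibox N) rfactor z x p.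
Proof.
move=> z1 x1.
have : forall p, p \in ibox N -> p != (0, 0) by move=> p; rewrite mem_ibox => /andP[].
elim: (ibox N) => [|p s IH] hs.
  by rewrite !big_nil mul0r oppr0 cexp0 invr1 !mulr1.
have p0 : p != (0, 0) by rewrite hs ?mem_head.
have {}IH : _ := IH (fun q qs => hs q (@mem_behead _ (p :: s) q qs)).
rewrite !big_cons.
have W1 := w_ge1 w_ge p0.
have vz : w p - z != 0 by rewrite -nrm_gt0; have := nrm_geB (w p) z; lra.
have vzx : w p - z + x != 0.
  by rewrite -nrm_gt0; have := nrm_geB (w p) z; have := nrm_geD (w p - z) x; lra.
have E := sigma_quotient_factor (w_neq0 w_ge p0) vz vzx.
set A := \prod_(j <- s) sigma_factor (x / _) in IH *.
set B := \prod_(j <- s) sigma_factor (z / _) in IH *.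
set D := \prod_(j <- s) sigma_factor ((z - x) / _) in IH *.
set Q := \prod_(j <- s) rfactor z x j in IH *.
set S := \sum_(j <- s) zterm z j in IH *; set T := \sum_(j <- s) _ in IH *.
have -> : cexp (- ((zterm z p + S) * x)) = cexp (- (zterm z p * x)) * cexp (- (S * x)).
  by rewrite -cexpD; congr cexp; ring.
rewrite invfM [cexp (_ + T)]cexpD.
have -> : rfactor z x p = psi (- (x / w p)) * psi_inv (x / (w p - z)) by [].
transitivity ((sigma_factor (x / w p) * sigma_factor (z / w p) / sigma_factor ((z - x) / w p)
    * cexp (- (zterm z p * x))) * (A * B / D * cexp (- (S * x)))); first by ring.
by rewrite E IH; ring.
Qed.

Lemma sigma_quotient_origin (z x : C) : z != 0 -> z - x != 0 ->
  z / (z - x) * cexp (- (z^-1 * x)) =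
  cexp (quintic 0 0 (z ^- 2 / 2) (z ^- 3 / 3) (z ^- 4 / 4) (z ^- 5 / 5) x)
    * psi_inv (- (x / z)).
Proof.
move=> z0 zx; rewrite /psi_inv.
set t := quintic _ _ _ _ _ _ _; set L := log_quintic _.
have -> : - (z^-1 * x) = t + L by rewrite /t /L /log_quintic /quintic; field.
rewrite cexpD (_ : z / (z - x) = (1 - x / z)^-1); last by field; rewrite z0 zx.
by ring.
Qed.

(** The product of the inverse factors converges as well, and the two limits multiply to 1, so
    neither vanishes. This justifies dividing by sigma(z - x) in the limit. *)
Lemma sigma_prod_cvg : exists2 d : R, 0 < d & forall x : C, x != 0 -> nrm x <= d ->
  exists2 l, l != 0 & (fun N => \prod_(p <- ibox N) sigma_factor (x / w p)) @ \oo --> l.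
Proof.
have C1 (f : C -> C) : isO 3 (fun s => f s - 1) -> exists2 d : R, 0 < d &
    forall x : C, x != 0 -> nrm x <= d -> cvgn (fun N => \prod_(p <- ibox N) f (x / w p)).
  move=> /(lattice_isO w_ge)[K [d [K0 d0 h]]]; exists d => // x x0 xd.
  apply: (@is_cvg_prod_ibox _ _ (K * nrm x ^+ 3)).
    by rewrite mulr_ge0 ?exprn_ge0 ?nrm_ge0.
  move=> p p0; apply: le_trans (h x p x0 xd p0) _.
  by rewrite ler_wpM2l ?(wV_le w_ge) ?mulr_ge0 ?exprn_ge0 ?nrm_ge0.
have [d d0 h] := C1 _ (isO_sigma_factor R).
have [e e0 h'] := C1 (fun s => (sigma_factor s)^-1) (isO_sigma_factor_inv R).
exists (Num.min (Num.min d e) (1 / 2)); first by rewrite !lt_min d0 e0 divr_gt0.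
move=> x x0; rewrite !le_min => /andP[/andP[xd xe] x2].
have /cvg_ex[l hl] := h x x0 xd.
pose v N := \prod_(p <- ibox N) (sigma_factor (x / w p))^-1.
have cv : cvgn v := h' x x0 xe.
have /cvg_ex[m hm] := cv.
exists l; last exact: hl.
suff lm : l * m = 1 by apply/eqP => l0; have := oner_eq0 C; rewrite -lm l0 mul0r eqxx.
have E : (fun N => \prod_(p <- ibox N) sigma_factor (x / w p) * v N) = (fun=> 1).
  apply/funext => N; rewrite /v -big_split /= big_seq big1 // => p.
  rewrite mem_ibox => /andP[p0 _]; rewrite divff // /sigma_factor mulf_neq0 ?cexp_neq0 //.
  apply: one_sub_neq0; rewrite nrmM nrmV; apply: le_trans x2.
  by rewrite ler_piMr ?nrm_ge0 // invf_le1 ?(w_ge1 w_ge) ?nrm_gt0 ?(w_neq0 w_ge).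
have hlm : (fun N => \prod_(p <- ibox N) sigma_factor (x / w p) * v N) @ \oo --> l * m.
  by apply: cvgM; [exact: hl | exact: hm].
rewrite E in hlm.
exact: (cvg_unique (@norm_hausdorff _ C) hlm (cvg_cst (1 : C))).
Qed.

Lemma nrm_mul_sub1 (a b : C) (K L r : R) : 0 <= K -> 0 <= L -> 0 <= r <= 1 ->
  nrm (a - 1) <= K * r -> nrm (b - 1) <= L * r -> nrm (a * b - 1) <= (K * L + K + L) * r.
Proof.
move=> K0 L0 /andP[r0 r1] ha hb.
have -> : a * b - 1 = (a - 1) * (b - 1) + ((a - 1) + (b - 1)) by ring.
apply: le_trans (nrmD _ _) _; rewrite nrmM.
have h1 : nrm (a - 1) * nrm (b - 1) <= (K * r) * (L * r) by rewrite ler_pM ?nrm_ge0.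
have h2 : (K * r) * (L * r) <= K * L * r.
  by rewrite mulrACA ler_wpM2l ?mulr_ge0 // ler_piMr.
have := nrmD (a - 1) (b - 1); lra.
Qed.

Lemma rfactor_le : exists K d : R, [/\ 0 <= K, 0 < d & forall z x : C, nrm z <= 1 / 4 ->
  x != 0 -> nrm x <= d -> forall p, p != (0, 0) ->
  nrm (rfactor z x p - 1) <= K * nrm x ^+ 6 / imaxR R p ^+ 3].
Proof.
have hpsi : isO 6 (fun s : C => psi (- s) - 1).
  have [K [d [K0 d0 h]]] := isO_psi R.
  by exists K, d; split=> // s s0 sd; have := h (- s); rewrite oppr_eq0 nrmN; apply.
have [K1 [d1 [K10 d10 h1]]] := lattice_isO w_ge hpsi.
have [K2 [d2 [K20 d20 h2]]] := isO_psi_inv R.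
(* 64 = 2^6 comes from |w - z| >= |w| / 2. *)
pose L := 64 * K2; have L0 : 0 <= L by rewrite mulr_ge0.
exists (K1 * L + K1 + L), (Num.min (Num.min d1 (d2 / 2)) 1); split.
- by rewrite !addr_ge0 ?mulr_ge0.
- by rewrite !lt_min d10 ltr01 divr_gt0.
move=> z x z4 x0; rewrite !le_min => /andP[/andP[xd1 xd2] x1] p p0.
have W1 := w_ge1 w_ge p0; have W0 : 0 < nrm (w p) by lra.
have wz : nrm (w p) / 2 <= nrm (w p - z) by have := nrm_geB (w p) z; lra.
have wz0 : 0 < nrm (w p - z) by lra.
pose r := nrm x ^+ 6 / nrm (w p) ^+ 6.
have r01 : 0 <= r <= 1.
  rewrite /r mulr_ge0 ?invr_ge0 ?exprn_ge0 ?nrm_ge0 //= ler_pdivrMr ?exprn_gt0 // mul1r.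
  by rewrite lerXn2r ?nnegrE ?nrm_ge0 //; lra.
apply: (@le_trans _ _ ((K1 * L + K1 + L) * r)); last first.
  by rewrite /r mulrA ler_wpM2l ?(wV_le w_ge) ?mulr_ge0 ?exprn_ge0 ?nrm_ge0 ?addr_ge0 ?mulr_ge0.
apply: nrm_mul_sub1 => //.
  by rewrite /r mulrA; exact: h1.
have tle : nrm (x / (w p - z)) <= 2 * (nrm x / nrm (w p)).
  rewrite nrmM nrmV ler_pdivrMr //.
  have y0 : 0 <= nrm x / nrm (w p) by rewrite divr_ge0 ?nrm_ge0.
  rewrite -[leLHS](mulfVK (lt0r_neq0 W0)); move: (nrm x / nrm (w p)) y0 => y y0.
  by rewrite [2 * y]mulrC -mulrA ler_wpM2l //; lra.
apply: le_trans (h2 _ _ _) _.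
- by rewrite mulf_neq0 ?invr_neq0 // -nrm_gt0.
- apply: le_trans tle _.
  have : nrm x / nrm (w p) <= nrm x by rewrite ler_piMr ?nrm_ge0 // invf_le1.
  lra.
have -> : L * r = K2 * (2 * (nrm x / nrm (w p))) ^+ 6.
  by rewrite /L /r; field; rewrite gt_eqF.
by rewrite ler_wpM2l // lerXn2r ?nnegrE ?nrm_ge0 // mulr_ge0 ?divr_ge0 ?nrm_ge0.
Qed.

Lemma lsummable_zterm : exists2 d : R, 0 < d & forall z : C, nrm z <= d -> lsummable (zterm z).
Proof.
exists (1 / 2); rewrite ?divr_gt0 // => z z2.
exists 2 => // p p0; have W1 := w_ge1 w_ge p0.
have w0 := w_neq0 w_ge p0; have zw0 := sub_w_neq0 w_ge z2 p0.
have -> : zterm z p = z ^+ 2 * ((z - w p)^-1 * w p ^- 2).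
  by rewrite /zterm; field; rewrite w0 zw0.
rewrite !nrmM !nrmV !nrmX.
apply: (@le_trans _ _ (1 * (2 * nrm (w p) ^- 3))); last first.
  by rewrite mul1r ler_wpM2l // (wV_le w_ge).
apply: ler_pM; rewrite ?exprn_ge0 ?mulr_ge0 ?invr_ge0 ?exprn_ge0 ?nrm_ge0 //.
  by have := nrm_ge0 z; nra.
have -> : 2 * nrm (w p) ^- 3 = (nrm (w p) / 2)^-1 * nrm (w p) ^- 2.
  by field; rewrite nrm_eq0.
rewrite ler_wpM2r ?invr_ge0 ?exprn_ge0 ?nrm_ge0 // lef_pV2 ?posrE ?nrm_gt0 //.
  exact: (nrm_sub_w_ge w_ge).
by rewrite divr_gt0 ?nrm_gt0.
Qed.

Lemma cvg_quintic (x a : C) (u2 u3 u4 u5 : nat -> C) (l2 l3 l4 l5 : C) :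
  u2 @ \oo --> l2 -> u3 @ \oo --> l3 -> u4 @ \oo --> l4 -> u5 @ \oo --> l5 ->
  (fun N => quintic 0 a (u2 N / 2) (u3 N / 3) (u4 N / 4) (u5 N / 5) x) @ \oo -->
    quintic 0 a (l2 / 2) (l3 / 3) (l4 / 4) (l5 / 5) x.
Proof.
move=> h2 h3 h4 h5; rewrite /quintic.
have M (u : nat -> C) (l b c : C) : u @ \oo --> l -> (fun N => u N / b * c) @ \oo --> l / b * c.
  by move=> h; apply: cvgM; [apply: cvgM; [exact: h | exact: cvg_cst] | exact: cvg_cst].
apply: cvgD; last exact: M.
apply: cvgD; last exact: M.
apply: cvgD; last exact: M.
apply: cvgD; last exact: M.
exact: cvg_cst.
Qed.

(** On each box, the partial quotient times exp(-T_N), with T_N the partial quintic, is exactly x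
    times a product of factors 1 + O((x/w)^6) for w != 0 and 1 + O((x/z)^6) for the origin. The
    resulting bound O(x^7) is uniform in N, hence survives the limit; multiplying back by exp(T)
    leaves only [cexp_quintic]. *)
Lemma lfKr_expansion : exists2 d : R, 0 < d & forall z : C, z != 0 -> nrm z <= d ->
  forall a : C, isO 7 (fun x => lfKr z a x - x * exp_quintic a (bsum w 2 z / 2)
    (bsum w 3 z / 3) (bsum w 4 z / 4) (bsum w 5 z / 5) x).
Proof.
have [ds ds0 hs] := sigma_prod_cvg.
have [K [dr [K0 dr0 hr]]] := rfactor_le.
have [dz dz0 hz] := lsummable_zterm.
have [K2 [d2 [_ d20 h2]]] := isO_bterm w_ge (isT : 2 <= 2)%N.
have [K3 [d3 [_ d30 h3]]] := isO_bterm w_ge (isT : 2 <= 3)%N.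
have [K4 [d4 [_ d40 h4]]] := isO_bterm w_ge (isT : 2 <= 4)%N.
have [K5 [d5 [_ d50 h5]]] := isO_bterm w_ge (isT : 2 <= 5)%N.
have [Kp [dp [Kp0 dp0 hp]]] := isO_psi_inv R.
pose d := Num.min (Num.min (ds / 2) (1 / 4)) (Num.min dz (Num.min (Num.min d2 d3) (Num.min d4 d5))).
have d0 : 0 < d by rewrite !lt_min ?divr_gt0 ?dz0 ?d20 ?d30 ?d40 ?d50.
exists d => // z z0; rewrite !le_min.
move=> /andP[/andP[zs z4] /and3P[zz /andP[zd2 zd3] /andP[zd4 zd5]]] a.
have zs' : nrm z <= ds by lra.
have nz : 0 < nrm z by rewrite nrm_gt0.
have [sz sz0 hsz] := hs z z0 zs'.
pose T x := quintic 0 a (bsum w 2 z / 2) (bsum w 3 z / 3) (bsum w 4 z / 4) (bsum w 5 z / 5) x.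
pose M := 16 * K * expR (16 * K).
have M0 : 0 <= M by rewrite !mulr_ge0 ?expR_ge0.
pose L := Kp / nrm z ^+ 6.
have L0 : 0 <= L by rewrite divr_ge0 ?exprn_ge0 ?nrm_ge0.
have main : isO 7 (fun x => lfKr z a x * cexp (- T x) - x).
  exists (L * M + L + M), (Num.min (Num.min (Num.min (ds / 2) (1 / 4)) (Num.min dr 1))
      (Num.min (nrm z / 2) (dp * nrm z))); split.
  - by apply: addr_ge0 => //; apply: addr_ge0 => //; exact: mulr_ge0.
  - by rewrite !lt_min ?divr_gt0 ?mulr_gt0 ?dr0 ?ltr01.
  move=> x x0; rewrite !le_min.
  move=> /andP[/andP[/andP[xs x4] /andP[xr x1]] /andP[xz xp]].
  have zx0 : z - x != 0 by rewrite -nrm_gt0; have := nrm_geB z x; lra.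
  have xs' : nrm x <= ds by lra.
  have zxs : nrm (z - x) <= ds by have := nrmB z x; lra.
  have [sx sx0 hsx] := hs x x0 xs'.
  have [szx szx0 hszx] := hs (z - x) zx0 zxs.
  have cz := lsum_cvg (hz z zz).
  have cb k dk Kk : (forall z : C, z != 0 -> nrm z <= dk ->
       lsummable (bterm w k z) /\ nrm (lsum (bterm w k z)) <= Kk) -> nrm z <= dk -> (fun N => z ^- k + \sum_(p <- ibox N) bterm w k z p) @ \oo --> bsum w k z.
    by move=> h zk; apply: cvgD; [exact: cvg_cst | apply: lsum_cvg; case: (h z z0 zk)].
  pose TN N := quintic 0 a ((z ^- 2 + \sum_(p <- ibox N) bterm w 2 z p) / 2)
    ((z ^- 3 + \sum_(p <- ibox N) bterm w 3 z p) / 3)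
    ((z ^- 4 + \sum_(p <- ibox N) bterm w 4 z p) / 4)
    ((z ^- 5 + \sum_(p <- ibox N) bterm w 5 z p) / 5) x.
  have cT : TN @ \oo --> T x.
    apply: cvg_quintic.
    - exact: cb h2 zd2.
    - exact: cb h3 zd3.
    - exact: cb h4 zd4.
    - exact: cb h5 zd5.
  pose S (y : C) N := y * \prod_(p <- ibox N) sigma_factor (y / w p).
  have cS (y l : C) : (fun N => \prod_(p <- ibox N) sigma_factor (y / w p)) @ \oo --> l ->
      S y @ \oo --> lsigma y.
    move=> hl; have -> : lsigma y = y * l by rewrite /lsigma (cvg_lim (@norm_hausdorff _ C) hl).
    by apply: cvgM; [exact: cvg_cst | exact: hl].
  have nS : lsigma (z - x) != 0.
    by rewrite /lsigma (cvg_lim (@norm_hausdorff _ C) hszx) mulf_neq0.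
  pose fN N := S x N * S z N / S (z - x) N
     * cexp (a * x - (z^-1 + \sum_(p <- ibox N) zterm z p) * x) * cexp (- TN N).
  have cf : fN @ \oo --> lfKr z a x * cexp (- T x).
    apply: cvgM; last by apply: cvg_cexp; exact: cvgN.
    apply: cvgM.
      apply: cvgM; first by apply: cvgM; [exact: cS hsx | exact: cS hsz].
      by apply: cvgV; [exact: nS | exact: cS hszx].
    apply: cvg_cexp; apply: cvgB; first exact: cvg_cst.
    apply: cvgM; last exact: cvg_cst.
    by apply: cvgD; [exact: cvg_cst | exact: cz].
  apply: (cvg_nrm_le cf) => N.
  have -> : fN N = x * (psi_inv (- (x / z)) * \prod_(p <- ibox N) rfactor z x p).
    rewrite /fN /S.
    have P := sigma_quotient_prod N z4 x4.
    have O := sigma_quotient_origin z0 zx0.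
    have ET : TN N = quintic 0 a (z ^- 2 / 2) (z ^- 3 / 3) (z ^- 4 / 4) (z ^- 5 / 5) x
       + \sum_(p <- ibox N) quintic 0 0 (bterm w 2 z p / 2) (bterm w 3 z p / 3)
           (bterm w 4 z p / 4) (bterm w 5 z p / 5) x.
      by rewrite quintic_sum /TN /quintic; field.
    set U := quintic 0 0 (z ^- 2 / 2) _ _ _ _ in O.
    set V := \sum_(p <- _) quintic _ _ _ _ _ _ _ in P ET.
    have -> : TN N = a * x + U + V by rewrite ET /U /quintic; ring.
    clear ET; clearbody U V.
    set Z := \sum_(p <- _) zterm z p in P *.
    have -> : a * x - (z^-1 + Z) * x = a * x + - (z^-1 * x) + - (Z * x) by ring.
    rewrite !opprD !cexpD invfM.
    set PX := \prod_(p <- _) sigma_factor (x / _) in P *.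
    set PZ := \prod_(p <- _) sigma_factor (z / _) in P *.
    set PD := \prod_(p <- _) sigma_factor ((z - x) / _) in P *.
    transitivity (x * (z / (z - x) * cexp (- (z^-1 * x))) * (PX * PZ / PD * cexp (- (Z * x)))
      * (cexp (a * x) * cexp (- (a * x))) * cexp (- U) * cexp (- V)); first by ring.
    rewrite O P cexpNK.
    transitivity (x * (cexp U * cexp (- U)) * (cexp V * cexp (- V))
      * (psi_inv (- (x / z)) * \prod_(p <- ibox N) rfactor z x p)); first by ring.
    by rewrite !cexpNK !mulr1.
  set P := psi_inv _ * _.
  have -> : x * P - x = x * (P - 1) by ring.
  have n6 : 0 <= nrm x ^+ 6 <= 1 by rewrite exprn_ge0 ?exprn_ile1 ?nrm_ge0.
  rewrite nrmM [nrm x ^+ 7]exprS mulrCA ler_wpM2l ?nrm_ge0 //.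
  apply: nrm_mul_sub1 => //.
    apply: le_trans (hp _ _ _) _.
    - by rewrite oppr_eq0 mulf_neq0 ?invr_neq0.
    - by rewrite nrmN nrmM nrmV ler_pdivrMr.
    by rewrite nrmN nrmM nrmV exprMn exprVn /L mulrA mulrAC.
  have A0 : 0 <= K * nrm x ^+ 6 by rewrite mulr_ge0 //; case/andP: n6.
  apply: le_trans (prod_ibox_sub1_le N A0 (hr z x z4 x0 xr)) _.
  have -> : M * nrm x ^+ 6 = 16 * (K * nrm x ^+ 6) * expR (16 * K) by rewrite /M; ring.
  apply: ler_wpM2l; first by apply: mulr_ge0.
  by rewrite ler_expR ler_wpM2l // ler_piMr //; case/andP: n6.
have cT0 : isO 0 (fun x => cexp (T x)) by exact: isO_cexp_quintic.
have Q := cexp_quintic a (bsum w 2 z / 2) (bsum w 3 z / 3) (bsum w 4 z / 4) (bsum w 5 z / 5).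
set q := exp_quintic _ _ _ _ _ in Q *.
apply: (@eq_isO _ 7 (fun x => (lfKr z a x * cexp (- T x) - x) * cexp (T x)
    + x ^+ 1 * (cexp (T x) - q x))).
  move=> x; have e := cexpNK (T x); rewrite mulrBl -mulrA [cexp (- _) * _]mulrC e.
  by ring.
apply: isOD; first exact: (@isOM _ 7 0).
by apply: (@isOM _ 1 6); first exact: isO_X.
Qed.

End LatticeExpansion.

(** * Taylor coefficients and remainders of convergent power series *)

Section TaylorSeries.
Variable R : realType.
Local Notation C := (cplx R).

Lemma nbhs0_nrm (P : C -> Prop) : (\forall x \near (0 : C), P x) ->
  exists2 r : R, 0 < r & forall x : C, nrm x < r -> P x.
Proof.
move=> /nbhs_normP[e /= e0 h].
have eE : e = (complex.Re e)%:C%C by rewrite RRe_real // gtr0_real.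
exists (complex.Re e); first by rewrite -ltcR -eE.
by move=> x xe; apply: h; rewrite /= sub0r normrN eE nrm_ltC.
Qed.

Lemma bounded_terms (u : nat -> C) (l : C) : series u @ \oo --> l ->
  exists2 M : R, 0 <= M & forall i, nrm (u i) <= M.
Proof.
move=> /cvgC_P /(_ 1 ltr01)[N _ hN].
exists (2 + \sum_(i < N) nrm (u i)).
  by rewrite addr_ge0 // sumr_ge0 // => i _; exact: nrm_ge0.
move=> i; have [iN|Ni] := ltnP i N.
  rewrite (bigD1 (Ordinal iN)) //= addrCA lerDl addr_ge0 // sumr_ge0 // => j _.
  exact: nrm_ge0.
have -> : u i = (l - series u i) - (l - series u i.+1).
  by rewrite /series /= big_nat_recr //=; ring.
apply: le_trans (nrmB _ _) _.
have h1 := hN i Ni; have h2 := hN i.+1 (leqW Ni); rewrite /= in h1 h2.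
have h3 : 0 <= \sum_(j < N) nrm (u j) by rewrite sumr_ge0 // => j _; exact: nrm_ge0.
lra.
Qed.

(** The terms are bounded by some M at one point s of the disc of convergence, hence dominated at x
    by a geometric series of ratio q = |x| / s <= 1/2. The induction on partial sums carries the
    factor 1 - q^N, which the plain bound 2 M q^n would not sustain. *)
Lemma taylor_remainder (f : C -> C) (c : nat -> C) : taylor_at0 f c ->
  forall n, isO n (fun x => f x - \sum_(i < n) c i * x ^+ i).
Proof.
move=> /nbhs0_nrm[r r0 h] n.
pose s := r / 2; have s0 : 0 < s by rewrite divr_gt0.
have ns : nrm (s%:C%C : C) = s by rewrite nrm_real gtr0_norm.
have [|M M0 hM] := @bounded_terms (fun i => c i * (s%:C%C : C) ^+ i) _ (h s%:C%C _).
  by rewrite ns /s; lra.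
exists (2 * M / s ^+ n), (s / 2); split.
- by rewrite !mulr_ge0 ?invr_ge0 ?exprn_ge0 ?(ltW s0).
- by rewrite divr_gt0.
move=> x x0 xs.
pose q := nrm x / s.
have q0 : 0 <= q by rewrite divr_ge0 ?nrm_ge0 ?(ltW s0).
have q2 : q <= 1 / 2 by rewrite ler_pdivrMr //; lra.
have -> : 2 * M / s ^+ n * nrm x ^+ n = 2 * M * q ^+ n.
  by rewrite /q [in RHS]expr_div_n -!mulrA; congr (_ * (_ * _)); rewrite mulrC.
have cx : series (fun i => c i * x ^+ i) @ \oo --> f x.
  by apply: h; rewrite /s in xs; lra.
have cxn : (fun N => series (fun i => c i * x ^+ i) (N + n)%N) @ \oo --> f x.
  by rewrite (cvg_shiftn n (series (fun i => c i * x ^+ i))); exact: cx.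
apply: (cvg_nrm_le cxn) => N.
suff : nrm (series (fun i => c i * x ^+ i) (N + n)%N - \sum_(i < n) c i * x ^+ i)
    <= 2 * M * q ^+ n * (1 - q ^+ N).
  move=> /le_trans; apply; rewrite ler_piMr ?mulr_ge0 ?exprn_ge0 //.
  by rewrite gerBl exprn_ge0.
elim: N => [|N IH].
  by rewrite add0n /series /= big_mkord subrr nrm0 expr0 subrr mulr0.
rewrite addSn /series /= big_nat_recr //= addrAC.
apply: le_trans (nrmD _ _) _.
have T : nrm (c (N + n)%N * x ^+ (N + n)) <= M * (q ^+ N * q ^+ n).
  have -> : x ^+ (N + n) = (s%:C%C : C) ^+ (N + n) * (x / s%:C%C) ^+ (N + n).
    by rewrite -exprMn mulrCA divff ?mulr1 // -nrm_gt0 ns.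
  rewrite mulrA nrmM.
  have -> : nrm ((x / s%:C%C) ^+ (N + n)) = q ^+ N * q ^+ n.
    by rewrite nrmX nrmM nrmV ns exprD.
  by rewrite ler_wpM2r ?mulr_ge0 ?exprn_ge0.
apply: le_trans (lerD IH T) _.
have qq : 0 <= q ^+ n * q ^+ N by rewrite mulr_ge0 ?exprn_ge0.
have h1 : M * (q ^+ n * q ^+ N) * q <= M * (q ^+ n * q ^+ N) * (1 / 2).
  by rewrite ler_wpM2l // mulr_ge0.
rewrite exprS; lra.
Qed.

Lemma taylor_coefs (f : C -> C) (c : nat -> C) q1 q2 q3 q4 q5 : taylor_at0 f c ->
  isO 7 (fun x => f x - x * quintic 1 q1 q2 q3 q4 q5 x) ->
  forall n, (n < 7)%N -> c n = nth 0 [:: 0; 1; q1; q2; q3; q4; q5] n.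
Proof.
move=> hc hq n n7; apply/eqP; rewrite -subr_eq0; apply/eqP; move: n n7.
apply: isO_coef0.
apply: eq_isO (isOB hq (taylor_remainder hc 7)) => x.
rewrite !big_ord_recr !big_ord0 /= /quintic; ring.
Qed.

Lemma isO_scale n (f : C -> C) (c t : C) : t != 0 -> isO n f -> isO n (fun x => c * f (x / t)).
Proof.
move=> t0 [K [d [K0 d0 h]]]; have nt : 0 < nrm t by rewrite nrm_gt0.
exists (nrm c * K / nrm t ^+ n), (d * nrm t); split.
- by rewrite !mulr_ge0 ?invr_ge0 ?exprn_ge0 ?nrm_ge0.
- by rewrite mulr_gt0.
move=> x x0 xd; rewrite nrmM.
have xt : nrm (x / t) = nrm x / nrm t by rewrite nrmM nrmV.
have -> : nrm c * K / nrm t ^+ n * nrm x ^+ n = nrm c * (K * nrm (x / t) ^+ n).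
  by rewrite xt [in RHS]expr_div_n -!mulrA; congr (_ * (_ * _)); rewrite mulrC.
rewrite ler_wpM2l ?nrm_ge0 //; apply: h; first by rewrite mulf_neq0 ?invr_neq0.
by rewrite xt ler_pdivrMr.
Qed.

End TaylorSeries.

(** * The lattices t(Z + iyZ) *)

Section RectangularLattice.
Variable R : realType.
Local Notation C := (cplx R).

Definition lpoint (w1 w2 : C) (p : int * int) : C := p.1%:~R * w1 + p.2%:~R * w2.

Definition period (y : R) : C := (0 +i* y)%C.

Definition rpoint (y : R) (p : int * int) : C := lpoint 1 (period y) p.

Lemma intr_complex (m : int) : (m%:~R : C) = (m%:~R)%:C%C.
Proof. by rewrite -(rmorph_int (real_complex R)). Qed.

Lemma rpointE y p : rpoint y p = (p.1%:~R +i* (p.2%:~R * y))%C.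
Proof.
rewrite /rpoint /lpoint /period mulr1 !intr_complex.
apply/eqP; rewrite eq_complex /= !mulr0 !mul0r.
by rewrite subrr !addr0 add0r !eqxx.
Qed.

Lemma nrm_rpoint y p : nrm (rpoint y p) = Num.sqrt (p.1%:~R ^+ 2 + (p.2%:~R * y) ^+ 2).
Proof. by rewrite nrm_sqrt rpointE. Qed.

Lemma rpoint_ge y : 1 <= y -> forall p, imaxR R p <= nrm (rpoint y p).
Proof.
move=> y1 [m n]; rewrite /imaxR /imax /= natr_max ge_max.
have h (x y' : R) : `|x| <= Num.sqrt (x ^+ 2 + y' ^+ 2).
  by rewrite -sqrtr_sqr ler_wsqrtr // lerDl sqr_ge0.
have ni (k : int) : (`|k|%N%:R : R) = `|k%:~R|.
  by rewrite -intr_norm -abszE.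
rewrite nrm_rpoint !ni; apply/andP; split; first exact: h.
apply: (@le_trans _ _ `|n%:~R * y|); last by rewrite addrC h.
by rewrite normrM ler_peMr // ger0_norm //; lra.
Qed.

Lemma rpoint_opp y p : rpoint y (- p.1, - p.2) = - rpoint y p.
Proof. by rewrite /rpoint /lpoint /= !rmorphN /= !mulNr opprD. Qed.

Lemma lattice_boxE (w1 w2 : C) N : (forall p, p != (0, 0) -> lpoint w1 w2 p != 0) ->
  lattice_box w1 w2 N = [seq lpoint w1 w2 p | p <- ibox N].
Proof.
move=> h; rewrite /lattice_box -/(irange N).
have -> : [seq m%:~R * w1 + n%:~R * w2 | m <- irange N, n <- irange N] =
    map (lpoint w1 w2) [seq (m, n) | m <- irange N, n <- irange N].
  by rewrite map_allpairs.
rewrite filter_map; congr map; apply: eq_filter => p /=.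
have [->|p0] := eqVneq p (0, 0); last by rewrite h.
by rewrite /lpoint /= !mul0r addr0 eqxx.
Qed.

Lemma lpoint_scale y t p : lpoint t (t * period y) p = t * rpoint y p.
Proof. by rewrite /rpoint /lpoint mulr1; ring. Qed.

Lemma lattice_box_scale y t N : 1 <= y -> t != 0 ->
  lattice_box t (t * period y) N = [seq t * rpoint y p | p <- ibox N].
Proof.
move=> y1 t0; rewrite lattice_boxE.
  by apply: eq_map => p; rewrite lpoint_scale.
by move=> p p0; rewrite lpoint_scale mulf_neq0 // (w_neq0 (rpoint_ge y1)).
Qed.

Lemma lattice_basis_scale y t : 1 <= y -> t != 0 -> lattice_basis t (t * period y).
Proof.
move=> y1 t0; rewrite /lattice_basis mulrAC divff // mul1r -complexIm /period /=.
rewrite eq_complex /= eqxx andbT; apply/eqP; lra.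
Qed.

Lemma not_in_lattice_scale y t z : 1 <= y -> t != 0 -> z != 0 -> nrm z <= 1 / 2 ->
  ~ in_lattice t (t * period y) (t * z).
Proof.
move=> y1 t0 z0 z2 [m [n E]].
have zE : z = rpoint y (m, n).
  by apply: (mulfI t0); rewrite -lpoint_scale -[RHS]/(_ + _) E.
have [e|p0] := eqVneq (m, n) (0, 0).
  by move: z0; rewrite zE e rpointE /= mul0r eq_complex /= eqxx.
by have := w_ge1 (rpoint_ge y1) p0; rewrite -zE; lra.
Qed.

Variables (y : R) (t : C).
Hypotheses (y1 : 1 <= y) (t0 : t != 0).
Local Notation w := (rpoint y).

Lemma limn_lattice_sum (F : C -> C) (G : int * int -> C) (c : C) : lsummable G ->
  (forall p, p != (0, 0) -> F (t * w p) = c * G p) ->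
  limn (fun N => \sum_(v <- lattice_box t (t * period y) N) F v) = c * lsum G.
Proof.
move=> sG FG; rewrite -(lsumZ _ sG) /lsum; congr (lim (_ @ \oo)); apply/funext => N.
by rewrite lattice_box_scale // big_map; exact: eq_sum_ibox.
Qed.

Lemma g2_scale : g2 t (t * period y) = t ^- 4 * (60 * eis w 4).
Proof.
rewrite /g2 (@limn_lattice_sum _ (fun p => w p ^- 4) (t ^- 4)).
- by rewrite mulrCA.
- exact: (lsummable_eis (rpoint_ge y1)).
by move=> p p0; rewrite exprMn invfM.
Qed.

Lemma wp_scale x : lsummable (bterm w 2 x) -> wp t (t * period y) (t * x) = t ^- 2 * bsum w 2 x.
Proof.
move=> sx; rewrite /wp (@limn_lattice_sum _ (bterm w 2 x) (t ^- 2)) //.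
  by rewrite /bsum exprMn invfM mulrDr.
by move=> p p0; rewrite /bterm -mulrBr !exprMn !invfM mulrBr.
Qed.

Lemma wzeta_scale x : x != 0 -> nrm x <= 1 / 2 -> lsummable (zterm w x) ->
  wzeta t (t * period y) (t * x) = t^-1 * lzeta w x.
Proof.
move=> x0 x2 sx; rewrite /wzeta (@limn_lattice_sum _ (zterm w x) (t^-1)) //.
  by rewrite /lzeta invfM mulrDr.
move=> p p0; have wp0 := w_neq0 (rpoint_ge y1) p0.
have xw := sub_w_neq0 (rpoint_ge y1) x2 p0.
by rewrite /zterm -mulrBr; field; rewrite wp0 xw t0.
Qed.

Lemma wsigma_scale x : wsigma t (t * period y) (t * x) = t * lsigma w x.
Proof.
rewrite /wsigma /lsigma mulrA.
have -> // : (fun N => \prod_(v <- lattice_box t (t * period y) N)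
      ((1 - t * x / v) * cexp (t * x / v + (t * x / v) ^+ 2 / 2))) =
    fun N => \prod_(p <- ibox N) sigma_factor (x / w p).
apply/funext => N; rewrite lattice_box_scale // big_map; apply: eq_bigr => p _.
by rewrite -mulf_div divff // mul1r.
Qed.

End RectangularLattice.

(** * Values of the universal polynomials at rectangular lattices *)

Section LatticeData.
Variable R : realType.
Local Notation C := (cplx R).
Variable P : nat -> mpoly.mpoly 4 rat.
Hypothesis hP : fKr_polynomials R P.

Definition fKr_coefs (a c2 c3 c4 c5 : C) : seq C :=
  [:: 0; 1; a; exp_coef2 a c2; exp_coef3 a c2 c3; exp_coef4 a c2 c3 c4;
      exp_coef5 a c2 c3 c4 c5].

Lemma derive1_wp_scale (y : R) : 1 <= y ->
  exists2 d : R, 0 < d & forall t z : C, t != 0 -> z != 0 -> nrm z <= d ->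
  derive1 (wp t (t * period y)) (t * z) = t ^- 3 * (- 2 * bsum (rpoint y) 3 z).
Proof.
move=> y1; have w_ge := rpoint_ge y1.
have [d d0 h] := bsum2_derivative w_ge (rpoint_opp y).
have [K [e [_ e0 hs]]] := isO_bterm w_ge (isT : 2 <= 2)%N.
exists (Num.min d (e / 2)); first by rewrite lt_min d0 divr_gt0.
move=> t z t0 z0; rewrite le_min => /andP[zd ze].
have nt : 0 < nrm t by rewrite nrm_gt0.
have nz : 0 < nrm z by rewrite nrm_gt0.
apply: isO2_derive1.
apply: (@isO_near _ _ _ _ (Num.min (e / 2) (nrm z / 2) * nrm t)); last first.
- exact: (isO_scale (t ^- 2) t0 (h z z0 zd)).
- move=> x x0 xd /=.
  have xt : nrm (x / t) <= Num.min (e / 2) (nrm z / 2).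
    by rewrite nrmM nrmV ler_pdivrMr.
  move: xt; rewrite le_min => /andP[xe xz].
  have s1 : lsummable (bterm (rpoint y) 2 z).
    by case: (hs z z0 _) => //; lra.
  have zx0 : z + x / t != 0 by rewrite -nrm_gt0; have := nrm_geD z (x / t); lra.
  have s2 : lsummable (bterm (rpoint y) 2 (z + x / t)).
    by case: (hs _ zx0 _) => //; have := nrmD z (x / t); lra.
  have -> : t * z + x = t * (z + x / t) by field.
  by rewrite !wp_scale //; field.
by rewrite mulr_gt0 // lt_min !divr_gt0.
Qed.

Lemma fKr_lattice_scale (y : R) (t z a x : C) : 1 <= y -> t != 0 -> z != 0 ->
  nrm z <= 1 / 2 -> lsummable (zterm (rpoint y) z) ->
  fKr_lattice t (t * period y) (t * z) a x = t * lfKr (rpoint y) z (a * t) (x / t).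
Proof.
move=> y1 t0 z0 z2 sz; rewrite /fKr_lattice /lfKr.
have -> : x = t * (x / t) by field.
have -> : t * (x / t) / t = x / t by field.
rewrite -mulrBr !wsigma_scale // wzeta_scale //.
have -> : a * t * (x / t) - lzeta (rpoint y) z * (x / t) =
   a * (t * (x / t)) - t^-1 * lzeta (rpoint y) z * (t * (x / t)) by field.
set E := cexp _; set A := lsigma _ (x / t); set B := lsigma _ z; set D := lsigma _ _.
rewrite invfM; transitivity (t * (t / t) * (A * B / D * E)); first by ring.
by rewrite divff // mulr1.
Qed.

(** The radius [d] depends on y only: it is fixed before t and a, so that t may vary at fixed z
    (homogeneity) and z may tend to 0 at fixed t (density). *)
Lemma fKr_polynomials_lattice (y : R) : 1 <= y ->
  exists2 d : R, 0 < d & forall z : C, z != 0 -> nrm z <= d -> forall t a : C, t != 0 ->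
  let b := fun k => t ^- k * bsum (rpoint y) k z in
  forall n, (n < 7)%N ->
    eval4 (P n) a (b 2%N) (- 2 * b 3%N) (t ^- 4 * (60 * eis (rpoint y) 4)) =
    (fKr_coefs a (b 2%N / 2) (b 3%N / 3) (b 4%N / 4) (b 5%N / 5))`_n.
Proof.
move=> y1; have w_ge := rpoint_ge y1.
have [d1 d10 h1] := lfKr_expansion w_ge.
have [d2 d20 h2] := lsummable_zterm w_ge.
have [K [d3 [_ d30 h3]]] := isO_bterm w_ge (isT : 2 <= 2)%N.
have [d4 d40 h4] := derive1_wp_scale y1.
pose d := Num.min (Num.min d1 d2) (Num.min (Num.min d3 d4) (1 / 2)).
have d0 : 0 < d by rewrite !lt_min d10 d20 d30 d40 divr_gt0.
exists d => // z z0; rewrite !le_min.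
move=> /andP[/andP[zd1 zd2] /andP[/andP[zd3 zd4] z2]] t a t0 b.
apply: (@taylor_coefs _ (fKr_lattice t (t * period y) (t * z) a)).
  have := hP a (lattice_basis_scale y1 t0) (not_in_lattice_scale y1 t0 z0 z2).
  rewrite (wp_scale y1 t0 (proj1 (h3 z z0 zd3))) (h4 t z t0 z0 zd4) (g2_scale y1 t0).
  by have -> : t ^- 3 * (- 2 * bsum (rpoint y) 3 z) = - 2 * b 3%N by rewrite /b mulrCA.
apply: eq_isO (isO_scale t t0 (h1 z z0 zd1 (a * t))) => x.
rewrite (fKr_lattice_scale a x y1 t0 z0 z2 (h2 z zd2)).
rewrite mulrBr; congr (_ - _); rewrite /exp_quintic /quintic /b.
rewrite /exp_coef2 /exp_coef3 /exp_coef4 /exp_coef5.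
by field.
Qed.

End LatticeData.

(** * Eisenstein series of rectangular lattices *)

Section EisensteinValues.
Variable R : realType.
Local Notation C := (cplx R).

Lemma sum_indicator (V : nmodType) (s : seq (int * int)) q (v : V) : uniq s -> q \in s ->
  \sum_(p <- s) (if p == q then v else 0) = v.
Proof.
move=> us qs; rewrite (bigD1_seq q) //= eqxx big1 ?addr0 // => p /negbTE ->.
by [].
Qed.

(* A telescoping bound for the 4(2k - 1) indices off the axes on the shell
   max(|m|, |n|) = k, where m^2 + n^2 >= k^2 + 1; it sums to 1/2 over k >= 1. *)
Lemma shell_telescope (n : nat) (k : R) : k = n.+1%:R ->
  (2 * k - 1) / (k ^+ 2 + 1) ^+ 2 <= (k ^+ 2 - k + 2)^-1 - (k ^+ 2 + k + 2)^-1.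
Proof.
move=> kE; have k1 : 1 <= k by rewrite kE ler1n.
have a0 : 0 < k ^+ 2 - k + 2 by nra.
have b0 : 0 < k ^+ 2 + k + 2 by nra.
have c0 : 0 < k ^+ 2 + 1 by nra.
have -> : (k ^+ 2 - k + 2)^-1 - (k ^+ 2 + k + 2)^-1
   = 2 * k / ((k ^+ 2 - k + 2) * (k ^+ 2 + k + 2)).
  by field; rewrite !gt_eqF.
rewrite ler_pdivrMr ?exprn_gt0 // mulrAC ler_pdivlMr ?mulr_gt0 //.
rewrite -subr_ge0.
have -> : 2 * k * (k ^+ 2 + 1) ^+ 2 - (2 * k - 1) * ((k ^+ 2 - k + 2) * (k ^+ 2 + k + 2))
  = (k - 1) * (k ^+ 3 - k ^+ 2 + 2 * k - 4) by ring.
have [n0|n0] := posnP n; first by rewrite kE n0 subrr mul0r.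
have k2 : 2 <= k by rewrite kE ler_nat.
by rewrite mulr_ge0 //; nra.
Qed.

Let axis (k : nat) : seq (int * int) :=
  [:: (k%:Z, 0%Z); (- k%:Z, 0%Z); (0%Z, k%:Z); (0%Z, - k%:Z)].

(** Four of the 8 k points of the shell lie on the axes; each of the remaining 8 k - 4 costs at most
    e. *)
Lemma ishell_lower (F : int * int -> R) (e : R) (k : nat) : (0 < k)%N ->
  (forall p, p \in ishell k -> p.1 != 0 -> p.2 != 0 -> - e <= F p) ->
  \sum_(q <- axis k) F q - e * (8 * k%:R - 4) <= \sum_(p <- ishell k) F p.
Proof.
move=> k0 hF.
pose ind q (v : R) (p : int * int) := if p == q then v else 0.
have us : uniq (ishell k) by rewrite filter_uniq ?uniq_ibox.
have ax q : q \in axis k -> q \in ishell k.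
  rewrite !inE mem_ishell mem_ibox => /or4P[] /eqP ->;
    rewrite /imax xpair_eqE /=; lia.
apply: (@le_trans _ _ (\sum_(p <- ishell k) (- e + \sum_(q <- axis k) ind q (F q + e) p))).
  have E : \sum_(p <- ishell k) \sum_(q <- axis k) ind q (F q + e) p =
      \sum_(q <- axis k) (F q + e).
    by rewrite exchange_big; apply: eq_big_seq => q /ax qs; exact: sum_indicator.
  have zs : size (ishell k) = (8 * k)%N by case: (k) k0 => // n _; exact: size_ishell.
  rewrite big_split E big_split /= !big_const_seq !count_predT !iter_addr_0 zs /=.
  by rewrite -[X in _ <= X + _]mulr_natr natrM -mulr_natr; lra.
rewrite big_seq [leRHS]big_seq; apply: ler_sum => p ps.
have ua : uniq (axis k) by rewrite /= !inE !xpair_eqE; lia.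
have [pa|pa] := boolP (p \in axis k).
  rewrite (bigD1_seq p) //= /ind eqxx big1; first lra.
  by move=> q; rewrite eq_sym => /negbTE ->.
rewrite big_seq big1 ?addr0; last first.
  by move=> q qa; rewrite /ind; case: eqP => // pq; rewrite pq qa in pa.
apply: hF => //; move: ps pa; rewrite mem_ishell /imax /axis !inE;
  case: p => a b; rewrite !xpair_eqE /=; lia.
Qed.

Lemma sum_axis (F : int * int -> R) k : \sum_(q <- axis k) F q =
  F (k%:Z, 0) + F (- k%:Z, 0) + F (0, k%:Z) + F (0, - k%:Z).
Proof. by rewrite !big_cons big_nil addr0 !addrA. Qed.

(** Only the shell k = 1 contributes its axis terms to the bound; those with larger k are merely
    nonnegative. Off the axes, the loss on shell k is at most 4 c (2 k - 1) / (k^2 + 1)^2, and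
    [shell_telescope] bounds the total by 4 c / 2. *)
Lemma sum_ibox_lower (F : int * int -> R) (c x : R) : 0 <= c ->
  (forall p, p.1 != 0 -> p.2 != 0 -> - (c / (imaxR R p ^+ 2 + 1) ^+ 2) <= F p) ->
  (forall k : nat, (0 < k)%N ->
    0 <= F (k%:Z, 0) + F (- k%:Z, 0) + F (0, k%:Z) + F (0, - k%:Z)) ->
  x <= F (1, 0) + F (- 1, 0) + F (0, 1) + F (0, - 1) ->
  forall N, x - 2 * c <= \sum_(p <- ibox N.+1) F p.
Proof.
move=> c0 hF hk h1.
pose g (k : nat) : R := ((k%:R) ^+ 2 + k%:R + 2)^-1.
have gS (k : nat) : g k = ((k.+1%:R) ^+ 2 - k.+1%:R + 2)^-1.
  by rewrite /g -natr1; congr (_^-1); ring.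
have sh k : \sum_(q <- axis k.+1) F q - 4 * c * (g k - g k.+1) <= \sum_(p <- ishell k.+1) F p.
  apply: le_trans (@ishell_lower F (c / ((k.+1%:R) ^+ 2 + 1) ^+ 2) k.+1 isT _); last first.
    move=> p; rewrite mem_ishell => /andP[/eqP e _] p1 p2.
    by have := hF p p1 p2; rewrite /imaxR e.
  rewrite lerD2l lerN2.
  have := shell_telescope (erefl k.+1%:R); rewrite -gS -/(g k.+1) => h.
  have -> : c / (k.+1%:R ^+ 2 + 1) ^+ 2 * (8 * k.+1%:R - 4) =
     4 * c * ((2 * k.+1%:R - 1) / (k.+1%:R ^+ 2 + 1) ^+ 2) by ring.
  by rewrite ler_wpM2l // mulr_ge0.
suff H N : x - 4 * c * (g 0%N - g N.+1) <= \sum_(p <- ibox N.+1) F p.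
  move=> N; apply: le_trans (H N); rewrite lerD2l lerN2.
  have g0 : g 0%N = 2^-1 by rewrite /g expr0n /= !add0r.
  have gN : 0 <= g N.+1 by rewrite invr_ge0 !addr_ge0 ?exprn_ge0.
  rewrite g0; have : 0 <= 4 * c * g N.+1 by rewrite !mulr_ge0.
  lra.
elim: N => [|N IH].
  rewrite sum_iboxS ibox0 big_nil add0r; apply: le_trans (sh 0%N).
  by rewrite lerD2r sum_axis.
rewrite sum_iboxS; apply: le_trans (lerD IH (sh N.+1)).
have := hk N.+2 isT; rewrite -sum_axis; lra.
Qed.

Lemma Re_lsum_ge (F : int * int -> C) (b : R) : lsummable F ->
  (forall N, b <= \sum_(p <- ibox N.+1) complex.Re (F p)) -> b <= complex.Re (lsum F).
Proof.
move=> /lsum_cvg /cvgC_P h hb; apply/ler_addgt0Pr => e e0.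
have [N _ hN] := h e e0; have := hN N.+1 (leqnSn N); rewrite /= => hl.
have := le_lt_trans (nrm_Re _) hl; rewrite raddfB raddf_sum /= ltr_norml => /andP[h1 _].
have := hb N; lra.
Qed.

Lemma Re_inv_ge (z : C) (k : nat) : - nrm z ^- k <= complex.Re (z ^- k).
Proof. by have := nrm_Re (z ^- k); rewrite nrmV nrmX ler_norml => /andP[]. Qed.

Lemma real_complexXV (r : R) n : (r%:C%C : C) ^- n = (r ^- n)%:C%C.
Proof. by rewrite fmorphV rmorphXn. Qed.

Lemma Re_rpoint_axis1 (y : R) (k : int) n :
  complex.Re (rpoint y (k, 0) ^- n) = k%:~R ^- n.
Proof. by rewrite rpointE /= mul0r real_complexXV. Qed.

Lemma sqr_rpoint_axis2 (y : R) (k : int) :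
  rpoint y (0, k) ^+ 2 = (- (k%:~R * y) ^+ 2)%:C%C.
Proof.
by rewrite rpointE; apply/eqP; rewrite eq_complex /= !mul0r sub0r mulr0 addr0 !eqxx.
Qed.

Lemma Re_rpoint_axis2 (y : R) (k : int) n :
  complex.Re (rpoint y (0, k) ^- (2 * n)) = (- (k%:~R * y) ^+ 2) ^- n.
Proof. by rewrite exprM sqr_rpoint_axis2 real_complexXV. Qed.

Lemma nrm_rpoint2_ge (y : R) p : p.1 != 0 -> p.2 != 0 -> 1 <= y ->
  imaxR R p ^+ 2 + y ^+ 2 <= nrm (rpoint y p) ^+ 2.
Proof.
move=> p1 p2 y1; rewrite nrm_rpoint sqr_sqrtr ?addr_ge0 ?sqr_ge0 // exprMn.
have sq (k : int) : (k%:~R : R) ^+ 2 = (`|k|%N%:R) ^+ 2.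
  by rewrite -[`|k|%N%:R]/((`|k|%N : int)%:~R : R) abszE intr_norm real_normK ?num_real.
have ge1 (k : int) : k != 0 -> 1 <= (`|k|%N%:R : R) by move=> k0; rewrite ler1n; lia.
rewrite !sq; have h1 := ge1 _ p1; have h2 := ge1 _ p2.
rewrite /imaxR /imax natr_max.
set a := `|p.1|%N%:R in h1 *; set b := `|p.2|%N%:R in h2 *.
have y2 : 1 <= y ^+ 2 by rewrite exprn_ege1.
have a2 : 1 <= a ^+ 2 by rewrite exprn_ege1.
have b2 : 1 <= b ^+ 2 by rewrite exprn_ege1.
have [ab|ba] := leP a b; first by nra.
by nra.
Qed.

Lemma eis4_neq0 (y : R) : 1 <= y <= 2 -> eis (rpoint y) 4 != 0.
Proof.
move=> /andP[y1 y2]; have w_ge := rpoint_ge y1.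
suff h : 1 / 8 <= complex.Re (eis (rpoint y) 4).
  by apply/eqP => e; move: h; rewrite e /=; lra.
apply: Re_lsum_ge; first exact: lsummable_eis.
(* The points 1 and -1 contribute 1 each, and iy and -iy at least 1/16 each because y <= 2. Off the
   axes, |w|^2 >= max^2 + 1 allows c = 1, so the bound is 2 + 1/8 - 2. *)
move=> N; apply: le_trans (@sum_ibox_lower _ 1 (2 + 1 / 8) _ _ _ _ N); first lra.
- by [].
- move=> p p1 p2; apply: le_trans (Re_inv_ge _ _).
  rewrite lerN2 div1r lef_pV2 ?posrE.
  + rewrite (exprM _ 2 2) lerXn2r ?nnegrE ?addr_ge0 ?sqr_ge0 //.
    apply: le_trans (nrm_rpoint2_ge p1 p2 y1); rewrite lerD2l exprn_ege1 //.
  + rewrite exprn_gt0 // nrm_gt0 (w_neq0 w_ge) //.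
    by case: (p) p1 => a b /=; apply: contraNN => /eqP[->].
  + by rewrite exprn_gt0 // ltr_wpDl ?sqr_ge0.
- move=> k k0; rewrite !Re_rpoint_axis1 !(@Re_rpoint_axis2 _ _ 2).
  by rewrite !addr_ge0 // invr_ge0 ?(exprM _ 2 2) ?sqr_ge0.
rewrite !Re_rpoint_axis1 !(@Re_rpoint_axis2 _ _ 2).
have -> : (1 : int)%:~R = 1 :> R by [].
have -> : (- 1 : int)%:~R = -1 :> R by [].
have hy : 1 / 16 <= (- y ^+ 2) ^- 2.
  rewrite sqrrN -exprM -[1 / 16]invrK lef_pV2 ?posrE ?exprn_gt0 ?invr_gt0 ?divr_gt0 //; try lra.
  have -> : (1 / 16)^-1 = 2 ^+ 4 :> R by field.
  by rewrite lerXn2r ?nnegrE //; lra.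
rewrite mul1r mulN1r sqrrN (exprM (-1) 2 2) sqrrN !expr1n invr1; lra.
Qed.

Lemma eis6_period2 : eis (rpoint 2) 6 != 0 :> C.
Proof.
have y1 : 1 <= 2 :> R by lra.
have w_ge := rpoint_ge y1.
suff h : 1 <= complex.Re (eis (rpoint 2) 6 : C).
  by apply/eqP => e; move: h; rewrite e /=; lra.
apply: Re_lsum_ge; first exact: lsummable_eis.
(* Sixth powers are negative on the imaginary axis, but at y = 2 they are 64 times smaller than on
   the real axis: the shell k = 1 gives 2 - 2/64 > 3/2. Off the axes, |w|^2 >= max^2 + 4 gives |w|^6
   >= 5 (max^2 + 1)^2, hence c = 1/5. *)
move=> N; apply: le_trans (@sum_ibox_lower _ (1 / 5) (3 / 2) _ _ _ _ N); first lra.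
- by lra.
- move=> p p1 p2; apply: le_trans (Re_inv_ge _ _).
  have h := nrm_rpoint2_ge p1 p2 y1.
  have W0 : 0 < nrm (rpoint (2 : R) p).
    rewrite nrm_gt0; apply: (w_neq0 w_ge).
    by case: (p) p1 => a b /=; apply: contraNN => /eqP[->].
  have M0 : 0 <= imaxR R p ^+ 2 by exact: sqr_ge0.
  rewrite lerN2 -[leRHS]invrK lef_pV2 ?posrE ?exprn_gt0 ?invr_gt0 ?divr_gt0 ?exprn_gt0 //; try lra.
  rewrite invf_div div1r invrK (exprM _ 2 3).
  set s := nrm _ ^+ 2 in h *; set m := imaxR R p ^+ 2 in h M0 *.
  have ms : m + 1 <= s by lra.
  have s5 : 5 <= s + 1 by lra.
  have h1 : 5 * (m + 1) ^+ 2 <= s ^+ 3.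
    have h2 : (m + 1) ^+ 2 <= s ^+ 2 by rewrite lerXn2r ?nnegrE //; lra.
    have h3 : 0 <= s ^+ 2 by exact: sqr_ge0.
    rewrite exprS; nra.
  lra.
- move=> k k0; rewrite !Re_rpoint_axis1 !(@Re_rpoint_axis2 _ _ 3).
  have kE : (- k%:Z)%:~R = - (k%:R) :> R by rewrite mulrNz.
  have k1 : 0 < k%:R ^+ 6 :> R by rewrite exprn_gt0 // ltr0n.
  have k2 : 0 < (k%:R ^+ 6)^-1 :> R by rewrite invr_gt0.
  have kk : k%:Z%:~R = k%:R :> R by [].
  have -> : (- (k%:Z%:~R * 2) ^+ 2) ^- 3 = - (1 / 64) * (k%:R ^+ 6)^-1 :> R.
    by rewrite kk; field; rewrite pnatr_eq0 -lt0n.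
  have -> : (- ((- k%:Z)%:~R * 2) ^+ 2) ^- 3 = - (1 / 64) * (k%:R ^+ 6)^-1 :> R.
    by rewrite kE; field; rewrite pnatr_eq0 -lt0n.
  have -> : (- k%:Z)%:~R ^- 6 = (k%:R ^+ 6)^-1 :> R.
    by rewrite kE; field; rewrite pnatr_eq0 -lt0n.
  by rewrite kk; lra.
rewrite !Re_rpoint_axis1 !(@Re_rpoint_axis2 _ _ 3).
have -> : (1 : int)%:~R = 1 :> R by [].
have -> : (- 1 : int)%:~R = -1 :> R by [].
have -> : (- (1 * 2) ^+ 2) ^- 3 = - (1 / 64) :> R by field.
have -> : (- (-1 * 2) ^+ 2) ^- 3 = - (1 / 64) :> R by field.
have -> : (-1) ^- 6 = 1 :> R by field.
by rewrite expr1n invr1; lra.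
Qed.

(** Multiplication by i permutes the points of each square box, and i^-6 = -1. *)
Lemma eis6_period1 : eis (rpoint 1) 6 = 0 :> C.
Proof.
apply: lsum_unique.
have E N : \sum_(p <- ibox N) (rpoint 1 p : C) ^- 6 = 0.
  have e : \sum_(p <- ibox N) (rpoint 1 (- p.2, p.1) : C) ^- 6 =
      \sum_(p <- ibox N) (rpoint 1 p) ^- 6.
    apply: (@sum_ibox_inj _ (fun p => (rpoint 1 p : C) ^- 6) (fun p => (- p.2, p.1))).
    - by move=> [a b] [c d] /= [/oppr_inj -> ->].
    - by move=> [a b]; rewrite /imax /= abszN maxnC.
    - by rewrite /= oppr0.
  move: e; have R6 p : (rpoint 1 (- p.2, p.1) : C) ^- 6 = - rpoint 1 p ^- 6.
    have -> : rpoint 1 (- p.2, p.1) = 'i%C * rpoint 1 p :> C.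
      rewrite !rpointE; apply/eqP; rewrite eq_complex /= !mul0r !mul1r !mulr1 sub0r add0r.
      by rewrite mulrNz !eqxx.
    rewrite exprMn (exprM _ 2 3) sqr_i.
    have -> : (-1) ^+ 3 = -1 :> C by rewrite -signr_odd.
    by rewrite mulN1r invrN.
  under eq_bigr do rewrite R6.
  by rewrite sumrN => /eqP; rewrite eq_sym -subr_eq0 opprK -mulr2n mulrn_eq0 /= => /eqP.
under eq_fun do rewrite E; exact: cvg_cst.
Qed.

Lemma nrm_subX (a b : C) (r : R) n : nrm a <= r -> nrm b <= r ->
  nrm (a ^+ n.+1 - b ^+ n.+1) <= n.+1%:R * r ^+ n * nrm (a - b).
Proof.
move=> ar br; have r0 : 0 <= r by apply: le_trans ar; exact: nrm_ge0.
elim: n => [|n IH]; first by rewrite !expr1 expr0 mulr1 mul1r.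
have -> : a ^+ n.+2 - b ^+ n.+2 = a * (a ^+ n.+1 - b ^+ n.+1) + (a - b) * b ^+ n.+1.
  by rewrite !exprS; ring.
apply: le_trans (nrmD _ _) _; rewrite !nrmM nrmX.
have h1 : nrm a * nrm (a ^+ n.+1 - b ^+ n.+1) <= r * (n.+1%:R * r ^+ n * nrm (a - b)).
  by rewrite ler_pM ?nrm_ge0.
have h2 : nrm (a - b) * nrm b ^+ n.+1 <= nrm (a - b) * r ^+ n.+1.
  by rewrite ler_wpM2l ?nrm_ge0 // lerXn2r ?nnegrE ?nrm_ge0.
apply: le_trans (lerD h1 h2) _; rewrite -[n.+2%:R]natr1 exprS; lra.
Qed.

(** Replacing y by y' moves w by at most |y - y'| max(|m|, |n|), hence 1/w by at most |y - y'| /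
    max(|m|, |n|); the power n + 1 of 1/w then moves by at most (n + 1) |y - y'| / max(|m|, |n|)^(n
    + 1), which is summable. *)
Lemma eis_lipschitz (y y' : R) n : (2 <= n)%N -> 1 <= y -> 1 <= y' ->
  nrm (eis (rpoint y) n.+1 - eis (rpoint y') n.+1 : C) <= 16 * (n.+1%:R * `|y - y'|).
Proof.
move=> n2 y1 y1'; have w_ge := rpoint_ge y1; have w_ge' := rpoint_ge y1'.
have s1 := lsummable_eis w_ge (n2 : 3 <= n.+1)%N.
have s2 := lsummable_eis w_ge' (n2 : 3 <= n.+1)%N.
have -> : eis (rpoint y) n.+1 - eis (rpoint y') n.+1 =
    lsum (fun p => rpoint y p ^- n.+1 + (-1) * rpoint y' p ^- n.+1) :> C.
  by rewrite (lsumD s1 (lsummableZ _ s2)) (lsumZ _ s2) mulN1r.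
apply: lsum_le; first by rewrite mulr_ge0.
move=> p p0; rewrite mulN1r -!exprVn.
have M1 := imaxR_ge1 R p0; have M0 : 0 < imaxR R p by lra.
have V1 : nrm (rpoint y p)^-1 <= (imaxR R p)^-1.
  by rewrite nrmV lef_pV2 ?posrE ?nrm_gt0 ?(w_neq0 w_ge).
have V2 : nrm (rpoint y' p)^-1 <= (imaxR R p)^-1.
  by rewrite nrmV lef_pV2 ?posrE ?nrm_gt0 ?(w_neq0 w_ge').
apply: le_trans (nrm_subX n V1 V2) _.
have D : nrm ((rpoint y p)^-1 - (rpoint y' p)^-1) <= `|y - y'| * (imaxR R p)^-1.
  have -> : (rpoint y p)^-1 - (rpoint y' p)^-1 =
      (rpoint y' p - rpoint y p) * (rpoint y p)^-1 * (rpoint y' p)^-1.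
    by field; rewrite (w_neq0 w_ge) // (w_neq0 w_ge').
  have E : nrm (rpoint y' p - rpoint y p) <= `|y - y'| * imaxR R p.
    have -> : rpoint y' p - rpoint y p = (0 +i* (p.2%:~R * (y' - y)))%C.
      by rewrite !rpointE; apply/eqP; rewrite eq_complex /= subrr mulrBr !eqxx.
    rewrite nrm_sqrt /= expr0n add0r sqrtr_sqr normrM mulrC distrC ler_wpM2l //.
    rewrite -intr_norm /imaxR /imax natr_max le_max -abszE; apply/orP; right.
    by [].
  rewrite !nrmM; apply: (@le_trans _ _ (`|y - y'| * imaxR R p * (imaxR R p)^-1 * (imaxR R p)^-1)).
    by rewrite !ler_pM ?mulr_ge0 ?nrm_ge0.
  by rewrite mulfK // gt_eqF.
apply: (@le_trans _ _ (n.+1%:R * (imaxR R p)^-1 ^+ n * (`|y - y'| * (imaxR R p)^-1))).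
  by rewrite ler_wpM2l // mulr_ge0 ?exprn_ge0 ?invr_ge0 // ltW.
have -> : n.+1%:R * (imaxR R p)^-1 ^+ n * (`|y - y'| * (imaxR R p)^-1) =
    n.+1%:R * `|y - y'| * (imaxR R p)^-1 ^+ n.+1 by rewrite exprSr; ring.
apply: ler_wpM2l; first by rewrite mulr_ge0.
rewrite !exprVn lef_pV2 ?posrE ?exprn_gt0 //.
by rewrite ler_weXn2l.
Qed.

End EisensteinValues.

(** * Zariski density of the lattice parameters *)

Section Density.
Variable R : realType.
Local Notation C := (cplx R).

Lemma lipschitz_cont (f : R -> R) (L : R) : 0 <= L ->
  (forall x y, `|f x - f y| <= L * `|x - y|) -> continuous f.
Proof.
move=> L0 h x; apply/cvgrPdist_lt => e e0.
near=> y.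
apply: le_lt_trans (h x y) _.
have : `|x - y| < e / (L + 1).
  near: y; apply: (@cvgr_dist_lt _ _ _ (nbhs x) _ id x) => //.
  by rewrite divr_gt0 // ltr_wpDl.
rewrite ltr_pdivlMr ?ltr_wpDl //; have := normr_ge0 (x - y); nra.
Unshelve. all: by end_near. Qed.

(** Invariant under rescaling the lattice: once t is chosen with t^-4 g2 = l, the quantity |t^-6
    g3|^2 is this ratio times a constant depending on l only. *)
Definition eis_ratio (y : R) : R :=
  nrm (eis (rpoint y) 6) ^+ 2 / nrm (eis (rpoint y) 4) ^+ 3.

Lemma eis_ratio_infinite : exists u : nat -> R,
  (forall n, 1 <= u n <= 2) /\ injective (fun n => eis_ratio (u n)).
Proof.
(* Composing with the retraction onto [1, 2] extends the Lipschitz bounds to the whole line, so that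
   continuity holds everywhere. *)
pose clamp (y : R) : R := if y <= 1 then 1 else if y <= 2 then y else 2.
have clampP y : 1 <= clamp y <= 2.
  rewrite /clamp; have [y1|y1] := leP y 1; have [y2|y2] := leP y 2 => /=;
    apply/andP; split; lra.
have clamp_mono x y : x <= y -> 0 <= clamp y - clamp x <= y - x.
  rewrite /clamp => xy; have [x1|x1] := leP x 1; have [y1|y1] := leP y 1;
    have [x2|x2] := leP x 2; have [y2|y2] := leP y 2 => /=; apply/andP; split; lra.
have clamp_le x y : `|clamp x - clamp y| <= `|x - y|.
  wlog xy : x y / x <= y.
    by move=> H; have [/H //|/ltW /H] := leP x y; rewrite distrC [leRHS]distrC.
  have /andP[h1 h2] := clamp_mono x y xy.
  by rewrite distrC [leRHS]distrC !ger0_norm //; lra.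
have clampE y : 1 <= y <= 2 -> clamp y = y.
  rewrite /clamp => /andP[y1 y2]; have [y1'|_] := leP y 1; first lra.
  by rewrite y2.
pose g k (y : R) := nrm (eis (rpoint (clamp y)) k : C).
have gc k : (2 <= k)%N -> continuous (g k.+1).
  move=> k2; apply: (@lipschitz_cont _ (16 * k.+1%:R)); first by rewrite mulr_ge0.
  move=> x y; have /andP[x1 _] := clampP x; have /andP[y1 _] := clampP y.
  have := eis_lipschitz k2 x1 y1; rewrite mulrA => h.
  apply: (@le_trans _ _ (16 * k.+1%:R * `|clamp x - clamp y|)).
    apply: le_trans h; rewrite ler_norml; apply/andP; split.
      by rewrite lerNl opprB nrmB_sym nrm_geB.
    exact: nrm_geB.
  by rewrite ler_wpM2l // mulr_ge0.
have g4 y : g 4%N y != 0 by rewrite nrm_eq0 eis4_neq0.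
pose F (y : R) := g 6%N y ^+ 2 / g 4%N y ^+ 3.
have Fc : continuous F.
  move=> y; apply: cvgM.
    by apply: (@cvg_comp _ _ _ (g 6%N) (fun x => x ^+ 2)); [exact: gc | exact: exprn_continuous].
  apply: cvgV; first by rewrite expf_neq0.
  by apply: (@cvg_comp _ _ _ (g 4%N) (fun x => x ^+ 3)); [exact: gc | exact: exprn_continuous].
have le12 : 1 <= 2 :> R by lra.
have F1 : F 1 = 0.
  by rewrite /F /g clampE ?lexx // eis6_period1 nrm0 expr0n mul0r.
have F2 : 0 < F 2.
  rewrite /F divr_gt0 // exprn_gt0 // /g; last by rewrite nrm_gt0 eis4_neq0.
  by rewrite clampE ?lexx ?le12 // nrm_gt0 eis6_period2.
have iv n : exists y : R, 1 <= y <= 2 /\ F y = F 2 / n.+1%:R.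
  have n0 : 0 < n.+1%:R :> R by rewrite ltr0n.
  have v0 : 0 <= F 2 / n.+1%:R by rewrite divr_ge0 ?ltW.
  have v2 : F 2 / n.+1%:R <= F 2 by rewrite ler_piMr ?(ltW F2) // invf_le1 // ler1n.
  have := @IVT R F 1 2 (F 2 / n.+1%:R) le12 (continuous_subspaceT Fc).
  rewrite F1 min_l ?max_r ?(ltW F2) // v0 v2 => /(_ isT)[y].
  by rewrite in_itv /= => y12 yE; exists y.
have [u hu] := choice iv; exists u; split; first by move=> n; case: (hu n).
move=> n m /= e.
have FE k : eis_ratio (u k) = F 2 / k.+1%:R.
  by have [h <-] := hu k; rewrite /F /g clampE.
move: e; rewrite !FE => /(mulfI (lt0r_neq0 F2)) /invr_inj /eqP.
by rewrite eqr_nat => /eqP [].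
Qed.

Lemma isO_sum n (I : Type) (s : seq I) (P : pred I) (f : I -> C -> C) :
  (forall i, P i -> isO n (f i)) -> isO n (fun z => \sum_(i <- s | P i) f i z).
Proof.
move=> h; elim: s => [|i s IH].
  by under eq_fun do rewrite big_nil; exact: isO0.
under eq_fun do rewrite big_cons; case: (boolP (P i)) => // Pi.
by apply: isOD => //; exact: h.
Qed.

Lemma isO_exp n k (f : C -> C) : isO n f -> isO (k * n) (fun z => f z ^+ k).
Proof.
move=> h; elim: k => [|k IH].
  by apply: eq_isO (isO_cst 1) => z; rewrite expr0.
by rewrite mulSn; apply: eq_isO (isOM h IH) => z; rewrite exprS.
Qed.

Lemma isO_horner_comp (p : {poly C}) (f : C -> C) : isO 0 f -> isO 0 (fun z => p.[f z]).
Proof.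
move=> hf; elim/poly_ind: p => [|p c IH].
  by apply: eq_isO (isO_cst 0) => z; rewrite horner0.
apply: (@eq_isO _ _ (fun z => p.[f z] * f z + c)).
  by move=> z; rewrite hornerD hornerM hornerX hornerC.
by apply: isOD; [exact: (@isOM _ 0 0) | exact: isO_cst].
Qed.

Lemma isO_horner_sub (p : {poly C}) (f : C -> C) (m : C) :
  isO 1 (fun z => f z - m) -> isO 1 (fun z => p.[f z] - p.[m]).
Proof.
move=> hf; have hf0 : isO 0 f.
  apply: (@eq_isO _ _ (fun z => (f z - m) + m)); first by move=> z; rewrite subrK.
  by apply: isOD; [exact: isO_le hf | exact: isO_cst].
elim/poly_ind: p => [|p c IH].
  by apply: eq_isO (isO0 R 1) => z; rewrite !horner0 subrr.
apply: (@eq_isO _ _ (fun z => (p.[f z] - p.[m]) * f z + p.[m] * (f z - m))).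
  by move=> z; rewrite !hornerD !hornerM !hornerX !hornerC; ring.
by apply: isOD; [exact: (@isOM _ 1 0) | apply: (@isOM _ 0 1) => //; exact: isO_cst].
Qed.

Lemma poly_infinite_roots (p : {poly C}) (u : nat -> C) : injective u ->
  (forall n, p.[u n] = 0) -> p = 0.
Proof.
move=> ui h; apply/eqP; apply: contraT => p0.
have := @max_poly_roots _ p (map u (iota 0 (size p))) p0.
rewrite map_inj_uniq // iota_uniq size_map size_iota ltnn; apply => //.
by apply/allP => _ /mapP[n _ ->]; rewrite /root h.
Qed.

(* If beta has a pole at 0, the leading coefficient in beta of a bivariate
   polynomial relation q(beta, phi) = 0 must vanish at the value of phi at 0. *)
Lemma bivariate_eq0 (q : {poly {poly C}}) (m : nat -> C) : injective m ->
  (forall n, exists beta phi : C -> C, [/\ isO 1 (fun z => (beta z)^-1),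
     isO 1 (fun z => phi z - m n) &
     exists2 d : R, 0 < d & forall z, z != 0 -> nrm z <= d ->
       beta z != 0 /\ (q.[(beta z)%:P]).[phi z] = 0]) ->
  q = 0.
Proof.
move=> mi h; apply/eqP; apply: contraT => q0.
have := lead_coef_eq0 q; rewrite (negbTE q0) => /negP[]; apply/eqP.
apply: (@poly_infinite_roots _ m) => // n.
have [beta [phi [hb hp [d d0 hz]]]] := h n.
have hp0 : isO 0 phi.
  apply: (@eq_isO _ _ (fun z => (phi z - m n) + m n)); first by move=> z; rewrite subrK.
  by apply: isOD; [exact: isO_le hp | exact: isO_cst].
pose K := (size q).-1.
have sK : size q = K.+1 by rewrite /K prednK // lt0n size_poly_eq0.
apply: isO1_cst.
apply: (@eq_isO _ _ (fun z => (lead_coef q).[phi z] - ((lead_coef q).[phi z] - (lead_coef q).[m n]))).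
  by move=> z; rewrite opprB addrC subrK.
apply: isOB; last exact: isO_horner_sub.
(* Dividing the relation by beta^K expresses the leading coefficient at phi by terms that all carry
   a factor 1/beta, hence are O(z). *)
apply: (@isO_near _ _ (fun z => - \sum_(i < K) (q`_i).[phi z] * (beta z)^-1 ^+ (K - i)) _ d d0).
  move=> z z0 zd; have [b0 E] := hz z z0 zd.
  move: E; rewrite (horner_coef q) horner_sum sK big_ord_recr /= => E.
  have bK : beta z ^+ K != 0 by rewrite expf_neq0.
  apply: (mulIf bK); rewrite lead_coefE -/K mulNr mulr_suml.
  apply/eqP; rewrite eq_sym -addr_eq0; apply/eqP; rewrite addrC -[RHS]E; congr (_ + _).
    apply: eq_bigr => i _; rewrite hornerM -rmorphXn hornerC -mulrA; congr (_ * _).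
    rewrite -[in X in _ * X = _](subnK (ltnW (ltn_ord i))) exprD mulrA exprVn mulVf ?mul1r //.
    by rewrite expf_neq0.
  by rewrite hornerM -rmorphXn hornerC.
apply: isON; apply: isO_sum => i _.
apply: (@isOM _ 0 1); first exact: isO_horner_comp.
apply: (@isO_le _ _ ((K - i) * 1)); first by rewrite muln1 subn_gt0.
exact: isO_exp.
Qed.

Lemma isO_divX m n (f : C -> C) : isO (m + n) (fun z => z ^+ m * f z) -> isO n f.
Proof.
move=> [K [d [K0 d0 h]]]; exists K, d; split=> // z z0 zd.
have := h z z0 zd; rewrite nrmM nrmX exprD mulrCA ler_pM2l //.
by rewrite exprn_gt0 // nrm_gt0.
Qed.

Lemma isO_inv_near1 (f : C -> C) : isO 1 (fun z => f z - 1) ->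
  exists2 d : R, 0 < d & forall z, z != 0 -> nrm z <= d -> 1 / 2 <= nrm (f z).
Proof.
move=> [K [d [K0 d0 h]]]; exists (Num.min d (1 / (2 * (K + 1)))).
  by rewrite lt_min d0 divr_gt0 // mulr_gt0 // ltr_wpDl.
move=> z z0; rewrite le_min => /andP[zd].
rewrite ler_pdivlMr ?mulr_gt0 ?ltr_wpDl // => zK.
have := h z z0 zd; rewrite expr1 => hz.
have := nrm_geB 1 (1 - f z); rewrite nrm1 (_ : 1 - (1 - f z) = f z); last by ring.
rewrite nrmB_sym in hz; have := nrm_ge0 z; nra.
Qed.

End Density.

(** * Laurent expansions at z = 0 and density of the lattice parameters *)

Section LatticeDensity.
Variable R : realType.
Local Notation C := (cplx R).

Section Laurent.
Variable y : R.
Hypothesis y1 : 1 <= y.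
Local Notation b2 := (bsum (rpoint y) 2).
Local Notation b3 := (bsum (rpoint y) 3).
Local Notation G4 := (eis (rpoint y) 4).
Local Notation G6 := (eis (rpoint y) 6).

Lemma laurent_bsum2 : isO 7 (fun z => z ^+ 2 * b2 z - (1 + 3 * G4 * z ^+ 4 + 5 * G6 * z ^+ 6)).
Proof.
have h := bsum2_expansion (rpoint_ge y1) (rpoint_opp y).
apply: (@isO_near _ _ _ _ 1 ltr01 _ (isOM (isO_X R 2) h)) => z z0 _.
by field.
Qed.

Lemma laurent_bsum3 : isO 7 (fun z => z ^+ 3 * b3 z - (1 - 3 * G4 * z ^+ 4 - 10 * G6 * z ^+ 6)).
Proof.
have h := bsum3_expansion (rpoint_ge y1) (rpoint_opp y).
apply: (@isO_near _ _ _ _ 1 ltr01 _ (isOM (isO_X R 3) h)) => z z0 _.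
by field.
Qed.

Lemma bsum2_near : exists2 d : R, 0 < d & forall z, z != 0 -> nrm z <= d ->
  1 / 2 <= nrm (z ^+ 2 * b2 z).
Proof.
apply: isO_inv_near1.
apply: (@eq_isO _ _ (fun z => (z ^+ 2 * b2 z - (1 + 3 * G4 * z ^+ 4 + 5 * G6 * z ^+ 6))
   + z ^+ 1 * (3 * G4 * z ^+ 3 + 5 * G6 * z ^+ 5))).
  by move=> z; ring.
apply: isOD; first exact: isO_le laurent_bsum2.
by apply: isO_Xpoly; apply: polyfunD; exact: polyfun_monomial.
Qed.

Lemma bsum3_near : exists2 d : R, 0 < d & forall z, z != 0 -> nrm z <= d ->
  1 / 2 <= nrm (z ^+ 3 * b3 z).
Proof.
apply: isO_inv_near1.
apply: (@eq_isO _ _ (fun z => (z ^+ 3 * b3 z - (1 - 3 * G4 * z ^+ 4 - 10 * G6 * z ^+ 6))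
   + z ^+ 1 * ((- 3 * G4) * z ^+ 3 + (- 10 * G6) * z ^+ 5))).
  by move=> z; ring.
apply: isOD; first exact: isO_le laurent_bsum3.
by apply: isO_Xpoly; apply: polyfunD; exact: polyfun_monomial.
Qed.

Lemma isO_bsum2_inv : isO 1 (fun z => (b2 z)^-1).
Proof.
have [d d0 h] := bsum2_near.
exists 2, (Num.min d 1); split; rewrite ?lt_min ?d0 ?ltr01 //.
move=> z z0; rewrite le_min => /andP[zd z1].
have hz := h z z0 zd; have nz : 0 < nrm z by rewrite nrm_gt0.
have nb : 0 < nrm (b2 z).
  rewrite nrm_gt0; apply/eqP => e; move: hz; rewrite e mulr0 nrm0; lra.
rewrite nrmV expr1 -[leLHS]mul1r ler_pdivrMr //.
move: hz; rewrite nrmM nrmX => hz.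
have : nrm z ^+ 2 * nrm (b2 z) <= nrm z * nrm (b2 z).
  by rewrite ler_pM2r // expr2 ler_piMr ?nrm_ge0.
lra.
Qed.

(* With beta = b2, gamma = -2 b3, this is the relation gamma^2 = 4 beta^3 - g2 beta - g3
   up to O(z), which is all that the density argument uses. *)
Lemma weierstrass_invariant :
  isO 1 (fun z => 4 * b2 z ^+ 3 - 60 * G4 * b2 z - 4 * b3 z ^+ 2 - 140 * G6).
Proof.
pose X z := z ^+ 2 * b2 z; pose Y z := z ^+ 3 * b3 z.
pose p z : C := 1 + 3 * G4 * z ^+ 4 + 5 * G6 * z ^+ 6.
pose q z : C := 1 - 3 * G4 * z ^+ 4 - 10 * G6 * z ^+ 6.
have pp : polyfun p.
  by do 2 (apply: polyfunD; last exact: polyfun_monomial); exact: polyfun_cst.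
have pq : polyfun q.
  do 2 (apply: polyfunD; last by apply: polyfunN; exact: polyfun_monomial).
  exact: polyfun_cst.
have hX : isO 7 (fun z => X z - p z) := laurent_bsum2.
have hY : isO 7 (fun z => Y z - q z) := laurent_bsum3.
have p0 := isO_polyfun pp; have q0 := isO_polyfun pq.
have X0 : isO 0 X.
  apply: (@eq_isO _ _ (fun z => (X z - p z) + p z)); first by move=> z; rewrite subrK.
  by apply: isOD => //; exact: isO_le hX.
have Y0 : isO 0 Y.
  apply: (@eq_isO _ _ (fun z => (Y z - q z) + q z)); first by move=> z; rewrite subrK.
  by apply: isOD => //; exact: isO_le hY.
apply: (@isO_divX _ 6 1).
(* Differences of cubes and of squares isolate the errors X - p and Y - q. In the remaining
   polynomial the coefficients of 1, z^4 and z^6 cancel (36 - 60 + 24 = 0 and 60 + 80 - 140 = 0), so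
   it starts at z^8. *)
apply: (@isO_near _ _ (fun z =>
   (X z - p z) * (4 * (X z ^+ 2 + X z * p z + p z ^+ 2) - 60 * G4 * z ^+ 4)
   - (Y z - q z) * (4 * (Y z + q z))
   + (4 * p z ^+ 3 - 60 * G4 * z ^+ 4 * p z - 4 * q z ^+ 2 - 140 * G6 * z ^+ 6))
   _ 1 ltr01).
  by move=> z z0 _; rewrite /X /Y; field.
have H c n : isO 0 (fun z : C => c * z ^+ n).
  by apply: (@isOM _ 0 0); [exact: isO_cst | apply: (@isO_le _ _ n) => //; exact: isO_X].
have Q c f : isO 0 f -> isO 0 (fun z : C => c * f z).
  by move=> hf; apply: (@isOM _ 0 0) => //; exact: isO_cst.
apply: isOD; first apply: isOB.
- apply: (@isOM _ 7 0) => //; apply: isOB; last exact: H.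
  apply: Q; apply: isOD; first apply: isOD.
  + exact: (@isO_exp _ 0 2).
  + exact: (@isOM _ 0 0).
  + exact: (@isO_exp _ 0 2).
- by apply: (@isOM _ 7 0) => //; apply: Q; exact: isOD.
pose r z : C := z * (- 108 * G4 ^+ 2 + - 180 * G4 * G6 * z ^+ 2
  + (108 * G4 ^+ 3 - 100 * G6 ^+ 2) * z ^+ 4 + 540 * G4 ^+ 2 * G6 * z ^+ 6
  + 900 * G4 * G6 ^+ 2 * z ^+ 8 + 500 * G6 ^+ 3 * z ^+ 10).
apply: (@eq_isO _ _ (fun z => z ^+ 7 * r z)).
  by move=> z; rewrite /r /p /q; ring.
apply: isO_Xpoly; apply: polyfunM; first exact: polyfun_id.
do 5 (apply: polyfunD; last exact: polyfun_monomial).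
exact: polyfun_cst.
Qed.

End Laurent.

Section Dense.
Variables (I : Type) (s : seq I) (k : I -> C) (e1 e2 e3 e4 : I -> nat).

Let f (a b c d : C) : C :=
  \sum_(i <- s) k i * (a ^+ e1 i * b ^+ e2 i * c ^+ e3 i * d ^+ e4 i).

(* The part of f of given parity in c, as a polynomial in c^2 (and divided by c
   in the odd case). *)
Let half (o : bool) (a b g d : C) : C :=
  \sum_(i <- s | odd (e3 i) == o) k i * (a ^+ e1 i * b ^+ e2 i * g ^+ (e3 i)./2 * d ^+ e4 i).

Let f_half a b c d : f a b c d = half false a b (c ^+ 2) d + c * half true a b (c ^+ 2) d.
Proof.
rewrite /f (bigID (fun i => odd (e3 i) == false)) /=; congr (_ + _).
  apply: eq_bigr => i /eqP oi; do 3 congr (_ * _).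
  by rewrite -exprM mul2n -[in LHS](odd_double_half (e3 i)) oi.
rewrite mulr_sumr; apply: eq_big => [i|i oi]; first by case: odd.
have -> : c ^+ e3 i = c * (c ^+ 2) ^+ (e3 i)./2.
  rewrite -exprM mul2n -exprS -[in LHS](odd_double_half (e3 i)).
  by case: odd oi.
ring.
Qed.

Hypothesis f0 : forall y : R, 1 <= y <= 2 -> exists2 d : R, 0 < d &
  forall z : C, z != 0 -> nrm z <= d -> forall t a : C, t != 0 ->
  f a (t ^- 2 * bsum (rpoint y) 2 z) (- 2 * (t ^- 3 * bsum (rpoint y) 3 z))
    (t ^- 4 * (60 * eis (rpoint y) 4)) = 0.

(** A fourth root t with t^-4 g2 = l fixes lambda, while the rescaled g3, here [m n], runs through
    infinitely many values. Replacing t by -t changes only the sign of gamma, so f vanishes at gamma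
    and -gamma; as gamma != 0 near z = 0, both halves vanish there, and [bivariate_eq0] applies. *)
Let half0 (o : bool) (a l : C) : l != 0 -> forall b g, half o a b g l = 0.
Proof.
move=> l0 b g.
(* [half o] with gamma^2 replaced by 4 X^3 - l X - phi: the outer variable is beta, which has a
   pole, and the inner one is phi, which tends to g3. *)
pose q : {poly {poly C}} := \sum_(i <- s | odd (e3 i) == o)
  (k i * (a ^+ e1 i * l ^+ e4 i))%:P%:P * 'X ^+ e2 i
   * (4%:P%:P * 'X ^+ 3 - l%:P%:P * 'X - 'X%:P) ^+ (e3 i)./2.
have qE x phi : (q.[x%:P]).[phi] = half o a x (4 * x ^+ 3 - l * x - phi) l.
  rewrite /q !horner_sum; apply: eq_bigr => i _.
  rewrite !(hornerM, horner_exp, hornerD, hornerN, hornerX, hornerC); ring.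
suff q0 : q = 0.
  have -> : g = 4 * b ^+ 3 - l * b - (4 * b ^+ 3 - l * b - g) by ring.
  by rewrite -qE q0 !horner0.
have [u [u12 uinj]] := eis_ratio_infinite R.
have G0 n : eis (rpoint (u n)) 4 != 0 :> C by rewrite eis4_neq0.
pose t n : C := 4.-root (60 * eis (rpoint (u n)) 4 / l).
have t4 n : t n ^+ 4 = 60 * eis (rpoint (u n)) 4 / l by rewrite rootCK.
have t0 n : t n != 0.
  have : t n ^+ 4 != 0 by rewrite t4 !mulf_neq0 ?invr_neq0 // pnatr_eq0.
  by apply: contraNN => /eqP ->; rewrite expr0n.
pose m n : C := t n ^- 6 * (140 * eis (rpoint (u n)) 6).
have mE n : nrm (m n) ^+ 2 = 140 ^+ 2 * (nrm l / 60) ^+ 3 * eis_ratio (u n).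
  rewrite /m /eis_ratio nrmM nrmV nrmX exprMn nrmM nrm_nat.
  have e4' : nrm (t n) ^+ 4 = 60 * nrm (eis (rpoint (u n)) 4) / nrm l.
    by rewrite -nrmX t4 !nrmM nrmV nrm_nat.
  have -> : (nrm (t n) ^- 6) ^+ 2 = (nrm (t n) ^+ 4) ^- 3.
    by rewrite exprVn -!exprM.
  rewrite e4'; field.
  by rewrite !nrm_eq0 l0 G0.
apply: (@bivariate_eq0 _ q m).
  move=> i j e; apply: uinj; have := mE i; rewrite e mE.
  move=> /mulfI; rewrite mulf_neq0 ?expf_neq0 ?mulf_neq0 ?invr_neq0 ?nrm_eq0 ?pnatr_eq0 //.
  by move=> /(_ isT) ->.
move=> n; have /andP[y1 y2] := u12 n; have [d d0 hd] := f0 (u12 n).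
pose B2 := bsum (rpoint (u n)) 2; pose B3 := bsum (rpoint (u n)) 3.
pose beta z := t n ^- 2 * B2 z; pose gamma z := - 2 * (t n ^- 3 * B3 z).
have lE : l = t n ^- 4 * (60 * eis (rpoint (u n)) 4).
  by rewrite t4; field; rewrite l0 G0.
exists beta, (fun z => 4 * beta z ^+ 3 - l * beta z - gamma z ^+ 2); split.
- apply: (@eq_isO _ _ (fun z => t n ^+ 2 * (B2 z)^-1)).
    by move=> z; rewrite /beta invfM invrK.
  by apply: (@isOM _ 0 1); [exact: isO_cst | exact: isO_bsum2_inv].
- apply: (@eq_isO _ _ (fun z => t n ^- 6 * (4 * B2 z ^+ 3 - 60 * eis (rpoint (u n)) 4 * B2 z
     - 4 * B3 z ^+ 2 - 140 * eis (rpoint (u n)) 6))).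
    by move=> z; rewrite /beta /gamma /m lE; field.
  by apply: (@isOM _ 0 1); [exact: isO_cst | exact: weierstrass_invariant].
have [d2 d20 h2] := bsum2_near y1; have [d3 d30 h3] := bsum3_near y1.
exists (Num.min d (Num.min d2 d3)); first by rewrite !lt_min d0 d20.
move=> z z0; rewrite !le_min => /and3P[zd zd2 zd3].
have b20 : B2 z != 0.
  by apply/eqP => e; have := h2 z z0 zd2; rewrite -/B2 e mulr0 nrm0; lra.
have b30 : B3 z != 0.
  by apply/eqP => e; have := h3 z z0 zd3; rewrite -/B3 e mulr0 nrm0; lra.
have beta0 : beta z != 0 by rewrite mulf_neq0 ?invr_neq0 ?expf_neq0.
have gamma0 : gamma z != 0.
  by rewrite !mulf_neq0 ?oppr_eq0 ?pnatr_eq0 ?invr_neq0 ?expf_neq0.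
split=> //; rewrite qE.
have -> : 4 * beta z ^+ 3 - l * beta z - (4 * beta z ^+ 3 - l * beta z - gamma z ^+ 2) =
   gamma z ^+ 2 by ring.
have F1 : f a (beta z) (gamma z) l = 0 by rewrite lE; exact: hd.
have F2 : f a (beta z) (- gamma z) l = 0.
  (* The lattice is the same, but the point t z becomes -t z: wp and g2 are unchanged and wp'
     changes sign. *)
  have t0' : - t n != 0 by rewrite oppr_eq0.
  have := hd z z0 zd (- t n) a t0'.
  have -> : (- t n) ^- 2 * bsum (rpoint (u n)) 2 z = beta z by rewrite sqrrN.
  have -> : (- t n) ^- 4 * (60 * eis (rpoint (u n)) 4) = l.
    by rewrite lE (exprM _ 2 2) sqrrN -exprM.
  have -> : - 2 * ((- t n) ^- 3 * bsum (rpoint (u n)) 3 z) = - gamma z.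
    by rewrite /gamma -/B3; field.
  by [].
move: F1 F2; rewrite !f_half sqrrN mulNr => F1 F2.
case: o @q qE => _ _.
  apply: (mulfI gamma0); rewrite mulr0; apply/eqP.
  have := F1; rewrite -{1}F2 => /addrI /eqP; rewrite -subr_eq0 opprK -mulr2n mulrn_eq0 /=.
  by [].
have h : gamma z * half true a (beta z) (gamma z ^+ 2) l = 0.
  have := F1; rewrite -{1}F2 => /addrI /eqP; rewrite -subr_eq0 opprK -mulr2n mulrn_eq0 /=.
  by move=> /eqP.
by move: F1; rewrite h addr0.
Qed.

(** The fourth root leaves out d = 0; there f vanishes because it is polynomial in d and zero for
    every d != 0. *)
Lemma lattice_dense a b c d : f a b c d = 0.
Proof.
have H x : x != 0 -> f a b c x = 0.
  by move=> x0; rewrite f_half !half0 // mulr0 addr0.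
have [p pE] : polyfun (f a b c).
  rewrite /f; apply: polyfun_sum => i; apply: polyfunM; first exact: polyfun_cst.
  by apply: polyfunM; [exact: polyfun_cst | apply: polyfunX; exact: polyfun_id].
rewrite pE (@isO_poly0 _ (size p) p) ?horner0 //.
by exists 0, 1; split=> // x x0 _; rewrite -pE H // nrm0 mul0r.
Qed.

End Dense.
End LatticeDensity.

(** * The universal polynomials *)

Section UniversalCoefficients.
Variable R : realType.
Local Notation C := (cplx R).

(** Polynomial functions as lists of monomials over an arbitrary index type; repeated exponents are
    allowed, so that addition is concatenation. *)
Definition poly4 (f : C -> C -> C -> C -> C) : Prop :=
  exists (I : Type) (s : seq I) (k : I -> C) (e1 e2 e3 e4 : I -> nat),
  forall a b c d, f a b c d =
    \sum_(i <- s) k i * (a ^+ e1 i * b ^+ e2 i * c ^+ e3 i * d ^+ e4 i).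

Lemma poly4D f g : poly4 f -> poly4 g -> poly4 (fun a b c d => f a b c d + g a b c d).
Proof.
move=> [I [s [k [e1 [e2 [e3 [e4 fE]]]]]]] [J [r [l [n1 [n2 [n3 [n4 gE]]]]]]].
pose m T (u : I -> T) (v : J -> T) x := match x with inl i => u i | inr j => v j end.
exists (I + J)%type, (map inl s ++ map inr r), (m _ k l), (m _ e1 n1), (m _ e2 n2),
  (m _ e3 n3), (m _ e4 n4).
by move=> a b c d; rewrite big_cat !big_map fE gE.
Qed.

Lemma poly4Z x f : poly4 f -> poly4 (fun a b c d => x * f a b c d).
Proof.
move=> [I [s [k [e1 [e2 [e3 [e4 fE]]]]]]].
exists I, s, (fun i => x * k i), e1, e2, e3, e4 => a b c d.
by rewrite fE mulr_sumr; apply: eq_bigr => i _; rewrite mulrA.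
Qed.

Lemma eq_poly4 f g : (forall a b c d, f a b c d = g a b c d) -> poly4 f -> poly4 g.
Proof.
move=> e [I [s [k [e1 [e2 [e3 [e4 fE]]]]]]].
by exists I, s, k, e1, e2, e3, e4 => a b c d; rewrite -e fE.
Qed.

Lemma poly4_eval4 p : poly4 (eval4 p).
Proof.
pose e (j : 'I_4) (m : mpoly.multinom 4) : nat := mpoly.fun_of_multinom m j.
exists _, (mpoly.msupp p), (fun m => ratr (mpoly.mcoeff m p)), (e ord0),
  (e (lift ord0 ord0)), (e (lift ord0 (lift ord0 ord0))),
  (e (lift ord0 (lift ord0 (lift ord0 ord0)))).
move=> a b c d; rewrite /eval4 /mpoly.mmap; apply: eq_bigr => m _.
by rewrite /mpoly.mmap1 !big_ord_recl big_ord0 /= mulr1 !mulrA.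
Qed.

Section Weight.
Variables (I : Type) (s : seq I) (k : I -> C) (e1 e2 e3 e4 : I -> nat) (w : nat).

Let weight i := (2 * e2 i + 3 * e3 i + 4 * e4 i)%N.

(** Both sides are polynomials in t that agree off 0, and their coefficients of t^w are compared.
    Since 0^0 = 1, setting the first variable to 0 keeps exactly the monomials with [e1 i = 0]. *)
Lemma weight_component b c d x :
  (forall t, t != 0 -> \sum_(i <- s) k i * (0 ^+ e1 i * (t ^+ 2 * b) ^+ e2 i
     * (t ^+ 3 * c) ^+ e3 i * (t ^+ 4 * d) ^+ e4 i) = t ^+ w * x) ->
  x = \sum_(i <- s | (e1 i == 0)%N && (weight i == w))
    k i * (b ^+ e2 i * c ^+ e3 i * d ^+ e4 i).
Proof.
move=> h; pose g m := k m * (b ^+ e2 m * c ^+ e3 m * d ^+ e4 m).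
pose p : {poly C} := \sum_(m <- s | (e1 m == 0)%N) g m *: 'X^(weight m) - x *: 'X^w.
have p0 : p = 0.
  apply: (@isO_poly0 _ (size p)) => //; exists 0, 1; split=> // t t0 _.
  suff -> : p.[t] = 0 by rewrite nrm0 mul0r.
  rewrite hornerD hornerN hornerZ hornerXn horner_sum; apply/eqP; rewrite subr_eq0; apply/eqP.
  rewrite mulrC -h // [RHS](bigID (fun m => (e1 m == 0)%N)) /= [X in _ + X]big1 ?addr0.
    apply: eq_bigr => m /eqP e; rewrite hornerZ hornerXn e expr0 mul1r /g /weight.
    have -> : t ^+ (2 * e2 m + 3 * e3 m + 4 * e4 m) =
        (t ^+ 2) ^+ e2 m * (t ^+ 3) ^+ e3 m * (t ^+ 4) ^+ e4 m by rewrite -!exprM -!exprD.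
    rewrite (exprMn_comm _ (mulrC (t ^+ 2) b)) (exprMn_comm _ (mulrC (t ^+ 3) c)).
    by rewrite (exprMn_comm _ (mulrC (t ^+ 4) d)); ring.
  by move=> m /negbTE e; rewrite expr0n e !mul0r mulr0.
have : p`_w = 0 by rewrite p0 coef0.
rewrite coefB coefZ coefXn eqxx mulr1 coef_sum => /eqP; rewrite subr_eq0 => /eqP <-.
rewrite big_mkcondr; apply: eq_bigr => m _; rewrite coefZ coefXn eq_sym.
by case: (weight m == w); rewrite ?mulr1 ?mulr0.
Qed.

End Weight.

(** The only solutions of 2 i + 3 j + 4 k = 4 are (2, 0, 0) and (0, 0, 1). A and B are chosen before
    b, c, d and x, so one pair of constants serves all lattices and all z. *)
Lemma weight4_component f : poly4 f -> exists A B : C, forall b c d x,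
  (forall t, t != 0 -> f 0 (t ^+ 2 * b) (t ^+ 3 * c) (t ^+ 4 * d) = t ^+ 4 * x) ->
  x = A * b ^+ 2 + B * d.
Proof.
move=> [I [s [k [e1 [e2 [e3 [e4 fE]]]]]]].
pose P i := (e1 i == 0)%N && (2 * e2 i + 3 * e3 i + 4 * e4 i == 4)%N.
exists (\sum_(i <- s | P i && (e2 i == 2)%N) k i), (\sum_(i <- s | P i && (e2 i != 2)%N) k i).
move=> b c d x h; rewrite (@weight_component I s k e1 e2 e3 e4 4 b c d x); last first.
  by move=> t t0; rewrite -fE h.
rewrite (bigID (fun i => (e2 i == 2)%N)) /= !mulr_suml; congr (_ + _).
  apply: eq_bigr => i /andP[/andP[_ w4] /eqP e]; rewrite e.
  have -> : e3 i = 0%N by lia.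
  have -> : e4 i = 0%N by lia.
  by rewrite !expr0 !mulr1.
apply: eq_bigr => i /andP[/andP[_ w4] e].
have -> : e2 i = 0%N by lia.
have -> : e3 i = 0%N by lia.
have -> : e4 i = 1%N by lia.
by rewrite !expr0 !mul1r expr1.
Qed.

Lemma weight5_component f : poly4 f -> exists A : C, forall b c d x,
  (forall t, t != 0 -> f 0 (t ^+ 2 * b) (t ^+ 3 * c) (t ^+ 4 * d) = t ^+ 5 * x) ->
  x = A * (b * c).
Proof.
move=> [I [s [k [e1 [e2 [e3 [e4 fE]]]]]]].
exists (\sum_(i <- s | (e1 i == 0)%N && (2 * e2 i + 3 * e3 i + 4 * e4 i == 5)%N) k i).
move=> b c d x h; rewrite (@weight_component I s k e1 e2 e3 e4 5 b c d x); last first.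
  by move=> t t0; rewrite -fE h.
rewrite mulr_suml; apply: eq_bigr => i /andP[_ w5].
have -> : e2 i = 1%N by lia.
have -> : e3 i = 1%N by lia.
have -> : e4 i = 0%N by lia.
by rewrite !expr1 expr0 mulr1.
Qed.

Variable P : nat -> mpoly.mpoly 4 rat.
Hypothesis hP : fKr_polynomials R P.

(* The differential equations of the Weierstrass function, in the form
   wp'' = 6 wp^2 - g2 / 2 and wp''' = 12 wp wp'. Homogeneity of the universal
   polynomials forces their shape, and the pole at 0 the coefficients. *)
Lemma bsum45_formula (y : R) : 1 <= y <= 2 -> exists2 d : R, 0 < d &
  forall z, z != 0 -> nrm z <= d ->
  bsum (rpoint y) 4 z = bsum (rpoint y) 2 z ^+ 2 - 60 * eis (rpoint y) 4 / 10 /\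
  bsum (rpoint y) 5 z = bsum (rpoint y) 2 z * bsum (rpoint y) 3 z.
Proof.
have [A [B hAB]] := weight4_component (poly4_eval4 (P 5)).
have [D hD] := weight5_component (poly4_eval4 (P 6)).
have H (y' : R) : 1 <= y' -> exists2 d : R, 0 < d & forall z, z != 0 -> nrm z <= d ->
    bsum (rpoint y') 4 z / 4 + bsum (rpoint y') 2 z ^+ 2 / 8 =
      A * bsum (rpoint y') 2 z ^+ 2 + B * (60 * eis (rpoint y') 4) /\
    bsum (rpoint y') 5 z / 5 + bsum (rpoint y') 2 z * bsum (rpoint y') 3 z / 6 =
      D * (bsum (rpoint y') 2 z * (- 2 * bsum (rpoint y') 3 z)).
  move=> y1; have [d d0 h] := fKr_polynomials_lattice hP y1; exists d => // z z0 zd.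
  (* With alpha = 0 and scale t^-1, the parameters become t^2 B_2, -2 t^3 B_3 and t^4 g2, as the
     weight lemmas require. *)
  have V (t : C) k : (t^-1) ^- k = t ^+ k by rewrite exprVn invrK.
  split.
    apply: (hAB _ (- 2 * bsum (rpoint y') 3 z)) => t t0.
    have := h z z0 zd t^-1 0 (invr_neq0 t0) 5%N isT; rewrite !V /= /exp_coef4 => E.
    by rewrite mulrCA E; field.
  apply: (hD _ _ (60 * eis (rpoint y') 4)) => t t0.
  have := h z z0 zd t^-1 0 (invr_neq0 t0) 6%N isT; rewrite !V /= /exp_coef5 => E.
  by rewrite mulrCA E; field.
have le1 : 1 <= 1 :> R by [].
(* The constants do not depend on y, so the square lattice suffices. After multiplication by z^4,
   the coefficients of 1 and z^4 give A and, since G_4 != 0, B; after multiplication by z^5, the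
   constant term of the other identity gives D. *)
have [A38 B40 D60] : [/\ A = 3 / 8, B = - (1 / 40) & D = - (11 / 60)].
  have [d d0 h] := H 1 le1.
  pose b k := bsum (rpoint (1 : R)) k; pose G4 : C := eis (rpoint 1) 4.
  have G40 : G4 != 0 by apply: eis4_neq0; rewrite lexx; lra.
  pose X (z : C) := z ^+ 2 * b 2%N z.
  have hX : isO 5 (fun z => X z - (1 + 3 * G4 * z ^+ 4)).
    apply: (@eq_isO _ _ (fun z => (X z - (1 + 3 * G4 * z ^+ 4 + 5 * eis (rpoint 1) 6 * z ^+ 6))
      + 5 * eis (rpoint 1) 6 * z ^+ 6)); first by move=> z; ring.
    apply: isOD; first by apply: isO_le (laurent_bsum2 le1).
    by apply: (@isO_le _ _ 6) => //; apply: (@isOM _ 0 6); [exact: isO_cst | exact: isO_X].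
  have hb4 : isO 5 (fun z => z ^+ 4 * b 4%N z - 1).
    apply: (@isO_near _ _ _ _ 1 ltr01 _ (isOM (isO_X R 4) (bsum4_expansion (rpoint_ge le1)))).
    by move=> z z0 _; rewrite /b; field.
  have hX0 : isO 0 X.
    apply: (@eq_isO _ _ (fun z => (X z - (1 + 3 * G4 * z ^+ 4)) + (1 + 3 * G4 * z ^+ 4))).
      by move=> z; rewrite subrK.
    apply: isOD; first exact: isO_le hX.
    apply: isO_polyfun; apply: polyfunD; [exact: polyfun_cst | exact: polyfun_monomial].
  have hXX : isO 5 (fun z => X z ^+ 2 - (1 + 6 * G4 * z ^+ 4)).
    apply: (@eq_isO _ _ (fun z => (X z - (1 + 3 * G4 * z ^+ 4)) * (X z + (1 + 3 * G4 * z ^+ 4))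
       + z ^+ 5 * (9 * G4 ^+ 2 * z ^+ 3))); first by move=> z; ring.
    apply: isOD; last by apply: isO_Xpoly; exact: polyfun_monomial.
    apply: (@isOM _ 5 0) => //; apply: isOD => //.
    apply: isO_polyfun; apply: polyfunD; [exact: polyfun_cst | exact: polyfun_monomial].
  have M4 : isO 5 (fun z => quintic (3 / 8 - A) 0 0 0 ((3 / 4 - 6 * A - 60 * B) * G4) 0 z).
    apply: (@isO_near _ _ (fun z => - ((z ^+ 4 * b 4%N z - 1) * (1 / 4)
      + (1 / 8 - A) * (X z ^+ 2 - (1 + 6 * G4 * z ^+ 4)))) _ d d0).
      move=> z z0 zd; have [E _] := h z z0 zd.
      have {}E : b 4%N z = 4 * (A * b 2%N z ^+ 2 + B * (60 * G4) - b 2%N z ^+ 2 / 8).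
        by rewrite /b /G4 -E; field.
      by rewrite /quintic /X E; field.
    apply: isON; apply: isOD; first by apply: (@isOM _ 5 0) => //; exact: isO_cst.
    by apply: (@isOM _ 0 5) => //; exact: isO_cst.
  have C4 : forall i, (i < 5)%N -> [:: 3 / 8 - A; 0; 0; 0; (3 / 4 - 6 * A - 60 * B) * G4]`_i = 0.
    apply: isO_coef0; apply: eq_isO M4 => z.
    by rewrite !big_ord_recr big_ord0 /= /quintic; ring.
  have A38 : A = 3 / 8 by apply/esym/eqP; rewrite -subr_eq0; apply/eqP; exact: (C4 0%N).
  have B40 : B = - (1 / 40).
    have /eqP := C4 4%N isT; rewrite /= mulf_eq0 (negbTE G40) orbF A38 => /eqP e.
    have -> : B = (3 / 4 - 6 * (3 / 8) - (3 / 4 - 6 * (3 / 8) - 60 * B)) / 60 by field.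
    by rewrite e; field.
  split=> //.
  pose Y (z : C) := z ^+ 3 * b 3%N z.
  have hX1 : isO 1 (fun z => X z - 1).
    apply: (@eq_isO _ _ (fun z => (X z - (1 + 3 * G4 * z ^+ 4)) + 3 * G4 * z ^+ 4)).
      by move=> z; ring.
    apply: isOD; first exact: isO_le hX.
    by apply: (@isO_le _ _ 4) => //; apply: (@isOM _ 0 4); [exact: isO_cst | exact: isO_X].
  have hY1 : isO 1 (fun z => Y z - 1).
    apply: (@eq_isO _ _ (fun z => (Y z - (1 - 3 * G4 * z ^+ 4 - 10 * eis (rpoint 1) 6 * z ^+ 6))
      + z ^+ 1 * (- 3 * G4 * z ^+ 3 + - 10 * eis (rpoint 1) 6 * z ^+ 5))); first by move=> z; ring.
    apply: isOD; first by apply: isO_le (laurent_bsum3 le1).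
    by apply: isO_Xpoly; apply: polyfunD; exact: polyfun_monomial.
  have hb5 : isO 5 (fun z => z ^+ 5 * b 5%N z - 1).
    apply: (@isO_near _ _ _ _ 1 ltr01 _ (isOM (isO_X R 5) (bsum5_expansion (rpoint_ge le1)))).
    by move=> z z0 _; rewrite /b; field.
  have hXY : isO 1 (fun z => X z * Y z - 1).
    apply: (@eq_isO _ _ (fun z => X z * (Y z - 1) + (X z - 1))); first by move=> z; ring.
    by apply: isOD => //; exact: (@isOM _ 0 1).
  have M5 : 1 / 5 + 1 / 6 + 2 * D = 0.
    apply: isO1_cst.
    apply: (@isO_near _ _ (fun z => - ((z ^+ 5 * b 5%N z - 1) * (1 / 5)
      + (1 / 6 + 2 * D) * (X z * Y z - 1))) _ d d0).
      move=> z z0 zd; have [_ E] := h z z0 zd.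
      have {}E : b 5%N z = 5 * (D * (b 2%N z * (- 2 * b 3%N z)) - b 2%N z * b 3%N z / 6).
        by rewrite /b -E; field.
      by rewrite /X /Y E; field.
    apply: isON; apply: isOD.
      apply: (@isO_le _ _ 5) => //; apply: (@isOM _ 5 0) => //; exact: isO_cst.
    by apply: (@isOM _ 0 1) => //; exact: isO_cst.
  have -> : D = ((1 / 5 + 1 / 6 + 2 * D) - 1 / 5 - 1 / 6) / 2 by field.
  by rewrite M5; field.
move=> /andP[y1 _]; have [d d0 h] := H y y1; exists d => // z z0 zd.
have [E4 E5] := h z z0 zd; split.
  have -> : bsum (rpoint y) 4 z = 4 * ((bsum (rpoint y) 4 z / 4 + bsum (rpoint y) 2 z ^+ 2 / 8)
      - bsum (rpoint y) 2 z ^+ 2 / 8) by field.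
  by rewrite E4 A38 B40; field.
have -> : bsum (rpoint y) 5 z = 5 * ((bsum (rpoint y) 5 z / 5
   + bsum (rpoint y) 2 z * bsum (rpoint y) 3 z / 6)
   - bsum (rpoint y) 2 z * bsum (rpoint y) 3 z / 6) by field.
by rewrite E5 D60; field.
Qed.

End UniversalCoefficients.

(** * The functional equation *)

Section FinalArgument.
Variable R : realType.
Local Notation C := (cplx R).

Lemma poly4_list (l : seq (C * (nat * nat * nat * nat))) : poly4 (fun a b c d : C =>
  \sum_(u <- l) u.1 * (a ^+ u.2.1.1.1 * b ^+ u.2.1.1.2 * c ^+ u.2.1.2 * d ^+ u.2.2)).
Proof.
by exists _, l, (fun u => u.1), (fun u => u.2.1.1.1), (fun u => u.2.1.1.2),
  (fun u => u.2.1.2), (fun u => u.2.2).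
Qed.

(** The arguments are B_k / k for k = 2, ..., 5, with B_2 = b, B_3 = -c / 2, B_4 = b^2 - d / 10 and
    B_5 = -b c / 2. *)
Definition fKr_coef (a b c d : C) : seq C :=
  fKr_coefs a (b / 2) (- c / 6) (b ^+ 2 / 4 - d / 40) (- (b * c) / 10).

Lemma poly4_fKr_coef n : (n < 7)%N -> poly4 (fun a b c d => (fKr_coef a b c d)`_n).
Proof.
pose L : seq (seq (C * (nat * nat * nat * nat))) :=
  [:: [::]; [:: (1, (0, 0, 0, 0)%N)]; [:: (1, (1, 0, 0, 0)%N)];
      [:: (1 / 2, (0, 1, 0, 0)%N); (1 / 2, (2, 0, 0, 0)%N)];
      [:: (- (1 / 6), (0, 0, 1, 0)%N); (1 / 2, (1, 1, 0, 0)%N); (1 / 6, (3, 0, 0, 0)%N)];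
      [:: (3 / 8, (0, 2, 0, 0)%N); (- (1 / 40), (0, 0, 0, 1)%N); (- (1 / 6), (1, 0, 1, 0)%N);
          (1 / 4, (2, 1, 0, 0)%N); (1 / 24, (4, 0, 0, 0)%N)];
      [:: (- (11 / 60), (0, 1, 1, 0)%N); (3 / 8, (1, 2, 0, 0)%N); (- (1 / 40), (1, 0, 0, 1)%N);
          (- (1 / 12), (2, 0, 1, 0)%N); (1 / 12, (3, 1, 0, 0)%N); (1 / 120, (5, 0, 0, 0)%N)]].
move=> n7; apply: eq_poly4 (poly4_list (nth [::] L n)) => a b c d.
rewrite /fKr_coef /fKr_coefs /exp_coef2 /exp_coef3 /exp_coef4 /exp_coef5.
move: n n7; do 7 (case; [by move=> _; rewrite /= ?big_cons big_nil /=; field | ]).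
by [].
Qed.

Lemma universal_coefs (P : nat -> mpoly.mpoly 4 rat) : fKr_polynomials R P ->
  forall n, (n < 7)%N -> forall a b c d : C, eval4 (P n) a b c d = (fKr_coef a b c d)`_n.
Proof.
move=> hP n n7 a b c d; apply/eqP; rewrite -subr_eq0; apply/eqP.
have : poly4 (fun a b c d : C => eval4 (P n) a b c d + (-1) * (fKr_coef a b c d)`_n).
  by apply: poly4D; [exact: poly4_eval4 | apply: poly4Z; exact: poly4_fKr_coef].
move=> [I [s [k [e1 [e2 [e3 [e4 E]]]]]]].
have -> : eval4 (P n) a b c d - (fKr_coef a b c d)`_n =
    \sum_(i <- s) k i * (a ^+ e1 i * b ^+ e2 i * c ^+ e3 i * d ^+ e4 i).
  by rewrite -E mulN1r.
apply: lattice_dense => y y12; have /andP[y1 _] := y12.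
have [d1 d10 h1] := fKr_polynomials_lattice hP y1.
have [d2 d20 h2] := bsum45_formula hP y12.
exists (Num.min d1 d2); first by rewrite lt_min d10.
move=> z z0; rewrite le_min => /andP[z1 z2] t x t0.
have [E4 E5] := h2 z z0 z2.
rewrite -E (h1 z z0 z1 t x t0 n n7) /fKr_coef mulN1r.
set c3 := - (- 2 * _) / 6; set c4 := _ - _ / 40; set c5 := - (_ * _) / 10.
have -> : c3 = t ^- 3 * bsum (rpoint y) 3 z / 3 by rewrite /c3; field.
have -> : c4 = t ^- 4 * bsum (rpoint y) 4 z / 4 by rewrite /c4 E4; field.
have -> : c5 = t ^- 5 * bsum (rpoint y) 5 z / 5 by rewrite /c5 E5; field.
by rewrite subrr.
Qed.

(* The functional equation at the four points 0, z, 2 z, 3 z, with denominators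
   cleared and f (k z) = k z F (k z). *)
Lemma hirzebruch4_arith (f : C -> C) (q1 q2 q3 q4 q5 : C) : hirzebruch4 f ->
  isO 6 (fun z => f z / z - quintic 1 q1 q2 q3 q4 q5 z) ->
  let F z := f z / z in
  exists2 d : R, 0 < d & forall z, z != 0 -> nrm z <= d ->
    F (z * - 1) * F (z * - 2) * F (z * - 3) - 3 * (F (z * - 2) * F (z * - 3) * F (z * 3))
    + 3 * (F (z * 3) * F (z * - 3) * F (z * 2)) - F (z * 1) * F (z * 2) * F (z * 3) = 0.
Proof.
move=> [r r0 H] hF F.
have [d d0 hd] : exists2 d : R, 0 < d & forall z, z != 0 -> nrm z <= d -> 1 / 2 <= nrm (F z).
  apply: isO_inv_near1.
  apply: (@eq_isO _ _ (fun z => (F z - quintic 1 q1 q2 q3 q4 q5 z)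
    + z ^+ 1 * (q1 + q2 * z ^+ 1 + q3 * z ^+ 2 + q4 * z ^+ 3 + q5 * z ^+ 4))).
    by move=> z; rewrite /quintic; ring.
  apply: isOD; first exact: isO_le hF.
  apply: isO_Xpoly; do 4 (apply: polyfunD; last exact: polyfun_monomial).
  exact: polyfun_cst.
have fn0 z : z != 0 -> nrm z <= d -> f z != 0.
  move=> z0 zd; apply/eqP => e; have := hd z z0 zd; rewrite /F e mul0r nrm0; lra.
(* The points differ by at most 6 |z|, from the crude bound i + j <= 6; the 7 keeps the comparison
   with r strict. *)
exists (Num.min (d / 6) (r / 7)); first by rewrite lt_min !divr_gt0.
move=> z z0; rewrite le_min => /andP[zd zr].
have nz : 0 < nrm z by rewrite nrm_gt0.
pose x (i : 'I_4) : C := (i : nat)%:R * z.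
have xE (i j : 'I_4) : x j - x i = z * ((j : nat)%:R - (i : nat)%:R) by rewrite /x; ring.
have xn (i j : 'I_4) : i != j -> x j - x i != 0 /\ nrm (x j - x i) <= 6 * nrm z.
  move=> ij; rewrite xE; split.
    by rewrite mulf_neq0 // subr_eq0 eqr_nat; apply: contraNN ij => /eqP /val_inj ->.
  rewrite nrmM mulrC ler_wpM2r ?nrm_ge0 //; apply: le_trans (nrmB _ _) _.
  rewrite !nrm_nat -natrD ler_nat; have := ltn_ord i; have := ltn_ord j; lia.
have := H x; have hx (i j : 'I_4) : i != j -> `|x j - x i| < r%:C%C /\ f (x j - x i) != 0.
  move=> ij; have [h1 h2] := xn i j ij; split; first by rewrite nrm_ltC; lra.
  by apply: fn0 => //; lra.
move=> /(_ hx).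
have fF k : z * k != 0 -> f (z * k) = z * k * F (z * k).
  by move=> zk; rewrite /F mulrCA divff // mulr1.
under eq_bigr do rewrite big_mkcond /=.
rewrite !big_ord_recl !big_ord0 /= !xE /=.
rewrite (_ : bump 0 0 = 1)%N // (_ : bump 0 1 = 2)%N // (_ : bump 0 2 = 3)%N //.
rewrite !subr0 !sub0r.
have [-> -> ->] : [/\ 2%:R - 1%:R = 1 :> C, 3%:R - 1%:R = 2 :> C & 3%:R - 2%:R = 1 :> C].
  by split; ring.
have [-> -> ->] : [/\ 1%:R - 2%:R = - 1 :> C, 1%:R - 3%:R = - 2 :> C & 2%:R - 3%:R = - 1 :> C].
  by split; ring.
have K k : k != 0 -> nrm k <= 3 -> z * k != 0 /\ F (z * k) != 0.
  move=> k0 k3; have zk0 : z * k != 0 by rewrite mulf_neq0.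
  split=> //; have zk : nrm (z * k) <= d.
    by rewrite nrmM; have : nrm z * nrm k <= nrm z * 3 by [rewrite ler_wpM2l ?nrm_ge0]; lra.
  by have := hd _ zk0 zk; apply: contraTneq => ->; rewrite nrm0 -ltNge; lra.
have n2 : (2 : C) != 0 by rewrite pnatr_eq0.
have n3 : (3 : C) != 0 by rewrite pnatr_eq0.
have [z1 F1] : z * 1 != 0 /\ F (z * 1) != 0 by apply: K; rewrite ?oner_neq0 ?nrm1 //; lra.
have [z2 F2] : z * 2 != 0 /\ F (z * 2) != 0 by apply: K; rewrite ?nrm_nat //; lra.
have [z3 F3] : z * 3 != 0 /\ F (z * 3) != 0 by apply: K; rewrite ?nrm_nat.
have [y1 G1] : z * - 1 != 0 /\ F (z * - 1) != 0.
  by apply: K; rewrite ?oppr_eq0 ?oner_neq0 ?nrmN ?nrm1 //; lra.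
have [y2 G2] : z * - 2 != 0 /\ F (z * - 2) != 0.
  by apply: K; rewrite ?oppr_eq0 ?nrmN ?nrm_nat //; lra.
have [y3 G3] : z * - 3 != 0 /\ F (z * - 3) != 0.
  by apply: K; rewrite ?oppr_eq0 ?nrmN ?nrm_nat.
rewrite !fF //.
move: (F (z * 1)) (F (z * 2)) (F (z * 3)) (F (z * - 1)) (F (z * - 2)) (F (z * - 3))
  F1 F2 F3 G1 G2 G3 => f1 f2 f3 g1 g2 g3 F1 F2 F3 G1 G2 G3 E.
(* The products of the differences for i = 0, ..., 3 are 6, -2, 2 and -6 times z^3. Multiplying by 6
   z^3 and the six values of F produces the coefficients -1, 3, -3, 1. *)
transitivity (6 * z ^+ 3 * (f1 * f2 * f3 * g1 * g2 * g3) * 0); last by rewrite mulr0.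
rewrite -[in RHS]E; field.
by rewrite z0 F1 F2 F3 G1 G2 G3.
Qed.

Lemma eqO6_quinticM (f g : C -> C) d0 d1 d2 d3 d4 d5 e0 e1 e2 e3 e4 e5 :
  eqO6 f (quintic d0 d1 d2 d3 d4 d5) -> eqO6 g (quintic e0 e1 e2 e3 e4 e5) ->
  eqO6 (fun z => f z * g z) (quintic (d0 * e0) (d0 * e1 + d1 * e0)
    (d0 * e2 + d1 * e1 + d2 * e0) (d0 * e3 + d1 * e2 + d2 * e1 + d3 * e0)
    (d0 * e4 + d1 * e3 + d2 * e2 + d3 * e1 + d4 * e0)
    (d0 * e5 + d1 * e4 + d2 * e3 + d3 * e2 + d4 * e1 + d5 * e0)).
Proof.
move=> hf hg; have := eqO6M hf hg.
move=> /(@eqO6_trans_poly _ _ _ _ (fun z => (d1 * e5 + d2 * e4 + d3 * e3 + d4 * e2 + d5 * e1)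
  + (d2 * e5 + d3 * e4 + d4 * e3 + d5 * e2) * z ^+ 1 + (d3 * e5 + d4 * e4 + d5 * e3) * z ^+ 2
  + (d4 * e5 + d5 * e4) * z ^+ 3 + d5 * e5 * z ^+ 4)); apply.
- by do 4 (apply: polyfunD; last exact: polyfun_monomial); exact: polyfun_cst.
- exact: polyfun_quintic.
- by move=> z; rewrite /quintic; ring.
Qed.

(** The cubic expression changes sign under z -> -z, so its even coefficients vanish identically,
    and so does that of z. The first conditions on f thus come from z^3 and z^5. *)
Lemma hirzebruch4_coefs (f : C -> C) (q1 q2 q3 q4 q5 : C) : hirzebruch4 f ->
  isO 6 (fun z => f z / z - quintic 1 q1 q2 q3 q4 q5 z) ->
  - 24 * q3 + 120 * (q1 * q2) - 120 * q1 ^+ 3 = 0 /\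
  - 360 * q5 + 408 * (q2 * q3) + 1320 * (q1 * q4) + 840 * (q1 * q2 ^+ 2)
    - 2544 * (q1 ^+ 2 * q3) = 0.
Proof.
move=> hf hF; have [d d0 h] := hirzebruch4_arith hf hF.
pose F z := f z / z.
have FQ k : k != 0 -> eqO6 (fun z => F (z * k))
    (quintic 1 (k * q1) (k ^+ 2 * q2) (k ^+ 3 * q3) (k ^+ 4 * q4) (k ^+ 5 * q5)).
  move=> k0; split; last by apply: isO_polyfun; exact: polyfun_quintic.
  apply: eq_isO (isO_scale 1 (invr_neq0 k0) hF) => z.
  by rewrite invrK mul1r /F; congr (_ - _); rewrite /quintic; ring.
have n2 : (2 : C) != 0 by rewrite pnatr_eq0.
have n3 : (3 : C) != 0 by rewrite pnatr_eq0.
have m1 : (- 1 : C) != 0 by rewrite oppr_eq0 oner_neq0.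
have m2 : (- 2 : C) != 0 by rewrite oppr_eq0.
have m3 : (- 3 : C) != 0 by rewrite oppr_eq0.
have [T1 _] := eqO6_quinticM (eqO6_quinticM (FQ _ m1) (FQ _ m2)) (FQ _ m3).
have [T2 _] := eqO6_quinticM (FQ _ m2) (eqO6_quinticM (FQ _ m3) (FQ _ n3)).
have [T3 _] := eqO6_quinticM (eqO6_quinticM (FQ _ n3) (FQ _ m3)) (FQ _ n2).
have [T4 _] := eqO6_quinticM (eqO6_quinticM (FQ _ (oner_neq0 _)) (FQ _ n2)) (FQ _ n3).
have S c g : isO 6 g -> isO 6 (fun z : C => c * g z).
  by move=> hg; apply: (@isOM _ 0 6) => //; exact: isO_cst.
have T := isOB (isOD (isOB T1 (S 3 _ T2)) (S 3 _ T3)) T4.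
suff hXY : isO 6 (quintic 0 0 0 (- 24 * q3 + 120 * (q1 * q2) - 120 * q1 ^+ 3) 0
   (- 360 * q5 + 408 * (q2 * q3) + 1320 * (q1 * q4) + 840 * (q1 * q2 ^+ 2)
    - 2544 * (q1 ^+ 2 * q3))).
  by have [_ _ _ HX [_ HY]] := isO_quintic0 hXY.
apply: (@isO_near _ _ _ _ d d0 _ (isON T)) => z z0 zd.
have := h z z0 zd; rewrite -!/(F _).
move: (F (z * 1)) (F (z * 2)) (F (z * 3)) (F (z * - 1)) (F (z * - 2)) (F (z * - 3)).
move=> f1 f2 f3 g1 g2 g3 E.
apply: (addIr (g1 * g2 * g3 - 3 * (g2 * g3 * f3) + 3 * (f3 * g3 * f2) - f1 * f2 * f3)).
rewrite [in RHS]E addr0 /quintic; ring.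
Qed.

Lemma hirzebruch4_parameters (a b c d : C) : a != 0 ->
  let q2 := exp_coef2 a (b / 2) in
  let q3 := exp_coef3 a (b / 2) (- c / 6) in
  let q4 := exp_coef4 a (b / 2) (- c / 6) (b ^+ 2 / 4 - d / 40) in
  let q5 := exp_coef5 a (b / 2) (- c / 6) (b ^+ 2 / 4 - d / 40) (- (b * c) / 10) in
  - 24 * q3 + 120 * (a * q2) - 120 * a ^+ 3 = 0 ->
  - 360 * q5 + 408 * (q2 * q3) + 1320 * (a * q4) + 840 * (a * q2 ^+ 2)
    - 2544 * (a ^+ 2 * q3) = 0 ->
  c = 4 * a * (4 * a ^+ 2 - 3 * b) /\
  d = 4 * (32 * a ^+ 4 - 24 * a ^+ 2 * b + 3 * b ^+ 2).
Proof.
move=> a0 /=; rewrite /exp_coef2 /exp_coef3 /exp_coef4 /exp_coef5 => X0 Y0.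
have cE : c = 4 * a * (4 * a ^+ 2 - 3 * b).
  apply/eqP; rewrite -subr_eq0; apply/eqP.
  have n4 : (4 : C) != 0 by rewrite pnatr_eq0.
  by apply: (mulfI n4); rewrite mulr0 -[RHS]X0; field.
split=> //; apply/eqP; rewrite -subr_eq0; apply/eqP.
(* In the second relation d occurs only through q5 and a q4, with total coefficient 9 a - 33 a = -24
   a. *)
have n24 : (- 24 : C) * a != 0 by rewrite mulf_neq0 ?oppr_eq0 ?pnatr_eq0.
by apply: (mulfI n24); rewrite mulr0 -[RHS]Y0 cE; field.
Qed.

End FinalArgument.

Theorem lemma7p2 (R : realType) (alpha beta gamma lambda : cplx R)
    (f : cplx R -> cplx R)
    (halpha : alpha != 0)
    (hf : is_fKr alpha beta gamma lambda f)
    (heq : hirzebruch4 f) :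
  gamma = 4 * alpha * (4 * alpha ^+ 2 - 3 * beta) /\
  lambda = 4 * (32 * alpha ^+ 4 - 24 * alpha ^+ 2 * beta + 3 * beta ^+ 2).
Proof.
have [P [hP hT]] := hf; have E := universal_coefs hP.
have T := taylor_remainder hT 7.
have hF : isO 6 (fun z => f z / z - exp_quintic alpha (beta / 2) (- gamma / 6)
    (beta ^+ 2 / 4 - lambda / 40) (- (beta * gamma) / 10) z).
  apply: (@isO_divX _ 1 6); apply: (@isO_near _ _ _ _ 1 ltr01 _ T) => z z0 _.
  rewrite !big_ord_recr big_ord0 /= !E //= /exp_quintic /quintic expr1 mulrBr.
  by rewrite [z * (_ / _)]mulrCA divff // mulr1; congr (_ - _); ring.
have [X Y] := hirzebruch4_coefs heq hF.
exact: hirzebruch4_parameters halpha X Y.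
Qed.
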